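(* Let $n$ be a positive integer. There exists a subset $W\subset LI^n$ which is open and dense and has full Lebesgue measure, such that for each $n\times n$ matrix $\mathcal M\in W$, with completely mixed Nash equilibrium $(\bar p,\bar q)$, the following holds: 1. $(\bar p,\bar q)\in\Sigma\times\Sigma$ is the unique Nash equilibrium of the zero-sum game best response dynamics $$\frac{dp}{dt}\in BR_p(q)-p,\qquad \frac{dq}{dt}\in BR_q(p)-q$$ associated to $\mathcal M$, where $BR_p(q)=\arg\max_{x\in\Sigma}x'\mathcal Mq$ and $BR_q(p)=\arg\min_{y\in\Sigma}p'\mathcal My$. 2. The flow $\phi_t$ associated to this differential inclusion exists, is unique and continuous outside $(\bar p,\bar q)$. 3. For each $\rho>0$ small, each half-ray through $(\bar p,\bar q)$ intersects $H^{-1}(\rho)$ in a unique point. Let $\pi\colon(\Sigma\times\Sigma)\setminus\{(\bar p,\bar q)\}\to H^{-1}(\rho)$ be the corresponding continuous map (sending each point of a half-ray starting at $(\bar p,\bar q)$ to the intersection of that half-ray with $H^{-1}(\rho)$). Then $\pi\circ\phi_t$ is the flow on $H^{-1}(\rho)$ of a Hamiltonian vector field corresponding to $H$ and the symplectic form $\sum_{ij}a_{ij}\,dp_i\wedge dq_j$, where $(a_{ij})$ are the coefficients of the matrix $A:=\mathcal M$.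
   Context: Vectors are column vectors, and a prime denotes transpose. $\Sigma\subset\mathbb R^n$ is the set of probability vectors, and $T\Sigma$ is the set of vectors in $\mathbb R^n$ whose components sum to zero. $\underline 1=(1,\dots,1)\in\mathbb R^n$. $L^n$ is the space of all real $n\times n$ matrices. $LI^n\subset L^n$ is the set of $n\times n$ matrices $\mathcal M$ with a completely mixed Nash equilibrium, i.e. such that there exist unique $\bar p,\bar q\in\Sigma$ all of whose components are strictly positive with $\bar p'\mathcal M=\lambda\underline 1'$ and $\mathcal M\bar q=\mu\underline 1$ for some $\lambda,\mu\in\mathbb R$. A Nash equilibrium is a pair $(p,q)\in\Sigma\times\Sigma$ with $p\in BR_p(q)$ and $q\in BR_q(p)$. $H(p,q)=\max_{x\in\Sigma}x'\mathcal Mq-\min_{y\in\Sigma}p'\mathcal My$ for $(p,q)\in\Sigma\times\Sigma$, which equals $BR_p(q)'\mathcal Mq-p'\mathcal M BR_q(p)$. The Hamiltonian vector field $X_H$ for $\omega=\sum a_{ij}dp_i\wedge dq_j$ is the vector field tangent to $\Sigma\times\Sigma$ with $\omega(X_H,Y)=dH(Y)$ for all vector fields $Y$ tangent to $\Sigma\times\Sigma$. Where $BR_p(q)$ or $BR_q(p)$ is not a singleton, $X_H$ is set-valued, obtained by using all elements of $BR_p(q)$ and $BR_q(p)$ as if they were locally constant. For general invertible $A$ the corresponding differential inclusion is $\frac{dp}{dt}\in P_pA'^{-1}\mathcal M'BR_p(q)$, $\frac{dq}{dt}\in P_qA^{-1}\mathcal M BR_q(p)$, where $P_p,P_q\colon\mathbb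 R^n\to T\Sigma$ are the projections onto $T\Sigma$ along $A'^{-1}\underline 1$ and $A^{-1}\underline 1$ respectively. Solutions of differential inclusions are absolutely continuous curves satisfying the inclusion for almost every $t$.
   Formalization: In item 3, π∘φ_t is not literally a flow for n ≥ 2 (the semigroup law fails); the formal claim is that π(φ_t(x)) equals the Hamiltonian flow on H^{-1}(ρ) of π(x) after the time change t ↦ (ρ/H(x))(e^t − 1). *)

(* Defs.v *)
From mathcomp Require Import all_boot all_order all_algebra.
From mathcomp Require Import all_classical all_reals all_analysis.

Set Implicit Arguments.
Unset Strict Implicit.
Unset Printing Implicit Defensive.

Import Order.TTheory GRing.Theory Num.Theory.
Import numFieldNormedType.Exports.

Local Open Scope classical_set_scope.
Local Open Scope ring_scope.

Section Game.
Context {R : realType} {n : nat}.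
Implicit Types (M A : 'M[R]_n) (p q x y : 'cV[R]_n).
Implicit Types z v X Y : 'cV[R]_n * 'cV[R]_n.

Definition simplex : set 'cV[R]_n :=
  [set x : 'cV[R]_n | (forall i, 0 <= x i 0) /\ \sum_i x i 0 = 1].

Definition simplex2 : set ('cV[R]_n * 'cV[R]_n) := simplex `*` simplex.

(* pairs of vectors with zero coordinate sums: T Sigma x T Sigma *)
Definition tangent2 : set ('cV[R]_n * 'cV[R]_n) :=
  [set v : 'cV[R]_n * 'cV[R]_n | \sum_i v.1 i 0 = 0 /\ \sum_i v.2 i 0 = 0].

Definition payoff M p q : R := (p^T *m M *m q) 0 0.

Definition BRp M q : set 'cV[R]_n :=
  [set x | simplex x /\ forall x', simplex x' -> payoff M x' q <= payoff M x q].

Definition BRq M p : set 'cV[R]_n :=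
  [set y | simplex y /\ forall y', simplex y' -> payoff M p y <= payoff M p y'].

Definition nash M : set ('cV[R]_n * 'cV[R]_n) :=
  [set z | simplex2 z /\ BRp M z.2 z.1 /\ BRq M z.1 z.2].

Definition completely_mixed M z : Prop :=
  [/\ simplex2 z,
      forall i, 0 < z.1 i 0,
      forall j, 0 < z.2 j 0,
      exists lambda : R, z.1^T *m M = const_mx lambda
    & exists mu : R, M *m z.2 = const_mx mu].

Definition LI : set 'M[R]_n := [set M | exists! z, completely_mixed M z].

(* Both extrema are attained for 0 < n, so sup and inf are a max and a min. *)
Definition Ham M z : R :=
  sup [set payoff M x z.2 | x in simplex] -
  inf [set payoff M z.1 y | y in simplex].

Definition Ham_level M (rho : R) : set ('cV[R]_n * 'cV[R]_n) :=
  simplex2 `&` [set z | Ham M z = rho].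

Definition half_ray z v : set ('cV[R]_n * 'cV[R]_n) :=
  [set z + s *: v | s in [set s : R | 0 <= s]].

Definition br_field M z : set ('cV[R]_n * 'cV[R]_n) :=
  [set v | BRp M z.2 (v.1 + z.1) /\ BRq M z.1 (v.2 + z.2)].

(* sum_ij a_ij dp_i /\ dq_j, evaluated at two tangent vectors.  The
   coefficients are constant, so the form is closed and only nondegeneracy on
   the tangent space is at stake for it to be symplectic. *)
Definition omega A X Y : R :=
  \sum_i \sum_j A i j * (X.1 i 0 * Y.2 j 0 - Y.1 i 0 * X.2 j 0).

Definition symplectic A : Prop :=
  forall X, tangent2 X -> (forall Y, tangent2 Y -> omega A X Y = 0) -> X = 0.

(* The set-valued vector field X_H of H = Ham M for omega A.  With
   b in BRp M q and c in BRq M p treated as constants, H is the linear function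
   b' M q - p' M c of (p, q), so that dH(Y) = b' M Y.2 - Y.1' M c. *)
Definition ham_field A M z : set ('cV[R]_n * 'cV[R]_n) :=
  [set X | tangent2 X /\
     exists b c, [/\ BRp M z.2 b, BRq M z.1 c &
       forall Y, tangent2 Y ->
         omega A X Y = payoff M b Y.2 - payoff M Y.1 c]].

End Game.

Arguments simplex R n : clear implicits.
Arguments simplex2 R n : clear implicits.
Arguments tangent2 R n : clear implicits.
Arguments LI R n : clear implicits.

(* Lebesgue null sets of matrices, R^(m x n) being given its standard
   coordinates: coverings by countably many boxes of arbitrarily small total
   volume. *)

Definition mx_box {R : realType} {m n : nat} (a b : 'M[R]_(m, n)) :
    set 'M[R]_(m, n) :=
  [set X : 'M[R]_(m, n) | forall i j, a i j <= X i j <= b i j].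

Definition mx_box_volume {R : realType} {m n : nat} (a b : 'M[R]_(m, n)) : R :=
  \prod_i \prod_j (b i j - a i j).

Definition lebesgue_null {R : realType} {m n : nat} (N : set 'M[R]_(m, n)) :
    Prop :=
  forall eps : R, 0 < eps ->
  exists a b : nat -> 'M[R]_(m, n),
    [/\ forall k i j, a k i j <= b k i j,
        N `<=` \bigcup_k mx_box (a k) (b k)
      & (\sum_(0 <= k <oo) (mx_box_volume (a k) (b k))%:E <= eps%:E)%E].

Section Inclusion.
Context {R : realType} {V : normedModType R}.
Implicit Types (J : set R) (c : R -> V) (S D : set V) (F : V -> set V).

Definition abs_continuous_on (a b : R) c : Prop :=
  forall eps : R, 0 < eps -> exists2 delta : R, 0 < delta &
  forall (N : nat) (s t : nat -> R),
    (forall k, (k < N)%N -> a <= s k /\ s k <= t k /\ t k <= b) ->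
    trivIset `I_N (fun k => `]s k, t k[%classic) ->
    \sum_(k < N) (t k - s k) < delta ->
    \sum_(k < N) `|c (t k) - c (s k)| < eps.

(* c is a solution of dc/dt \in F(c) in the state space S over the interval J. *)
Definition solution_on J S F c : Prop :=
  [/\ forall t, J t -> S (c t),
      forall a b, J a -> J b -> abs_continuous_on a b c
    & {ae (@lebesgue_measure R), forall t, J t ->
        exists2 v, F (c t) v & is_derive t (1 : R) c v}].

(* phi is the flow, over the time interval T, of the inclusion dc/dt \in F(c)
   in the state space S, restricted to the invariant set D: every point of D is
   the initial point of a solution, this solution is unique, even among those
   in S which exist only over a subinterval of T, and it depends continuously
   on time and initial point. *)
Record is_flow (T : set R) S F D (phi : R -> V -> V) : Prop := IsFlow {
  flow_in : forall t x, T t -> D x -> D (phi t x);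
  flow0 : forall x, D x -> phi 0 x = x;
  flowD : forall s t x, T s -> T t -> D x -> phi (s + t) x = phi s (phi t x);
  flow_sol : forall x, D x -> solution_on T S F (phi ^~ x);
  flow_uniq : forall x J c, D x -> is_interval J -> J `<=` T -> J 0 ->
    solution_on J S F c -> c 0 = x -> forall t, J t -> c t = phi t x;
  flow_cont : {within T `*` D, continuous (fun tx : R * V => phi tx.1 tx.2)}
}.

End Inclusion.

(* Main.v *)
(* Write u = (p, q) and gain b u = b_1' M q - p' M b_2.  This form is
   antisymmetric, gain b e = 0, and Ham M u is the maximum of gain b u over the
   simplices, attained at the best replies b to u.  Blown up about e, both
   dynamics become u' = c - e with c a best reply to u, and Ham M is constant
   along every solution.  Over a short time the mean c of the replies used is
   still a best reply to the initial point x, and for every best reply b to x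
     gain b u(t) <= Ham M u(t) = Ham M x = gain b x,  that is,  gain b c <= 0:
   c solves the game restricted to the best replies to x.  If the minors of M
   and of its transpose, bordered by a row of ones, do not vanish, then each such
   restricted game has exactly one solution, so that every solution starts with
   a straight segment of known direction.  This gives uniqueness, existence (by
   continuation) and, since nearby solutions have means which nearly solve the
   same restricted game, continuity.  The bordered minors are affine in each
   entry of M; hence where one of them vanishes and a smaller one does not, the
   matrices form a locally Lipschitz graph, which is a null set. *)
Require Import Defs.
From mathcomp Require Import all_boot all_order all_algebra.
From mathcomp Require Import all_classical all_reals all_analysis.
From mathcomp Require Import ring lra zify.

Set Implicit Arguments.
Unset Strict Implicit.
Unset Printing Implicit Defensive.

Import Order.TTheory GRing.Theory Num.Theory.
Import numFieldNormedType.Exports.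

Local Open Scope classical_set_scope.
Local Open Scope ring_scope.

(** * Faces of the simplex *)

Section Faces.
Context {R : realType} {n : nat}.
Implicit Types (M N : 'M[R]_n) (p q x y b c d w : 'cV[R]_n) (I J : {set 'I_n}).

(** Replies are set-valued and derivatives exist only almost everywhere, so nothing is integrated
    directly. Absolute continuity enters through one monotonicity principle, which passes linear
    inequalities from the replies to their mean and conserves [Ham M]. Corners may accumulate, so
    solutions are not concatenated segment by segment: existence, uniqueness and continuity each
    proceed by real induction on time. Since [gain b e = 0], best replies are constant along open
    rays from e and [Ham M] is homogeneous about e. Both dynamics, and their dilations, are
    therefore reparametrisations of a single flow [Psi] on the affine hull of the simplices; a free
    clock in the notion of solution lets one uniqueness proof serve all of them. Running time
    backwards exchanges the aims of the players, which is why the local games carry a sign. For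
    genericity the induction is on the size of a minor, starting from the bordered minor of size
    one, which is the constant 1. *)

Definition dot x y : R := \sum_i x i 0 * y i 0.

Lemma dotC x y : dot x y = dot y x.
Proof. by apply: eq_bigr => i _; rewrite mulrC. Qed.

Lemma dotDr x y w : dot x (y + w) = dot x y + dot x w.
Proof. by rewrite -big_split; apply: eq_bigr => i _; rewrite /= mxE mulrDr. Qed.

Lemma dotZr a x y : dot x (a *: y) = a * dot x y.
Proof. by rewrite mulr_sumr; apply: eq_bigr => i _; rewrite /= mxE mulrCA. Qed.

Lemma dotDl x y w : dot (x + y) w = dot x w + dot y w.
Proof. by rewrite dotC dotDr !(dotC w). Qed.

Lemma dotZl a x y : dot (a *: x) y = a * dot x y.
Proof. by rewrite dotC dotZr dotC. Qed.

Lemma dot_delta w i : dot (delta_mx i 0) w = w i 0.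
Proof.
rewrite /dot (bigD1 i)//= mxE !eqxx mul1r big1 ?addr0// => j ji.
by rewrite mxE (negbTE ji) mul0r.
Qed.

Lemma payoffE M p q : payoff M p q = dot p (M *m q).
Proof.
by rewrite /payoff -mulmxA mxE; apply: eq_bigr => i _; rewrite mxE.
Qed.

Lemma payoffEr M p q : payoff M p q = dot q (M^T *m p).
Proof.
rewrite /payoff mxE; apply: eq_bigr => i _.
by rewrite -[p^T *m M]trmxK trmx_mul trmxK mxE mulrC.
Qed.

Lemma payoffDl M p p' q : payoff M (p + p') q = payoff M p q + payoff M p' q.
Proof. by rewrite !payoffE dotDl. Qed.

Lemma payoffZl M a p q : payoff M (a *: p) q = a * payoff M p q.
Proof. by rewrite !payoffE dotZl. Qed.

Lemma payoffDr M p q q' : payoff M p (q + q') = payoff M p q + payoff M p q'.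
Proof. by rewrite !payoffEr dotDl. Qed.

Lemma payoffZr M a p q : payoff M p (a *: q) = a * payoff M p q.
Proof. by rewrite !payoffEr dotZl. Qed.

Lemma payoffNl M p q : payoff M (- p) q = - payoff M p q.
Proof. by rewrite -scaleN1r payoffZl mulN1r. Qed.

Lemma payoffNr M p q : payoff M p (- q) = - payoff M p q.
Proof. by rewrite -scaleN1r payoffZr mulN1r. Qed.

Lemma payoffBl M p p' q : payoff M (p - p') q = payoff M p q - payoff M p' q.
Proof. by rewrite payoffDl payoffNl. Qed.

Definition face I : set 'cV[R]_n :=
  [set x | simplex R n x /\ forall i, i \notin I -> x i 0 = 0].

Lemma face_simplex I x : face I x -> simplex R n x.
Proof. by case. Qed.

Lemma simplex_face x : simplex R n x -> face [set: 'I_n]%SET x.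
Proof. by move=> sx; split=> // i; rewrite inE. Qed.

Lemma face_sub I J : I \subset J -> face I `<=` face J.
Proof.
move=> /fintype.subsetP IJ x [sx x0]; split=> // i iJ; apply: x0.
by apply: contra iJ => /IJ.
Qed.

Lemma face_delta I i : i \in I -> face I (delta_mx i 0).
Proof.
move=> iI; split; last first.
  by move=> j jI; rewrite mxE; case: eqP jI => //= ->; rewrite iI.
split; first by move=> j; rewrite mxE ler0n.
rewrite (bigD1 i)//= mxE !eqxx big1 ?addr0// => j ji.
by rewrite mxE (negbTE ji).
Qed.

Lemma face_dot_le I x w v : face I x -> (forall i, i \in I -> w i 0 <= v) ->
  dot x w <= v.
Proof.
move=> [[x0 x1] xI] wv; rewrite -[v]mul1r -x1 mulr_suml; apply: ler_sum => i _.
have [iI|iI] := boolP (i \in I); first by rewrite ler_wpM2l// wv.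
by rewrite xI// !mul0r.
Qed.

Lemma face_dot_ge I x w v : face I x -> (forall i, i \in I -> v <= w i 0) ->
  v <= dot x w.
Proof.
move=> [[x0 x1] xI] wv; rewrite -[v]mul1r -x1 mulr_suml; apply: ler_sum => i _.
have [iI|iI] := boolP (i \in I); first by rewrite ler_wpM2l// wv.
by rewrite xI// !mul0r.
Qed.

Lemma face_conv I x y (t : R) : face I x -> face I y -> 0 <= t <= 1 ->
  face I ((1 - t) *: x + t *: y).
Proof.
move=> [[x0 x1] xI] [[y0 y1] yI] /andP[t0 t1]; split; [split|].
- by move=> i; rewrite !mxE addr_ge0 ?mulr_ge0 ?subr_ge0.
- under eq_bigr do rewrite !mxE.
  by rewrite big_split/= -!mulr_sumr x1 y1 !mulr1 subrK.
- by move=> i iI; rewrite !mxE xI// yI// !mulr0 addr0.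
Qed.

Lemma simplex_le1 x i : simplex R n x -> x i 0 <= 1.
Proof.
move=> [x0 <-]; rewrite (bigD1 i)//= lerDl; exact: sumr_ge0.
Qed.

Lemma simplex_norm x : simplex R n x -> `|x| <= 1.
Proof.
move=> sx; rewrite [leLHS]mx_normrE; apply: bigmax_le => //= -[i j] _ /=.
by rewrite ord1 ger0_norm; [exact: simplex_le1|exact: sx.1].
Qed.

Lemma mx_norm_ge m k (A : 'M[R]_(m, k)) i j : `|A i j| <= `|A|.
Proof.
rewrite [leRHS]mx_normrE.
by apply: (le_bigmax _ (fun ij : 'I_m * 'I_k => `|A ij.1 ij.2|) (i, j)).
Qed.

Lemma trmx_continuous m k : continuous (trmx : 'M[R]_(m, k) -> 'M[R]_(k, m)).
Proof.
move=> A B /nbhs_ballP[e /= e0 AB]; apply/nbhs_ballP; exists e => //= C [_ AC].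
by apply: AB; split=> // i j; rewrite !mxE; exact: AC.
Qed.

(** The criterion for row vectors is carried over by transposition, which is continuous both ways
    and preserves bounds on the entries. *)
Lemma cV_bounded_closed_compact (A : set 'cV[R]_n) :
  bounded_set A -> closed A -> compact A.
Proof.
move=> bA cA.
have -> : A = trmx @` (trmx @^-1` A : set 'rV[R]_n).
  apply/seteqP; split=> [x Ax|_ [x /= Ax <-]//].
  by exists x^T; rewrite /= ?trmxK.
apply: continuous_compact.
  by apply: continuous_subspaceT => x; exact: trmx_continuous.
apply: bounded_closed_compact.
  case: bA => K [Kr bA]; exists K; split=> // r Kr' x Ax.
  apply: le_trans (bA r Kr' _ Ax).
  rewrite [leLHS]mx_normrE; apply: bigmax_le => //= -[i j] _ /=.
  by apply: le_trans (mx_norm_ge _ j i); rewrite mxE.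
by apply: closed_comp => // x _; exact: trmx_continuous.
Qed.

Lemma cV_coord_continuous i : continuous (fun x : 'cV[R]_n => x i 0).
Proof. exact: coord_continuous. Qed.

Lemma sum_continuous (T : topologicalType) (K : Type) (s : seq K) (P : pred K)
    (f : K -> T -> R) :
  (forall k, continuous (f k)) -> continuous (fun t => \sum_(k <- s | P k) f k t).
Proof.
move=> cf; elim: s => [|k s IH] t.
  under eq_fun do rewrite big_nil; exact: cvg_cst.
under eq_fun do rewrite big_cons; case: (P k); last exact: IH.
apply: cvgD; [exact: cf|exact: IH].
Qed.

Lemma face_closed I : closed (face I).
Proof.
have -> : face I = (\bigcap_i [set x : 'cV[R]_n | 0 <= x i 0]) `&`
    [set x | \sum_i x i 0 = 1] `&` \bigcap_(i in [set i | i \notin I]) [set x | x i 0 = 0].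
  apply/seteqP; split=> x /=.
    by move=> [[x0 x1] xI]; split; [split=> // i _; exact: x0|].
  by move=> [[x0 x1] xI]; split; [split=> // i; exact: x0|].
apply: closedI; first apply: closedI.
- apply: closed_bigI => i _.
  apply: (@closed_comp _ _ (fun x : 'cV[R]_n => x i 0) [set y : R | 0 <= y]).
    by move=> x _; exact: cV_coord_continuous.
  exact: closed_ge.
- apply: (@closed_comp _ _ (fun x : 'cV[R]_n => \sum_i x i 0) [set y : R | y = 1]).
    by move=> x _; apply: sum_continuous => k; exact: cV_coord_continuous.
  exact: closed_eq.
- apply: closed_bigI => i _.
  apply: (@closed_comp _ _ (fun x : 'cV[R]_n => x i 0) [set y : R | y = 0]).
    by move=> x _; exact: cV_coord_continuous.
  exact: closed_eq.
Qed.

Lemma face_compact I : compact (face I).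
Proof.
apply: cV_bounded_closed_compact; last exact: face_closed.
exists 1; split=> // r r1 x [sx _]; exact: le_trans (simplex_norm sx) (ltW r1).
Qed.

End Faces.

(** * Minimax theorem on faces *)

Section FiniteMax.
Context {R : realType} {T : topologicalType} {K : finType}.

(** The upper envelope of the [h k] over S is continuous and attains its minimum g on A. The last
    clause is the minimality of g, phrased by the functions themselves. *)
Lemma minimax_attained (h : K -> T -> R) (S : {set K}) (A : set T) (k0 : K) :
  k0 \in S -> (forall k, continuous (h k)) -> compact A -> A !=set0 ->
  exists z g, [/\ A z, forall k, k \in S -> h k z <= g
    & forall z', A z' -> exists2 k, k \in S & g <= h k z'].
Proof.
move=> k0S ch cA A0.
(* The seed [h k0] has its index in S, so it does not raise the maximum. *)
pose f z := \big[Order.max/h k0 z]_(k in S) h k z.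
have cf : continuous f.
  rewrite /f => z; elim: (index_enum K) => [|k s IH].
    by under eq_fun do rewrite big_nil; exact: ch.
  under eq_fun do rewrite big_cons.
  by case: (k \in S) => //; apply: (@continuous_max R T (h k)); [exact: ch|exact: IH].
have [z /set_mem Az zmin] := compact_EVT_min A0 cA (continuous_subspaceT cf).
exists z, (f z); split=> // [k kS|z' Az'].
  exact: (le_bigmax_cond _ (h ^~ z)).
apply: contrapT => nk; have := zmin z' (mem_set Az').
apply/negP; rewrite -ltNge; apply/bigmax_ltP.
have {}nk k : k \in S -> h k z' < f z.
  by move=> kS; rewrite ltNge; apply/negP => gk; apply: nk; exists k.
by split; [exact: nk|move=> k kS; exact: nk].
Qed.

End FiniteMax.

Section Minimax.
Context {R : realType} {n : nat}.
Implicit Types (M N : 'M[R]_n) (b c : 'cV[R]_n) (I J : {set 'I_n}).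

(** Saddle point of the game N on I and J without naming its value: averaging over b and c squeezes
    [payoff N b c] between the two sides. *)
Definition face_eq N I J b c : Prop :=
  forall i j, i \in I -> j \in J -> (N *m c) i 0 <= (N^T *m b) j 0.

(** Profit of the pure deviations ij against z. Its maximum over the pairs is the duality gap, and
    [face_eq] says that no pair profits. *)
Definition subgame_gap N (ij : 'I_n * 'I_n) (z : 'cV[R]_n * 'cV[R]_n) : R :=
  (N *m z.2) ij.1 0 - (N^T *m z.1) ij.2 0.

Lemma subgame_gap_continuous N ij : continuous (subgame_gap N ij).
Proof.
have cE A (i : 'I_n) : continuous (fun x : 'cV[R]_n => (A *m x) i 0).
  move=> x; under eq_fun do rewrite mxE.
  apply: sum_continuous => k y.
  apply: (@continuousM R _ (fun=> A i k) (fun y : 'cV[R]_n => y k 0)).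
    exact: cst_continuous.
  exact: cV_coord_continuous.
move=> z; apply: cvgB.
  by apply: (@continuous_comp _ _ _ snd (fun x : 'cV[R]_n => (N *m x) ij.1 0)); [exact: cvg_snd|exact: cE].
by apply: (@continuous_comp _ _ _ fst (fun x : 'cV[R]_n => (N^T *m x) ij.2 0)); [exact: cvg_fst|exact: cE].
Qed.

Lemma mulmx_comb N (s t : R) b c i :
  (N *m (s *: b + t *: c)) i 0 = s * (N *m b) i 0 + t * (N *m c) i 0.
Proof. by rewrite mulmxDr -!scalemxAr !mxE. Qed.

Lemma mulNmxE N c i : (- N *m c) i 0 = - (N *m c) i 0.
Proof. by rewrite mulNmx mxE. Qed.

Lemma trNtr N : (- N^T)^T = - N.
Proof. by rewrite linearN/= trmxK. Qed.

(* Loomis' induction: a row which is slack against a best column strategy can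
   be deleted. *)
Lemma loomis_step N I J b c (V1 V2 : R) i0 :
  (forall I', (#|I'| < #|I|)%N -> I' != finset.set0 ->
    exists b c, [/\ face I' b, face J c & face_eq N I' J b c]) ->
  face I b -> face J c -> V1 < V2 ->
  (forall i, i \in I -> (N *m c) i 0 <= V2) ->
  (forall j, j \in J -> V1 <= (N^T *m b) j 0) ->
  i0 \in I -> (N *m c) i0 0 < V2 ->
  ~ (forall b' c', face I b' -> face J c' -> exists i j,
      [/\ i \in I, j \in J & V2 - V1 <= (N *m c') i 0 - (N^T *m b') j 0]).
Proof.
move=> IH bI cJ V12 cV2 bV1 i0I ci0 min.
have [i1 [j1 [i1I j1J ij1]]] := min _ _ bI cJ.
have i1i0 : i1 != i0.
  by apply/negP => /eqP i10; have := bV1 _ j1J; rewrite i10 in ij1; lra.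
have [||b' [c' [b'I c'J b'c']]] := IH (I :\ i0).
- by rewrite [ltnRHS](cardsD1 i0) i0I.
- by apply/set0Pn; exists i1; rewrite !inE i1i0.
have I'I : I :\ i0 \subset I by exact: subD1set.
have [i2 [j2 [i2I j2J ij2]]] := min _ _ (face_sub I'I b'I) cJ.
(* By [min] at (b', c), column j2 bounds the reduced game by V1 < V2: a little of c' mixed into c
   pushes all rows other than i0 below V2. *)
have {}b'c' i : i \in I :\ i0 -> (N *m c') i 0 <= V1.
  by move=> iI'; have := b'c' _ _ iI' j2J; have := cV2 _ i2I; lra.
set a := (N *m c) i0 0 in ci0; set a' := (N *m c') i0 0.
(* Row i0 has slack V2 - a; with the weight e := (V2 - a) / S its value after mixing is at most V2 -
   e. *)
pose S := V2 - a + `|a' - V2| + 1.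
have S0 : 0 < S by rewrite /S; have := normr_ge0 (a' - V2); lra.
pose e := (V2 - a) / S.
have e0 : 0 < e by rewrite divr_gt0// subr_gt0.
have e1 : e <= 1.
  by rewrite ler_pdivrMr// mul1r /S; have := normr_ge0 (a' - V2); lra.
have ce : face J ((1 - e) *: c + e *: c') by apply: face_conv => //; rewrite (ltW e0).
have [i3 [j3 [i3I j3J]]] := min _ _ bI ce.
have := bV1 _ j3J.
rewrite mulmx_comb.
have [->|i3i0] := eqVneq i3 i0.
  rewrite -/a -/a' => h1 h2.
  have : (1 - e) * a + e * a' < V2; last by lra.
  have eS : e * S = V2 - a by rewrite /e divfK// gt_eqF.
  have : e * (a' - V2) <= e * `|a' - V2| by rewrite ler_pM2l// ler_norm.
  have : 0 < e by []. move: eS; rewrite /S; lra.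
have := b'c' i3; rewrite !inE i3i0 i3I => /(_ isT).
have := cV2 _ i3I; move: e0 e1; set u := (N *m c) i3 0; set v := (N *m c') i3 0.
move=> e0 e1 uV vV bV h.
have : (1 - e) * u <= (1 - e) * V2 by rewrite ler_wpM2l// subr_ge0.
have : e * v <= e * V1 by rewrite ler_wpM2l// ltW.
have : e * V1 < e * V2 by rewrite ltr_pM2l.
lra.
Qed.

(** Take a pair of least duality gap g. If 0 < g, [loomis_step] rules out slack rows and, applied to
    - N^T, slack columns; averaging then gives V2 <= [payoff N b c] <= V1, against g = V2 - V1. *)
Lemma minimax_face N I J : I != finset.set0 -> J != finset.set0 ->
  exists b c, [/\ face I b, face J c & face_eq N I J b c].
Proof.
move: {2}(#|I| + #|J|)%N (leqnn (#|I| + #|J|)) => m.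
elim: m N I J => [|m IH] N I J IJm I0 J0.
  by move: IJm; rewrite leqn0 addn_eq0 cards_eq0 (negbTE I0).
have [/set0Pn[i0 i0I] /set0Pn[j0 j0J]] := (I0, J0).
have cA : compact (face I `*` face J : set ('cV[R]_n * 'cV[R]_n)).
  by apply: compact_setX; exact: face_compact.
have A0 : (face I `*` face J : set ('cV[R]_n * 'cV[R]_n)) !=set0.
  by exists (delta_mx i0 0, delta_mx j0 0); split; exact: face_delta.
have ij0 : (i0, j0) \in finset.setX I J by rewrite finset.in_setX i0I.
have [[b c] [g [[/= bI cJ] gle gmin]]] :=
  minimax_attained ij0 (@subgame_gap_continuous N) cA A0.
have [g0|g0] := leP g 0.
  exists b, c; split=> // i j iI jJ; rewrite -subr_le0.
  by apply: le_trans g0; apply: (gle (i, j)); rewrite finset.in_setX iI.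
have [[i1 j1] /=] := gmin (b, c) (conj bI cJ).
rewrite finset.in_setX => /andP[i1I j1J]; rewrite /subgame_gap/= => ge.
set V2 := (N *m c) i1 0 in ge; set V1 := (N^T *m b) j1 0 in ge.
have gE : g = V2 - V1.
  apply/eqP; rewrite eq_le ge andTb; apply: (gle (i1, j1)).
  by rewrite finset.in_setX i1I.
have V12 : V1 < V2 by rewrite -subr_gt0 -gE.
have cV2 i : i \in I -> (N *m c) i 0 <= V2.
  move=> iI; have := gle (i, j1); rewrite finset.in_setX iI j1J => /(_ isT).
  rewrite /subgame_gap/= -/V1; lra.
have bV1 j : j \in J -> V1 <= (N^T *m b) j 0.
  move=> jJ; have := gle (i1, j); rewrite finset.in_setX jJ i1I => /(_ isT).
  rewrite /subgame_gap/= -/V2; lra.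
have min b' c' : face I b' -> face J c' -> exists i j,
    [/\ i \in I, j \in J & V2 - V1 <= (N *m c') i 0 - (N^T *m b') j 0].
  move=> b'I c'J; have [[i j]] := gmin (b', c') (conj b'I c'J).
  by rewrite finset.in_setX gE => /andP[iI jJ] h; exists i, j.
have [[i2 i2I ci2]|nI] := pselect (exists2 i, i \in I & (N *m c) i 0 < V2).
  exfalso; apply: (loomis_step _ bI cJ V12 cV2 bV1 i2I ci2 min) => I' I'I I'0.
  by apply: IH; rewrite // -ltnS (leq_trans _ IJm)// ltn_add2r.
have [[j2 j2J bj2]|nJ] := pselect (exists2 j, j \in J & V1 < (N^T *m b) j 0).
  exfalso; apply: (@loomis_step (- N^T) J I c b (- V2) (- V1) j2 _ cJ bI) => //.
  - move=> J' J'J J'0; have [|//|//|b' [c' [b'I c'J bc]]] := IH N I J'.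
      by rewrite -ltnS (leq_trans _ IJm)// ltn_add2l.
    exists c', b'; split=> // j i jJ iI; have := bc i j iI jJ.
    rewrite trNtr !mulNmxE; lra.
  - lra.
  - by move=> j jJ; rewrite mulNmxE lerN2 bV1.
  - by move=> i iI; rewrite trNtr mulNmxE lerN2 cV2.
  - by rewrite mulNmxE ltrN2.
  move=> c' b' c'J b'I; have [i [j [iI jJ ij]]] := min _ _ b'I c'J.
  exists j, i; split=> //; rewrite trNtr !mulNmxE; lra.
exfalso; have : V2 <= payoff N b c.
  rewrite payoffE; apply: (face_dot_ge bI) => i iI.
  by rewrite leNgt; apply/negP => ci; apply: nI; exists i.
have : payoff N b c <= V1.
  rewrite payoffEr; apply: (face_dot_le cJ) => j jJ.
  by rewrite leNgt; apply/negP => ci; apply: nJ; exists j.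
lra.
Qed.

End Minimax.

(** * Uniqueness of equilibria *)

Section Regular.
Context {R : realType} {n : nat}.
Implicit Types (M N : 'M[R]_n) (b c d : 'cV[R]_n) (I J : {set 'I_n}).

(* Row 0 is the row of ones, so the value f 0 is not used. *)
Definition bordered_minor k (f g : {ffun 'I_k.+1 -> 'I_n}) M : R :=
  \det (\matrix_(i < k.+1, j < k.+1) if i == ord0 then 1 else M (f i) (g j)).

Definition proper_minor k (f g : {ffun 'I_k.+1 -> 'I_n}) : Prop :=
  {in [pred i | i != ord0] &, injective f} /\ injective g.

Definition half_regular M : Prop :=
  forall k (f g : {ffun 'I_k.+1 -> 'I_n}),
    proper_minor f g -> bordered_minor f g M != 0.

Definition regular M : Prop := half_regular M /\ half_regular M^T.

Lemma sum_enum_nth I (x0 : 'I_n) (F : 'I_n -> R) m : #|I| = m ->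
  \sum_(i < m) F (nth x0 (enum I) i) = \sum_(i in I) F i.
Proof.
move=> <-; rewrite -[RHS]big_enum/= (big_nth x0) -cardE big_mkord.
by [].
Qed.

Lemma sum_support I (F : 'I_n -> R) : (forall i, i \notin I -> F i = 0) ->
  \sum_i F i = \sum_(i in I) F i.
Proof.
move=> F0; rewrite (bigID (mem I))/= [X in _ + X]big1 ?addr0// => i /F0; exact.
Qed.

(** One null vector for each shape. Take k rows in I and k + 1 columns in J with k as large as
    possible. If J has at most #|I| + 1 elements, all its columns are used and d is a right null
    vector of the bordered minor; otherwise all rows of I are used and (- v, b) is a left null
    vector, with - v facing the row of ones. *)
Lemma half_regular_full_rank M I J b d (v : R) : half_regular M ->
  d != 0 -> (forall j, j \notin J -> d j 0 = 0) -> \sum_j d j 0 = 0 ->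
  (forall i, i \in I -> (M *m d) i 0 = 0) ->
  b != 0 -> (forall i, i \notin I -> b i 0 = 0) ->
  (forall j, j \in J -> (M^T *m b) j 0 = v) -> False.
Proof.
move=> regM d0 dJ d1 Md b0 bI Mb.
have nz (x : 'cV[R]_n) : x != 0 -> exists i, x i 0 != 0.
  move=> /eqP x0; apply: contrapT => h; apply: x0; apply/colP => i.
  rewrite mxE; apply/eqP; apply: contrapT => /negP xi; apply: h.
  by exists i.
have [j0 dj0] := nz _ d0.
have j0J : j0 \in J by apply: contraNT dj0 => /dJ ->.
have J_gt0 : (0 < #|J|)%N by rewrite card_gt0; apply/set0Pn; exists j0.
pose k := minn #|J|.-1 #|I|.
have kJ : (k < #|J|)%N by rewrite /k; lia.
have kI : (k <= #|I|)%N by rewrite /k; lia.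
pose f := [ffun i : 'I_k.+1 => nth j0 (enum I) i.-1].
pose g := [ffun j : 'I_k.+1 => nth j0 (enum J) j].
have fi i : i != ord0 :> 'I_k.+1 -> (i.-1 < size (enum I))%N.
  rewrite -val_eqE /= -lt0n -cardE => i0.
  by apply: leq_trans kI; rewrite prednK// -ltnS ltn_ord.
have gj (j : 'I_k.+1) : (j < size (enum J))%N.
  by rewrite -cardE; exact: leq_trans (ltn_ord j) kJ.
have fI i : i != ord0 -> f i \in I.
  by move=> i0; rewrite ffunE -mem_enum mem_nth// fi.
have gJ j : g j \in J by rewrite ffunE -mem_enum mem_nth// gj.
have fg : proper_minor f g.
  split=> [i j|i j].
    rewrite !inE => i0 j0'; rewrite !ffunE => /eqP.
    rewrite (nth_uniq _ (fi _ i0) (fi _ j0') (enum_uniq _)) => /eqP ij.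
    move: i0 j0'; rewrite -!val_eqE /= -!lt0n => i0 j0'.
    by apply: val_inj; rewrite /= -(prednK i0) ij prednK.
  rewrite !ffunE => /eqP; rewrite (nth_uniq _ (gj i) (gj j) (enum_uniq _)).
  by move=> /eqP; exact: val_inj.
have /negP := regM _ _ _ fg; apply; rewrite /bordered_minor.
have [JI|IJ] := leqP #|J| #|I|.+1.
  have kE : k.+1 = #|J| by rewrite /k; lia.
  rewrite -det_tr; apply/det0P.
  exists (\row_j d (g j) 0).
    apply/eqP => /rowP du.
    have iJ : (index j0 (enum J) < k.+1)%N by rewrite kE cardE index_mem mem_enum.
    have := du (Ordinal iJ); rewrite !mxE ffunE/= nth_index ?mem_enum//.
    by move/eqP; rewrite (negbTE dj0).
  have gsum (F : 'I_n -> R) : (forall j, j \notin J -> F j = 0) ->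
      \sum_(j < k.+1) F (g j) = \sum_j F j.
    move=> F0; rewrite (sum_support F0) -(sum_enum_nth j0 _ (esym kE)).
    by apply: eq_bigr => j _; rewrite ffunE.
  apply/rowP => i; rewrite !mxE.
  have [i0|i0] := eqVneq i ord0.
    transitivity (\sum_(j < k.+1) d (g j) 0).
      by apply: eq_bigr => j _; rewrite !mxE i0 eqxx mulr1.
    by rewrite (gsum (fun j => d j 0)).
  transitivity (\sum_(j < k.+1) (d (g j) 0 * M (f i) (g j))).
    by apply: eq_bigr => j _; rewrite !mxE (negbTE i0).
  rewrite (gsum (fun j => d j 0 * M (f i) j)) => [|j /dJ ->]; last by rewrite mul0r.
  rewrite -[RHS](Md _ (fI _ i0)) mxE.
  by apply: eq_bigr => j _; rewrite mulrC.
have kE : k = #|I| by rewrite /k; lia.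
apply/det0P; exists (\row_i if i == ord0 then - v else b (f i) 0).
  apply/eqP => /rowP bu; have [i1 bi1] := nz _ b0.
  have i1I : i1 \in I by apply: contraNT bi1 => /bI ->.
  have iI : ((index i1 (enum I)).+1 < k.+1)%N.
    by rewrite ltnS kE cardE index_mem mem_enum.
  have := bu (Ordinal iI); rewrite !mxE ffunE/= nth_index ?mem_enum//.
  by move/eqP; rewrite (negbTE bi1).
apply/rowP => j; rewrite !mxE big_ord_recl !mxE !eqxx/= mulr1.
transitivity (- v + \sum_(i in I) b i 0 * M i (g j)).
  congr (_ + _); rewrite -(sum_enum_nth j0 _ (esym kE)).
  by apply: eq_bigr => i _; rewrite !mxE/= ffunE/=.
rewrite -sum_support => [|i /bI ->]; last by rewrite mul0r.
rewrite -(Mb _ (gJ j)) mxE addrC; apply/eqP; rewrite subr_eq0; apply/eqP.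
by apply: eq_bigr => i _; rewrite mxE mulrC.
Qed.
End Regular.

Section Uniqueness.
Context {R : realType} {n : nat}.
Implicit Types (M N : 'M[R]_n) (b c d : 'cV[R]_n) (I J : {set 'I_n}).

Lemma face_eq_le N I J b c i : face I b -> face J c -> face_eq N I J b c ->
  i \in I -> (N *m c) i 0 <= payoff N b c.
Proof.
move=> bI cJ bc iI; rewrite payoffEr; apply: (face_dot_ge cJ) => j jJ; exact: bc.
Qed.

Lemma face_eq_ge N I J b c j : face I b -> face J c -> face_eq N I J b c ->
  j \in J -> payoff N b c <= (N^T *m b) j 0.
Proof.
move=> bI cJ bc jJ; rewrite payoffE; apply: (face_dot_le bI) => i iI; exact: bc.
Qed.

(** Complementary slackness: the terms [F k] are nonnegative and sum to zero. *)
Lemma slack_row N I b c i : face I b ->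
  (forall i, i \in I -> (N *m c) i 0 <= payoff N b c) ->
  b i 0 != 0 -> (N *m c) i 0 = payoff N b c.
Proof.
move=> bI le bi; have [[b0 b1] bI0] := bI.
pose F k := b k 0 * (payoff N b c - (N *m c) k 0).
have F0 k : 0 <= F k.
  have [kI|kI] := boolP (k \in I); last by rewrite /F bI0// mul0r.
  by rewrite mulr_ge0// subr_ge0 le.
have : \sum_k F k = 0.
  under eq_bigr do rewrite /F mulrBr.
  rewrite sumrB -mulr_suml b1 mul1r payoffE.
  by rewrite /dot subrr.
move=> /eqP; rewrite psumr_eq0 => [|k _]; last exact: F0.
move=> /allP/(_ i (mem_index_enum _)); rewrite mulf_eq0 (negbTE bi)/= subr_eq0.
by move=> /eqP.
Qed.

Lemma slack_col N J b c j : face J c ->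
  (forall j, j \in J -> payoff N b c <= (N^T *m b) j 0) ->
  c j 0 != 0 -> (N^T *m b) j 0 = payoff N b c.
Proof.
have E : payoff (- N^T) c b = - payoff N b c.
  rewrite payoffEr trNtr payoffE /dot -sumrN.
  by apply: eq_bigr => i _; rewrite mulNmxE mulrN.
move=> cJ le cj; have := @slack_row (- N^T) J c b j cJ _ cj.
rewrite E mulNmxE => h; apply: oppr_inj; apply: h => k kJ.
by rewrite mulNmxE lerN2 le.
Qed.

(** Optimal strategies of a zero-sum game are interchangeable: comparison through (b', c) shows that
    the value at (b', c') is at most the one at (b, c). *)
Lemma face_eq_cross N I J b c b' c' :
  face I b -> face J c -> face I b' -> face J c' ->
  face_eq N I J b c -> face_eq N I J b' c' -> face_eq N I J b c'.
Proof.
move=> bI cJ b'I c'J bc b'c' i j iI jJ.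
have h1 := face_eq_le b'I c'J b'c'; have h2 := face_eq_ge b'I c'J b'c'.
have h3 := face_eq_le bI cJ bc; have h4 := face_eq_ge bI cJ bc.
have : payoff N b' c <= payoff N b c by rewrite payoffE; exact: face_dot_le h3.
have : payoff N b' c' <= payoff N b' c by rewrite [leRHS]payoffEr; exact: face_dot_ge h2.
by have := h1 _ iI; have := h4 _ jJ; lra.
Qed.

Lemma face_neq0 I b : face I b -> b != 0.
Proof.
move=> [[_ b1] _]; apply/eqP => b0; move: b1; rewrite b0 big1 => [/eqP|i _].
  by rewrite eq_sym oner_eq0.
by rewrite mxE.
Qed.

(** By complementary slackness the rows in the support of b do not distinguish c from c', so they
    annihilate c - c', while the columns in the supports of c and c' are all equal against b.
    [half_regular_full_rank] forbids this unless c = c'. *)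
Lemma col_unique M (s : R) I J b c c' : half_regular M -> s != 0 ->
  face I b -> face J c -> face J c' ->
  face_eq (s *: M) I J b c -> face_eq (s *: M) I J b c' -> c = c'.
Proof.
move=> regM s0 bI cJ c'J bc bc'; apply/eqP; rewrite -subr_eq0.
apply/negPn/negP => d0; set N := s *: M in bc bc'.
have vE : payoff N b c = payoff N b c'.
  apply/eqP; rewrite eq_le.
  have h1 := @face_eq_ge N I J b c' _ bI c'J bc'.
  have h2 := @face_eq_ge N I J b c _ bI cJ bc.
  by apply/andP; split; rewrite [leRHS]payoffEr; [exact: face_dot_ge h2|exact: face_dot_ge h1].
have ME x i : (M *m x) i 0 = s^-1 * (N *m x) i 0.
  by rewrite /N -scalemxAl [in RHS]mxE mulKf.
have MTE x i : (M^T *m x) i 0 = s^-1 * (N^T *m x) i 0.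
  by rewrite /N linearZ/= -scalemxAl [in RHS]mxE mulKf.
have h1 := @face_eq_le N I J b c _ bI cJ bc.
have h2 := @face_eq_le N I J b c' _ bI c'J bc'.
apply: (@half_regular_full_rank _ _ M [set i | b i 0 != 0]%SET
  [set j | (c j 0 != 0) || (c' j 0 != 0)]%SET b (c - c') (s^-1 * payoff N b c)) => //.
- by move=> j; rewrite !inE negb_or !negbK !mxE => /andP[/eqP-> /eqP->]; rewrite subr0.
- under eq_bigr do rewrite !mxE.
  by rewrite sumrB cJ.1.2 c'J.1.2 subrr.
- move=> i; rewrite inE => bi; rewrite mulmxBr mxE [X in _ + X]mxE !ME.
  by rewrite (slack_row bI h1 bi) (slack_row bI h2 bi) vE subrr.
- exact: face_neq0 bI.
- by move=> i; rewrite inE negbK => /eqP.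
have h3 := @face_eq_ge N I J b c _ bI cJ bc.
have h4 := @face_eq_ge N I J b c' _ bI c'J bc'.
move=> j; rewrite inE MTE => /orP[cj|cj].
  by rewrite (slack_col cJ h3 cj).
by rewrite (slack_col c'J h4 cj) vE.
Qed.

Lemma face_eq_tr N I J b c : face_eq N I J b c -> face_eq (- N^T) J I c b.
Proof.
by move=> bc j i jJ iI; rewrite trNtr !mulNmxE lerN2; exact: bc.
Qed.

(** Interchangeability reduces the claim to a common partner; uniqueness of b is [col_unique] for
    the transposed game, where s becomes - s. *)
Lemma face_eq_unique M (s : R) I J b c b' c' : regular M -> s != 0 ->
  face I b -> face J c -> face I b' -> face J c' ->
  face_eq (s *: M) I J b c -> face_eq (s *: M) I J b' c' -> b = b' /\ c = c'.
Proof.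
move=> [regM regMT] s0 bI cJ b'I c'J bc b'c'.
have bc' := face_eq_cross bI cJ b'I c'J bc b'c'.
split; last exact: col_unique regM s0 bI cJ c'J bc bc'.
have sE : - (s *: M)^T = (- s) *: M^T by rewrite linearZ/= scaleNr.
have := face_eq_tr bc'; have := face_eq_tr b'c'; rewrite sE => h1 h2.
by apply: (col_unique regMT _ c'J bI b'I h2 h1); rewrite oppr_eq0.
Qed.

End Uniqueness.

(** * Null sets of matrices *)

Section LebesgueNull.
Context {R : realType} {m n : nat}.
Implicit Types (N : set 'M[R]_(m, n)) (a b : 'M[R]_(m, n)).

Lemma mx_box_volume_ge0 a b : (forall i j, a i j <= b i j) ->
  0 <= mx_box_volume a b.
Proof.
move=> ab; apply: prodr_ge0 => i _; apply: prodr_ge0 => j _; rewrite subr_ge0.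
exact: ab.
Qed.

Lemma lebesgue_null_sub N N' : N `<=` N' -> lebesgue_null N' -> lebesgue_null N.
Proof.
move=> NN' N'0 e e0; have [a [b [ab N'ab abe]]] := N'0 e e0.
by exists a, b; split=> //; exact: subset_trans N'ab.
Qed.

Lemma lebesgue_null_bigcup (N : nat -> set 'M[R]_(m, n)) :
  (forall k, lebesgue_null (N k)) -> lebesgue_null (\bigcup_k N k).
Proof.
move=> N0 e e0.
have ek k : 0 < e / (2 ^ k.+1)%:R by rewrite divr_gt0// ltr0n expn_gt0.
have /choice[ab abP] k : exists ab : (nat -> 'M[R]_(m, n)) * (nat -> 'M[R]_(m, n)),
    [/\ forall l i j, ab.1 l i j <= ab.2 l i j,
        N k `<=` \bigcup_l mx_box (ab.1 l) (ab.2 l)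
      & (\sum_(0 <= l <oo) (mx_box_volume (ab.1 l) (ab.2 l))%:E <=
         (e / (2 ^ k.+1)%:R)%:E)%E].
  by have [a [b abk]] := N0 k _ (ek k); exists (a, b).
(* A bijection of nat with its square lists the boxes of all coverings in one sequence. *)
have /card_esym/ppcard_eqP[f] := card_nat2.
pose v (kl : nat * nat) : \bar R :=
  (mx_box_volume ((ab kl.1).1 kl.2) ((ab kl.1).2 kl.2))%:E.
have v0 kl : (0 <= v kl)%E.
  by rewrite lee_fin mx_box_volume_ge0// => i j; have [+ _ _] := abP kl.1; apply.
exists (fun l => (ab (f l).1).1 (f l).2), (fun l => (ab (f l).1).2 (f l).2); split.
- by move=> l i j; have [+ _ _] := abP (f l).1; apply.
- move=> x [k _ Nkx]; have [_ /(_ _ Nkx)[l _ klx] _] := abP k.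
  by exists (f^-1%FUN (k, l)) => //=; rewrite invK ?inE.
have -> : (\sum_(0 <= l <oo) v (f l))%E = (\esum_(kl in setT) v kl)%E.
  by rewrite nneseries_esumT// (reindex_esum setT setT f).
have -> : (\esum_(kl in setT) v kl = \sum_(0 <= k <oo) \sum_(0 <= l <oo) v (k, l))%E.
  rewrite [RHS]nneseries_esumT => [|k]; last by apply: nneseries_ge0.
  transitivity (\esum_(k in [set: nat]) \esum_(l in [set: nat]) v (k, l))%E.
    rewrite (@esum_esum _ _ _ _ (fun=> setT) (fun i j => v (i, j)))//.
    rewrite (_ : _ `*`` _ = setT); last by apply/seteqP; split.
    by apply: eq_esum => -[].
  by apply: eq_esum => k _; rewrite nneseries_esumT.
apply: (@le_trans _ _ (\sum_(0 <= k <oo) (0 + (e / (2 ^ k.+1)%:R)%:E))%E).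
  apply: lee_nneseries => k _; first by move=> _; exact: nneseries_ge0.
  by rewrite add0e; have [] := abP k.
apply: le_trans (@epsilon_trick R (fun=> 0%E) e xpredT _ _) _ => //; first exact: ltW.
by rewrite eseries0 ?add0e.
Qed.

Lemma lebesgue_null_bigcup_fin (K : finType) (k0 : K) (N : K -> set 'M[R]_(m, n)) :
  (forall k, lebesgue_null (N k)) -> lebesgue_null (\bigcup_k N k).
Proof.
(* Indices past the end of the enumeration repeat [N k0]. *)
move=> N0; apply: (@lebesgue_null_sub _ (\bigcup_l N (nth k0 (enum K) l))).
  move=> x [k _ Nkx]; exists (index k (enum K)) => //=.
  by rewrite nth_index// mem_enum.
by apply: lebesgue_null_bigcup => l; exact: N0.
Qed.

End LebesgueNull.

(** * Lipschitz graphs over all entries but one are null *)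

Section LipschitzGraph.
Context {R : realType} {m n : nat}.
Implicit Types (N : set 'M[R]_(m, n)) (a b X Y : 'M[R]_(m, n)).

Lemma lebesgue_null_finite_cover N : (0 < m)%N -> (0 < n)%N ->
  (forall e : R, 0 < e -> exists (K : finType) (a b : K -> 'M[R]_(m, n)),
    [/\ forall k i j, a k i j <= b k i j, N `<=` \bigcup_k mx_box (a k) (b k)
      & \sum_k mx_box_volume (a k) (b k) <= e]) ->
  lebesgue_null N.
Proof.
move=> m0 n0 fin e e0; have [K [a [b [ab Nab abe]]]] := fin e e0.
pose ext (c : K -> 'M[R]_(m, n)) (l : nat) : 'M[R]_(m, n) :=
  if insub l is Some i then c (enum_val (i : 'I_#|K|)) else 0.
exists (ext a), (ext b); split.
- by move=> l i j; rewrite /ext; case: insubP => // _ _ _; exact: ab.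
- move=> X /Nab[k _ kX]; exists (enum_rank k) => //.
  by rewrite /ext/= valK enum_rankK.
(* The padding boxes are the point 0; their volume vanishes because the product over the entries is
   not empty. *)
have z0 : mx_box_volume (0 : 'M[R]_(m, n)) 0 = 0.
  rewrite /mx_box_volume (bigD1 (Ordinal m0))//= (bigD1 (Ordinal n0))//=.
  by rewrite mxE subrr !mul0r.
rewrite (nneseries_split 0 #|K|) => [|l _]; last first.
  rewrite lee_fin mx_box_volume_ge0// => i j.
  by rewrite /ext; case: insubP => // _ _ _; exact: ab.
rewrite eseries0 ?adde0 => [|l]; last first.
  by rewrite add0n => Kl _; rewrite /ext insubF ?z0// ltnNge Kl.
rewrite add0n sumEFin lee_fin big_mkord; apply: le_trans abe.
rewrite [leRHS](reindex (fun i : 'I_#|K| => enum_val i)); last first.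
  by apply: onW_bij; exact: enum_val_bij.
by apply: ler_sum => i _; rewrite /ext/= valK.
Qed.

Lemma grid_index k (t : R) : (0 < k)%N -> 0 <= t <= k%:R ->
  exists l : 'I_k, l%:R <= t <= l%:R + 1.
Proof.
move=> k0 /andP[t0 tk]; have /andP[lt tl] := Num.Theory.truncn_itv t0.
have [lk|kl] := ltnP (Num.truncn t) k.
  by exists (Ordinal lk); rewrite /= lt natr1 ltW.
(* Only t = k is left, and it belongs to the last cell. *)
have kk : (k.-1 < k)%N by rewrite prednK.
exists (Ordinal kk); rewrite /= natr1 prednK// tk andbT.
apply: le_trans lt; rewrite ler_nat; exact: leq_trans (leq_pred _) kl.
Qed.

(** Cut the cube of the D other entries into k ^ D cells of side d = 2 K / k. Over a cell the graph
    stays within L * d of any one of its points, so the slabs have total volume C / k. *)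
Lemma lipschitz_graph_null N (i0 : 'I_m) (j0 : 'I_n) (K L : R) :
  0 < K -> 0 < L -> (forall X i j, N X -> `|X i j| <= K) ->
  (forall X Y d, N X -> N Y -> 0 <= d ->
    (forall i j, (i, j) != (i0, j0) -> `|X i j - Y i j| <= d) ->
    `|X i0 j0 - Y i0 j0| <= L * d) ->
  lebesgue_null N.
Proof.
move=> K0 L0 NK NL; apply: lebesgue_null_finite_cover.
- exact: leq_ltn_trans (leq0n i0) (ltn_ord i0).
- exact: leq_ltn_trans (leq0n j0) (ltn_ord j0).
move=> e e0.
pose D := #|[pred x : 'I_m * 'I_n | x != (i0, j0)]|.
pose C := (2 * K) ^+ D * (4 * K * L).
have C0 : 0 < C by rewrite mulr_gt0 ?exprn_gt0 ?mulr_gt0.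
pose k := (Num.bound (C / e)).+1.
have kR0 : 0 < k%:R :> R by rewrite ltr0n.
have Ck : C / k%:R <= e.
  rewrite ler_pdivrMr// mulrC -ler_pdivrMr//.
  apply: le_trans (ltW (Num.Theory.archi_boundP _)) _; first by rewrite divr_ge0// ltW.
  by rewrite ler_nat.
pose d := 2 * K / k%:R.
have d0 : 0 < d by rewrite divr_gt0 ?mulr_gt0.
pose T := {x : 'I_m * 'I_n | x != (i0, j0)}.
pose low (f : {ffun T -> 'I_k}) (x : T) : R := - K + d * (f x)%:R.
pose cell f : set 'M[R]_(m, n) := N `&` [set X |
  forall x : T, low f x <= X (val x).1 (val x).2 <= low f x + d].
(* Each nonempty cell gets a point of N as the centre of its slab; for an empty cell the default 0
   still gives an ordered box. *)
have /choice[Z ZP] f : exists Y : 'M[R]_(m, n), cell f !=set0 -> cell f Y.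
  by have [[Y fY]|f0] := pselect (cell f !=set0); [exists Y|exists 0 => /f0].
pose a f := \matrix_(i < m, j < n)
  if insub (i, j) is Some x then low f x else Z f i0 j0 - L * d.
pose b f := \matrix_(i < m, j < n)
  if insub (i, j) is Some x then low f x + d else Z f i0 j0 + L * d.
have baE f i j : b f i j - a f i j = if (i, j) == (i0, j0) then 2 * (L * d) else d.
  rewrite !mxE; case: insubP => [x xn xE|]; last first.
    by rewrite negbK => ->; ring.
  by move: xn => /negbTE ->; ring.
exists {ffun T -> 'I_k}, a, b; split.
- move=> f i j; rewrite -subr_ge0 baE; case: ifP => _; last exact: ltW.
  by rewrite !mulr_ge0// ltW.
- move=> X NX.
  have /choice[f fP] (x : T) : exists l : 'I_k,
      - K + d * l%:R <= X (val x).1 (val x).2 <= - K + d * l%:R + d.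
    have := NK _ (val x).1 (val x).2 NX; rewrite ler_norml => /andP[h1 h2].
    have dk : d * k%:R = 2 * K by rewrite /d divfK// gt_eqF.
    have [||l /andP[l1 l2]] := @grid_index k ((X (val x).1 (val x).2 + K) / d) => //.
      rewrite divr_ge0 ?(ltW d0)//=; last by rewrite addrC -lerBlDl sub0r.
      by rewrite ler_pdivrMr// mulrC dk; lra.
    exists l; move: l1 l2; rewrite ler_pdivlMr// ler_pdivrMr// => l1 l2.
    by apply/andP; split; [move: l1|move: l2]; rewrite ?mulrDl ?mul1r (mulrC d); lra.
  have cX : cell (finfun f) X by split=> // x; rewrite /low ffunE; exact: fP.
  have [NZ cZ] := ZP (finfun f) (ex_intro _ X cX).
  exists (finfun f) => // i j; rewrite !mxE; case: insubP => [x xn xE|].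
    by have := cX.2 x; rewrite xE.
  rewrite negbK => /eqP[-> ->].
  have : `|X i0 j0 - Z (finfun f) i0 j0| <= L * d.
    apply: NL => //; first exact: ltW.
    move=> i' j' ij'; have := cX.2 (Sub (i', j') ij').
    have := cZ (Sub (i', j') ij'); rewrite SubK /= ler_norml => /andP[u1 u2] /andP[v1 v2].
    by apply/andP; split; lra.
  by rewrite ler_norml => /andP[u1 u2]; apply/andP; split; lra.
have volE f : mx_box_volume (a f) (b f) = 2 * (L * d) * d ^+ D.
  rewrite /mx_box_volume pair_bigA/= (bigD1 (i0, j0))//= baE eqxx; congr (_ * _).
  rewrite -prodr_const; apply: eq_big => // x x0.
  by rewrite baE -surjective_pairing (negbTE x0).
rewrite (eq_bigr _ (fun f _ => volE f)) sumr_const card_ffun card_ord.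
rewrite card_sig -/D -[leLHS]mulr_natl natrX.
apply: le_trans Ck.
have -> : k%:R ^+ D * (2 * (L * d) * d ^+ D) = (d * k%:R) ^+ D * (2 * L * d).
  have gen (x y u w : R) : w * (2 * (x * y) * u) = u * w * (2 * x * y) by ring.
  by rewrite gen -exprMn.
have -> : d * k%:R = 2 * K by rewrite /d divfK// gt_eqF.
rewrite /C /d le_eqVlt; apply/orP; left; apply/eqP; field.
by rewrite gt_eqF.
Qed.

End LipschitzGraph.

(** * Generic matrices *)

Section Generic.
Context {R : realType} {n : nat}.
Implicit Types (f g a : 'M[R]_n -> R) (X Y : 'M[R]_n).

Lemma mx_norm_le m k (A : 'M[R]_(m, k)) (e : R) : 0 <= e ->
  (forall i j, `|A i j| <= e) -> `|A| <= e.
Proof.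
by move=> e0 Ae; rewrite [leLHS]mx_normrE; apply: bigmax_le => // -[i j] _; exact: Ae.
Qed.

(** Weak enough to hold for all polynomials in the entries, this gives both continuity and the
    Lipschitz constants of the graphs in [generic_affine]. *)
Definition loc_lipschitz f : Prop := forall K : R, exists2 L : R, 0 < L &
  forall X Y, `|X| <= K -> `|Y| <= K -> `|f X - f Y| <= L * `|X - Y|.

Lemma loc_lipschitz_cst c : loc_lipschitz (fun=> c).
Proof. by move=> K; exists 1 => // X Y _ _; rewrite subrr normr0 mul1r. Qed.

Lemma loc_lipschitz_coord i j : loc_lipschitz (fun X => X i j).
Proof.
move=> K; exists 1 => // X Y _ _; rewrite mul1r.
by apply: le_trans (mx_norm_ge _ i j); rewrite !mxE.
Qed.

Lemma loc_lipschitz_add f g : loc_lipschitz f -> loc_lipschitz g ->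
  loc_lipschitz (fun X => f X + g X).
Proof.
move=> lf lg K; have [[L L0 fL] [L' L'0 gL]] := (lf K, lg K).
exists (L + L'); first exact: addr_gt0.
move=> X Y XK YK; rewrite opprD addrACA mulrDl.
by apply: le_trans (ler_normD _ _) _; apply: lerD; [exact: fL|exact: gL].
Qed.

Lemma loc_lipschitz_mul f g : loc_lipschitz f -> loc_lipschitz g ->
  loc_lipschitz (fun X => f X * g X).
Proof.
move=> lf lg K.
have [[L L0 fL] [L' L'0 gL]] := (lf `|K|, lg `|K|).
have bnd0 (h : 'M[R]_n -> R) (l : R) : (forall X Y, `|X| <= `|K| -> `|Y| <= `|K| -> `|h X - h Y| <= l * `|X - Y|) ->
    forall X : 'M[R]_n, `|X| <= `|K| -> `|h X| <= `|h 0| + l * `|X|.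
  move=> hl X XK; rewrite -lerBlDl; apply: le_trans (lerB_dist _ _) _.
  by rewrite -[X in _ <= _ * `|X|]subr0 hl// normr0.
have bnd (h : 'M[R]_n -> R) (l : R) : 0 < l -> (forall X Y, `|X| <= `|K| -> `|Y| <= `|K| ->
    `|h X - h Y| <= l * `|X - Y|) ->
    forall X : 'M[R]_n, `|X| <= `|K| -> `|h X| <= `|h 0| + l * `|K|.
  move=> l0 hl X XK; apply: (le_trans (bnd0 _ _ hl _ XK)).
  by rewrite lerD2l ler_pM2l.
pose A := `|f 0| + L * `|K|; pose B := `|g 0| + L' * `|K|.
have A0 : 0 <= A by rewrite addr_ge0// mulr_ge0// ltW.
have B0 : 0 <= B by rewrite addr_ge0// mulr_ge0// ltW.
exists (A * L' + B * L + 1).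
  by rewrite ltr_wpDl// addr_ge0// mulr_ge0// ltW.
move=> X Y XK YK.
have {}XK := le_trans XK (ler_norm _).
have {}YK := le_trans YK (ler_norm _).
have -> : f X * g X - f Y * g Y = f X * (g X - g Y) + g Y * (f X - f Y) by ring.
apply: le_trans (ler_normD _ _) _; rewrite !normrM.
have h1 : `|f X| * `|g X - g Y| <= A * (L' * `|X - Y|).
  by apply: ler_pM => //; [exact: bnd|exact: gL].
have h2 : `|g Y| * `|f X - f Y| <= B * (L * `|X - Y|).
  by apply: ler_pM => //; [exact: bnd|exact: fL].
have := normr_ge0 (X - Y); lra.
Qed.

Lemma loc_lipschitz_sum (K : Type) (s : seq K) (P : pred K)
    (F : K -> 'M[R]_n -> R) : (forall k, loc_lipschitz (F k)) ->
  loc_lipschitz (fun X => \sum_(k <- s | P k) F k X).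
Proof.
move=> lF; elim: s => [|k s IH].
  by under eq_fun do rewrite big_nil; exact: loc_lipschitz_cst.
under eq_fun do rewrite big_cons; case: (P k) => //.
exact: loc_lipschitz_add.
Qed.

Lemma loc_lipschitz_prod (K : Type) (s : seq K) (P : pred K)
    (F : K -> 'M[R]_n -> R) : (forall k, loc_lipschitz (F k)) ->
  loc_lipschitz (fun X => \prod_(k <- s | P k) F k X).
Proof.
move=> lF; elim: s => [|k s IH].
  by under eq_fun do rewrite big_nil; exact: loc_lipschitz_cst.
under eq_fun do rewrite big_cons; case: (P k) => //.
exact: loc_lipschitz_mul.
Qed.

Lemma loc_lipschitz_det k (F : 'M[R]_n -> 'M[R]_k) :
  (forall i j, loc_lipschitz (fun X => F X i j)) ->
  loc_lipschitz (fun X => \det (F X)).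
Proof.
move=> lF; apply: loc_lipschitz_sum => s; apply: loc_lipschitz_mul.
  exact: loc_lipschitz_cst.
by apply: loc_lipschitz_prod => i; exact: lF.
Qed.

Lemma loc_lipschitz_near f X (e : R) : loc_lipschitz f -> 0 < e ->
  exists2 d : R, 0 < d & forall Y, `|X - Y| < d -> `|f X - f Y| < e.
Proof.
move=> lf e0; have [L L0 fL] := lf (`|X| + 1).
exists (Num.min 1 (e / L)); first by rewrite lt_min ltr01 divr_gt0.
move=> Y; rewrite lt_min => /andP[XY1 XYe].
apply: le_lt_trans (fL _ _ _ _) _; first by rewrite lerDl.
  have -> : Y = X - (X - Y) by rewrite opprB addrC subrK.
  by apply: le_trans (ler_normB _ _) _; rewrite lerD2l ltW.
by rewrite mulrC -ltr_pdivlMr.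
Qed.

(** In effect f is nonzero on an open dense set of full measure. It is kept as a property of f
    because it then passes to products. *)
Definition generic f : Prop :=
  [/\ loc_lipschitz f, lebesgue_null [set X | f X = 0] &
    forall X (e : R), 0 < e -> exists2 Y, `|X - Y| < e & f Y != 0].

Lemma lebesgue_null0 : (0 < n)%N -> lebesgue_null (set0 : set 'M[R]_n).
Proof.
move=> n0; apply: lebesgue_null_finite_cover => // e e0.
exists 'I_0, (fun=> 0), (fun=> 0); split; first by case.
  exact: sub0set.
by rewrite big_ord0 ltW.
Qed.

Lemma generic_cst c : (0 < n)%N -> c != 0 -> generic (fun=> c).
Proof.
move=> n0 c0; split; first exact: loc_lipschitz_cst.
  apply: lebesgue_null_sub (lebesgue_null0 n0) => X /= /eqP.
  by rewrite (negbTE c0).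
by move=> X e e0; exists X; rewrite ?subrr ?normr0.
Qed.

Lemma generic_mul f g : generic f -> generic g -> generic (fun X => f X * g X).
Proof.
move=> [lf nf df] [lg ng dg]; split; first exact: loc_lipschitz_mul.
  apply: (@lebesgue_null_sub _ _ _ _ (\bigcup_(b : bool) [set X | (if b then f X else g X) = 0])).
    move=> X /= /eqP; rewrite mulf_eq0 => /orP[] /eqP h; first by exists true.
    by exists false.
  by apply: lebesgue_null_bigcup_fin; [exact: true|case].
move=> X e e0; have e20 : 0 < e / 2 by rewrite divr_gt0.
have [Y XY fY] := df X _ e20.
have [d d0 fd] : exists2 d : R, 0 < d & forall Z, `|Y - Z| < d -> `|f Y - f Z| < `|f Y|.
  by apply: loc_lipschitz_near => //; rewrite normr_gt0.
have [|Z YZ gZ] := dg Y (Num.min d (e / 2)); first by rewrite lt_min d0.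
move: YZ; rewrite lt_min => /andP[YZd YZe]; exists Z.
  have -> : X - Z = (X - Y) + (Y - Z) by rewrite addrA subrK.
  by apply: le_lt_trans (ler_normD _ _) _; rewrite [e]splitr ltrD.
rewrite mulf_neq0//; apply/eqP => fZ; have := fd _ YZd.
by rewrite fZ subr0 ltxx.
Qed.

Lemma generic_prod (K : Type) (s : seq K) (P : pred K) (F : K -> 'M[R]_n -> R) :
  (0 < n)%N -> (forall k, P k -> generic (F k)) ->
  generic (fun X => \prod_(k <- s | P k) F k X).
Proof.
move=> n0 gF; elim: s => [|k s IH].
  by under eq_fun do rewrite big_nil; apply: generic_cst; rewrite ?oner_neq0.
under eq_fun do rewrite big_cons; have := gF k; case: (P k) => // /(_ isT) gFk.
exact: generic_mul.
Qed.

Lemma norm_delta i j : `|delta_mx i j : 'M[R]_n| <= 1.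
Proof.
apply: mx_norm_le => // k l; rewrite mxE.
by case: (_ && _); rewrite ?normr1 ?normr0.
Qed.

(* Where the slope a does not vanish, {f = 0} is a graph over the hyperplane of
   the other entries; where it vanishes, the induction takes over. *)
Lemma generic_affine f a (i0 j0 : 'I_n) : loc_lipschitz f -> generic a ->
  (forall Y t, f (Y + t *: delta_mx i0 j0) = f Y + t * a Y) -> generic f.
Proof.
move=> lf [la na da] fa; split => //.
  (* On the piece [N k] the slope is at least 1 / (k + 1) and f has a single Lipschitz constant L,
     so the entry (i0, j0) depends on the others with constant (k + 1) * L. *)
  pose N k := [set X | [/\ `|X| <= k.+1%:R, `|a X| >= k.+1%:R^-1 & f X = 0]].
  apply: (@lebesgue_null_sub _ _ _ _ (\bigcup_(b : bool)
      (if b then [set X | a X = 0] else \bigcup_k N k))).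
    move=> X /= fX; have [aX|aX] := eqVneq (a X) 0; first by exists true.
    exists false => //.
    pose k := maxn (Num.bound `|X|) (Num.bound `|a X|^-1).
    have [kX ka] : `|X| <= k.+1%:R /\ `|a X|^-1 <= k.+1%:R.
      split; (apply: le_trans (ltW (Num.Theory.archi_boundP _)) _; first by rewrite ?invr_ge0).
        by rewrite ler_nat (leq_trans (leq_maxl _ _) (leqnSn _)).
      by rewrite ler_nat (leq_trans (leq_maxr _ _) (leqnSn _)).
    exists k => //; split=> //.
    by rewrite -[leRHS]invrK lef_pV2// posrE ?ltr0n// invr_gt0 normr_gt0.
  apply: lebesgue_null_bigcup_fin; first exact: true.
  case=> //; apply: lebesgue_null_bigcup => k.
  have [L L0 fL] := lf k.+1%:R.
  apply: (@lipschitz_graph_null _ _ _ _ i0 j0 k.+1%:R (k.+1%:R * L)) => //.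
  - by rewrite mulr_gt0.
  - by move=> X i j [XK _ _]; exact: le_trans (mx_norm_ge _ _ _) XK.
  move=> X Y d [XK aX fX] [YK aY fY] d0 XYd.
  (* Y' takes its entry (i0, j0) from X and the others from Y. Then [f Y'] is the difference of
     these entries times [a Y], and since f X = 0 it is at most L times the distance from Y' to
     X. *)
  pose Y' := Y + (X i0 j0 - Y i0 j0) *: delta_mx i0 j0.
  have Y'E i j : Y' i j = if (i, j) == (i0, j0) then X i j else Y i j.
    rewrite !mxE -pair_eqE /=; case: eqP => [->|_]; case: eqP => [->|_] //=; ring.
  have Y'K : `|Y'| <= k.+1%:R.
    apply: mx_norm_le => // i j; rewrite Y'E.
    by case: ifP => _; [apply: le_trans XK|apply: le_trans YK]; exact: mx_norm_ge.
  have := fL _ _ Y'K XK; rewrite fX subr0 fa fY add0r normrM => h.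
  have {}h : `|X i0 j0 - Y i0 j0| * `|a Y| <= L * d.
    apply: le_trans h _; rewrite ler_pM2l//; apply: mx_norm_le => // i j.
    rewrite mxE [(- X) i j]mxE Y'E; case: ifPn => ij; first by rewrite subrr normr0.
    by rewrite distrC XYd.
  have : `|X i0 j0 - Y i0 j0| * k.+1%:R^-1 <= L * d.
    by apply: le_trans h; rewrite ler_wpM2l.
  by rewrite ler_pdivrMr// [leRHS]mulrC mulrA.
move=> X e e0; have [|Y XY aY] := da X (e / 2); first by rewrite divr_gt0.
have [fY|fY] := eqVneq (f Y) 0; last by exists Y => //; lra.
exists (Y + (e / 2) *: delta_mx i0 j0).
  rewrite opprD addrA [ltRHS]splitr; apply: le_lt_trans (ler_normB _ _) _.
  apply: ltr_leD => //; rewrite normrZ gtr0_norm ?divr_gt0//.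
  by rewrite ler_piMr ?norm_delta// divr_ge0// ltW.
by rewrite fa fY add0r mulf_neq0// mulf_neq0 ?invr_neq0 ?gt_eqF.
Qed.

End Generic.

(** * Genericity of the bordered minors and of regularity *)

Section GenericRegular.
Context {R : realType} {n : nat}.
Implicit Types (X Y M : 'M[R]_n).

Definition drop_last k (f : {ffun 'I_k.+2 -> 'I_n}) : {ffun 'I_k.+1 -> 'I_n} :=
  [ffun i => f (lift ord_max i)].

Lemma lift_max_eq0 k (i : 'I_k.+1) : (lift ord_max i == ord0 :> 'I_k.+2) = (i == ord0).
Proof. by rewrite -!val_eqE /= /bump leqNgt ltn_ord. Qed.

Lemma proper_drop_last k (f g : {ffun 'I_k.+2 -> 'I_n}) :
  proper_minor f g -> proper_minor (drop_last f) (drop_last g).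
Proof.
move=> [fi gi]; split=> [i j|i j].
  rewrite !inE => i0 j0; rewrite !ffunE => fE.
  apply: (@lift_inj _ (ord_max : 'I_k.+2)).
  by apply: fi; rewrite // !inE lift_max_eq0.
rewrite !ffunE => gE; exact: (@lift_inj _ (ord_max : 'I_k.+2)) (gi _ _ gE).
Qed.

(** Injectivity of f and g confines the change to the last corner, which lies below the row of ones;
    expanding along the last row, its cofactor is the smaller bordered minor. *)
Lemma bordered_minor_affine k (f g : {ffun 'I_k.+2 -> 'I_n}) Y (t : R) :
  proper_minor f g ->
  bordered_minor f g (Y + t *: delta_mx (f ord_max) (g ord_max)) =
  bordered_minor f g Y + t * bordered_minor (drop_last f) (drop_last g) Y.
Proof.
move=> [fi gi]; rewrite /bordered_minor.
set A := (X in \det X = _); set B := (X in _ = \det X + _).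
have AE i j : A i j = B i j + (if (i == ord_max) && (j == ord_max) then t else 0).
  rewrite !mxE; case: eqVneq => [->|i0]; first by rewrite /= addr0.
  have -> : (f i == f ord_max) = (i == ord_max).
    by apply/eqP/eqP => [/fi->//|->].
  have -> : (g j == g ord_max) = (j == ord_max).
    by apply/eqP/eqP => [/gi->//|->].
  by case: (_ && _); rewrite ?mulr1 ?mulr0.
rewrite (expand_det_row A ord_max) (expand_det_row B ord_max).
have cAB j : cofactor A ord_max j = cofactor B ord_max j.
  rewrite /cofactor; congr (_ * \det _); apply/matrixP => i l.
  rewrite [LHS]mxE [RHS]mxE [LHS]mxE [RHS]mxE AE.
  by rewrite [lift _ _ == _]eq_sym (negbTE (neq_lift _ _)) addr0.
under eq_bigr do rewrite cAB AE eqxx /= mulrDl.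
rewrite big_split/=; congr (_ + _).
rewrite (bigD1 ord_max)//= eqxx big1 ?addr0 => [|j /negbTE ->]; last by rewrite mul0r.
congr (_ * _); rewrite /cofactor -signr_odd addnn odd_double mul1r.
congr (\det _); apply/matrixP => i j.
by rewrite !mxE lift_max_eq0 !ffunE.
Qed.

Lemma bordered_minor_loc_lipschitz k (f g : {ffun 'I_k.+1 -> 'I_n})
    (F : 'M[R]_n -> 'M[R]_n) : (forall i j, loc_lipschitz (fun X => F X i j)) ->
  loc_lipschitz (fun X => bordered_minor f g (F X)).
Proof.
move=> lF; apply: loc_lipschitz_det => i j; under eq_fun do rewrite mxE.
by case: (i == ord0); [exact: loc_lipschitz_cst|exact: lF].
Qed.

Lemma bordered_minor0 (f g : {ffun 'I_1 -> 'I_n}) M : bordered_minor f g M = 1.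
Proof. by rewrite /bordered_minor det_mx11 mxE eqxx. Qed.

Lemma bordered_minor_generic k (f g : {ffun 'I_k.+1 -> 'I_n}) :
  (0 < n)%N -> proper_minor f g -> generic (@bordered_minor R n k f g).
Proof.
move=> n0; elim: k f g => [|k IH] f g fg.
  have -> : @bordered_minor R n 0 f g = fun=> 1.
    by apply/funext => M; exact: bordered_minor0.
  by apply: generic_cst; rewrite // oner_neq0.
apply: (@generic_affine _ _ _ (@bordered_minor R n k (drop_last f) (drop_last g))
  (f ord_max) (g ord_max)).
- exact: (@bordered_minor_loc_lipschitz _ f g id (@loc_lipschitz_coord R n)).
- exact/IH/proper_drop_last.
- by move=> Y t; exact: bordered_minor_affine.
Qed.

(** The induction is repeated with the varied entry transposed; this avoids carrying null sets along
    transposition. *)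
Lemma bordered_minor_tr_generic k (f g : {ffun 'I_k.+1 -> 'I_n}) :
  (0 < n)%N -> proper_minor f g ->
  generic (fun X : 'M[R]_n => bordered_minor f g X^T).
Proof.
move=> n0; elim: k f g => [|k IH] f g fg.
  under eq_fun do rewrite bordered_minor0.
  by apply: generic_cst; rewrite // oner_neq0.
apply: (@generic_affine _ _ _ (fun X => bordered_minor (drop_last f) (drop_last g) X^T)
  (g ord_max) (f ord_max)).
- apply: (@bordered_minor_loc_lipschitz _ f g trmx) => i j.
  by under eq_fun do rewrite mxE; exact: loc_lipschitz_coord.
- exact/IH/proper_drop_last.
- by move=> Y t; rewrite linearD linearZ/= trmx_delta; exact: bordered_minor_affine.
Qed.

(** Injectivity of g bounds the size of a proper minor by n, so finitely many minors decide
    regularity and their product serves as F. *)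
Lemma regular_generic : (0 < n)%N ->
  exists2 F : 'M[R]_n -> R, generic F & forall M, F M != 0 <-> regular M.
Proof.
move=> n0.
pose K := {k : 'I_n & ({ffun 'I_k.+1 -> 'I_n} * {ffun 'I_k.+1 -> 'I_n})%type}.
pose P (x : K) : bool := `[< proper_minor (tagged x).1 (tagged x).2 >].
pose D (x : K) (M : 'M[R]_n) := bordered_minor (tagged x).1 (tagged x).2 M.
exists (fun M => \prod_(x : K | P x) (D x M * D x M^T)).
  apply: generic_prod => // x /asboolP Px; apply: generic_mul.
    exact: bordered_minor_generic.
  exact: bordered_minor_tr_generic.
move=> M; rewrite prodf_seq_neq0; split.
  move=> /allP PM.
  have {}PM k (f g : {ffun 'I_k.+1 -> 'I_n}) : proper_minor f g ->
      bordered_minor f g M * bordered_minor f g M^T != 0.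
    move=> fg; have kn : (k < n)%N.
      by have := leq_card _ fg.2; rewrite !card_ord.
    have := PM (existT _ (Ordinal kn) (f, g)) (mem_index_enum _).
    by move=> /implyP; apply; apply/asboolP.
  by split=> k f g /PM; rewrite mulf_eq0 negb_or => /andP[].
move=> [rM rMT]; apply/allP => x _; apply/implyP => /asboolP Px.
by rewrite mulf_neq0// ?rM ?rMT.
Qed.

End GenericRegular.

(** * Openness of the set of matrices with a completely mixed equilibrium *)

Section CompletelyMixedOpen.
Context {R : realType} {n : nat}.
Implicit Types (X Y M : 'M[R]_n) (q d : 'cV[R]_n).

Definition equalizer M q : Prop :=
  [/\ forall i, 0 < q i 0, \sum_i q i 0 = 1 & exists mu, M *m q = const_mx mu].

Lemma completely_mixedE M z :
  completely_mixed M z <-> equalizer M^T z.1 /\ equalizer M z.2.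
Proof.
split.
  move=> [[[_ s1] [_ s2]] p1 p2 [l ml] mu]; split; split=> //; exists l.
  by rewrite -[LHS]trmxK trmx_mul trmxK ml trmx_const.
move=> [[p1 s1 [l ml]] [p2 s2 mu]]; split=> //.
  by split; split=> // i; exact: ltW.
by exists l; rewrite -[LHS]trmxK trmx_mul trmxK ml trmx_const.
Qed.

Lemma LI_E M : LI R n M <-> (exists! p, equalizer M^T p) /\ (exists! q, equalizer M q).
Proof.
split.
  move=> [[p q] [/completely_mixedE[/= ep eqq] u]]; split.
    exists p; split=> // p' ep'.
    by have /(congr1 fst) := u (p', q) (proj2 (completely_mixedE M (p', q)) (conj ep' eqq)).
  exists q; split=> // q' eq'.
  by have /(congr1 snd) := u (p, q') (proj2 (completely_mixedE M (p, q')) (conj ep eq')).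
move=> [[p [ep up]] [q [eqq uq]]]; exists (p, q); split; first exact/completely_mixedE.
by move=> [p' q'] /completely_mixedE[/= /up -> /uq ->].
Qed.

Lemma finite_pos_lower_bound (I : finType) (f : I -> R) : (forall i, 0 < f i) ->
  exists2 d : R, 0 < d & forall i, d <= f i.
Proof.
move=> f0; exists (\big[Order.min/1]_i f i); last by move=> i; exact: bigmin_le_cond.
by apply: lt_bigmin => // i _.
Qed.

(** Matrix of the linear system [M *m q = const_mx mu], [\sum_i q i 0 = 1] in the unknowns (q,
    mu). *)
Definition bordered M : 'M[R]_(n + 1) :=
  block_mx M (const_mx (-1)) (const_mx 1) 0.

Definition bordered_rhs : 'cV[R]_(n + 1) := col_mx 0 1.

Lemma bordered_mul M q mu : bordered M *m col_mx q (const_mx mu : 'cV_1) =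
  col_mx (M *m q - const_mx mu) (const_mx (\sum_i q i 0)).
Proof.
rewrite /bordered mul_block_col mul0mx addr0; congr (col_mx (_ + _) _).
  by apply/colP => i; rewrite !mxE big_ord1 !mxE mulN1r.
by apply/colP => i; rewrite !mxE; apply: eq_bigr => j _; rewrite !mxE mul1r.
Qed.

Lemma bordered_equalizer M q mu : M *m q = const_mx mu -> \sum_i q i 0 = 1 ->
  bordered M *m col_mx q (const_mx mu : 'cV_1) = bordered_rhs.
Proof.
move=> Mq q1; rewrite bordered_mul Mq subrr q1; congr col_mx.
by apply/colP => i; rewrite !mxE !ord1.
Qed.

(** A kernel vector (d, m) has coordinate sum zero in d, and q + s d is again an equalizer for small
    s because q is strictly positive. Uniqueness forces d = 0, and any row of M then gives m = 0. *)
Lemma unique_equalizer_unit M : (0 < n)%N -> (exists! q, equalizer M q) ->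
  bordered M \in unitmx.
Proof.
move=> n0 [q [[q0 q1 [mu Mq]] uq]]; rewrite unitmxE unitfE -det_tr.
apply/negP => /det0P[v v0 vB]; move/negP: v0; apply.
have {}vB : bordered M *m v^T = 0 by rewrite -[LHS]trmxK trmx_mul trmxK vB trmx0.
rewrite -[v]trmxK -(vsubmxK v^T) in vB *.
set d := usubmx v^T in vB *; set m := dsubmx v^T in vB *.
have mE : m = const_mx (m 0 0) by apply/colP => i; rewrite !mxE !ord1.
move: vB; rewrite mE trmxK bordered_mul -[X in _ = X]col_mx0.
move=> /eq_col_mx[/eqP]; rewrite subr_eq0 => /eqP Md d1.
have {}d1 : \sum_i d i 0 = 0 by move/colP/(_ 0): d1; rewrite !mxE.
have [e e0 eqq] := finite_pos_lower_bound q0.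
pose s := e / (`|d| + 1).
have d0 : 0 < `|d| + 1 by rewrite ltr_wpDl.
have s0 : 0 < s by rewrite divr_gt0.
have qd : equalizer M (q + s *: d).
  split.
  - move=> i; rewrite mxE [X in _ + X]mxE.
    have : s * `|d i 0| < e.
      rewrite /s mulrAC ltr_pdivrMr// ltr_pM2l// ltr_pwDr//.
      exact: mx_norm_ge.
    have := eqq i; have : s * - `|d i 0| <= s * d i 0.
      by rewrite ler_pM2l// lerNl; have := ler_norm (- d i 0); rewrite normrN.
    lra.
  - under eq_bigr do rewrite mxE [X in _ + X]mxE.
    by rewrite big_split/= -mulr_sumr d1 mulr0 addr0.
  - exists (mu + s * m 0 0); rewrite mulmxDr -scalemxAr Mq Md.
    by apply/matrixP => i j; rewrite !mxE.
have dz : d = 0.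
  have := uq _ qd => /esym/eqP; rewrite addrC -subr_eq0 addrK scaler_eq0.
  by rewrite gt_eqF//= => /eqP.
move: Md; rewrite dz mulmx0 => /colP/(_ (Ordinal n0)); rewrite !mxE => mz.
by rewrite -mz; apply/eqP/rowP => i; rewrite !mxE; case: splitP => j _; rewrite mxE.
Qed.

(** Numerator of Cramer's rule for the coordinate i of the equalizer. *)
Definition equalizer_num M (i : 'I_n) : R :=
  (\adj (bordered M) *m bordered_rhs) (lshift 1 i) 0.

(** By Cramer's rule the i-th coordinate is the quotient of the two factors, whose sign is that of
    their product. This makes the condition a finite system of strict polynomial inequalities, hence
    open. *)
Lemma unique_equalizerP M : (0 < n)%N -> (exists! q, equalizer M q) <->
  forall i, 0 < equalizer_num M i * \det (bordered M).
Proof.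
move=> n0; split=> [uM i|pos].
  have := unique_equalizer_unit n0 uM; rewrite unitmxE unitfE => D0.
  have [q [[q0 q1 [mu Mq]] _]] := uM.
  rewrite /equalizer_num -(bordered_equalizer Mq q1) mulmxA mul_adj_mx mul_scalar_mx.
  by rewrite mxE col_mxEu mulrAC mulr_gt0// -expr2 exprn_even_gt0.
set D := \det (bordered M) in pos.
have D0 : D != 0.
  by apply/eqP => D0; have := pos (Ordinal n0); rewrite D0 mulr0 ltxx.
have uD : bordered M \in unitmx by rewrite unitmxE unitfE.
pose v := D^-1 *: (\adj (bordered M) *m bordered_rhs).
have Bv : bordered M *m v = bordered_rhs.
  by rewrite -scalemxAr mulmxA mul_mx_adj mul_scalar_mx scalerA mulVf// scale1r.
pose q := usubmx v; pose m := dsubmx v.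
have mE : m = const_mx (m 0 0) by apply/colP => i; rewrite !mxE !ord1.
move: Bv; rewrite -[v]vsubmxK -/q -/m mE bordered_mul => /eq_col_mx[/eqP].
rewrite subr_eq0 => /eqP Mq /colP/(_ 0); rewrite !mxE/= => q1.
exists q; split.
  split=> //; last by exists (m 0 0).
  move=> i; have -> : q i 0 = equalizer_num M i * D * D^-1 ^+ 2.
    by rewrite /q /v !mxE /equalizer_num [in RHS]mxE; field.
  by rewrite mulr_gt0// exprn_even_gt0// invr_eq0.
move=> q' [_ q'1 [mu' Mq']]; have := bordered_equalizer Mq' q'1.
rewrite -(bordered_equalizer Mq q1) => /(congr1 (mulmx (invmx (bordered M)))).
by rewrite !mulKmx// => /eq_col_mx[->].
Qed.

Lemma loc_lipschitz_pos_near (f : 'M[R]_n -> R) X : loc_lipschitz f -> 0 < f X ->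
  \forall Y \near X, 0 < f Y.
Proof.
move=> lf fX; have [d d0 fd] := loc_lipschitz_near X lf fX.
apply/nbhs_ballP; exists d => // Y; rewrite -ball_normE => /fd.
by rewrite ltr_distlC => /andP[+ _]; rewrite subrr.
Qed.

Lemma loc_lipschitz_bordered i j : loc_lipschitz (fun M => bordered M i j).
Proof.
case: (split_ordP i) => i' ->; case: (split_ordP j) => j' ->; rewrite /bordered.
- by under eq_fun do rewrite block_mxEul; exact: loc_lipschitz_coord.
- by under eq_fun do rewrite block_mxEur mxE; exact: loc_lipschitz_cst.
- by under eq_fun do rewrite block_mxEdl mxE; exact: loc_lipschitz_cst.
- by under eq_fun do rewrite block_mxEdr mxE; exact: loc_lipschitz_cst.
Qed.

Lemma loc_lipschitz_equalizer i :
  loc_lipschitz (fun M => equalizer_num M i * \det (bordered M)).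
Proof.
apply: loc_lipschitz_mul; last exact/loc_lipschitz_det/loc_lipschitz_bordered.
rewrite /equalizer_num; under eq_fun do rewrite mxE.
apply: loc_lipschitz_sum => k; under eq_fun do rewrite mxE.
apply: loc_lipschitz_mul; last exact: loc_lipschitz_cst.
rewrite /cofactor; apply: loc_lipschitz_mul; first exact: loc_lipschitz_cst.
apply: loc_lipschitz_det => u v; under eq_fun do rewrite 2!mxE.
exact: loc_lipschitz_bordered.
Qed.

Lemma loc_lipschitz_tr (f : 'M[R]_n -> R) :
  loc_lipschitz f -> loc_lipschitz (fun M => f M^T).
Proof.
have trn X : `|X^T| = `|X|.
  apply/eqP; rewrite eq_le; apply/andP; split; apply: mx_norm_le => // i j.
    by rewrite mxE; exact: mx_norm_ge.
  by have := mx_norm_ge X^T j i; rewrite mxE.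
move=> lf K; have [L L0 fL] := lf K; exists L => // X Y XK YK.
by rewrite -(trn (X - Y)) linearB/= fL// trn.
Qed.

Lemma LI_open : (0 < n)%N -> open (LI R n).
Proof.
move=> n0; rewrite openE => M /LI_E[].
move=> /(unique_equalizerP _ n0) pM /(unique_equalizerP _ n0) qM.
have nearp : \forall Y \near M, forall i, 0 < equalizer_num Y^T i * \det (bordered Y^T).
  apply: (@filter_forall _ _ _ (nbhs M) (nbhs_filter M)) => i.
  exact: (loc_lipschitz_pos_near (loc_lipschitz_tr (@loc_lipschitz_equalizer i))).
have nearq : \forall Y \near M, forall i, 0 < equalizer_num Y i * \det (bordered Y).
  apply: (@filter_forall _ _ _ (nbhs M) (nbhs_filter M)) => i.
  exact: (loc_lipschitz_pos_near (@loc_lipschitz_equalizer i)).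
rewrite /interior/=; apply: filterS2 nearp nearq => Y pY qY.
by apply/LI_E; split; exact/unique_equalizerP.
Qed.

Lemma regular_LI_open_dense_conull : (0 < n)%N ->
  let W := LI R n `&` [set M | regular M] in
  [/\ open W, LI R n `<=` closure W & lebesgue_null (LI R n `\` W)].
Proof.
move=> n0; have [F [lF nF dF] FP] := @regular_generic R n n0.
have -> /= : [set M | regular M] = [set M | F M != 0].
  by apply/seteqP; split=> M /FP.
split.
- apply: openI; first exact: LI_open.
  rewrite openE => M /= FM.
  have lF2 := loc_lipschitz_mul lF lF.
  have /(loc_lipschitz_pos_near lF2) : 0 < F M * F M.
    by rewrite -expr2 exprn_even_gt0.
  by apply: filterS => Y; apply: contraTneq => ->; rewrite mulr0 ltxx.
- move=> M LM B MB; have : nbhs M (LI R n `&` B).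
    by apply: filterI => //; apply: open_nbhs_nbhs; split=> //; exact: LI_open.
  move=> /nbhs_ballP[e /= e0 eLB]; have [Y MY FY] := dF M e e0.
  have [LY BY] : (LI R n `&` B) Y by apply: eLB; rewrite -ball_normE.
  by exists Y.
- apply: lebesgue_null_sub nF => M [LM nW]; apply/eqP/negPn/negP => FM.
  exact: nW.
Qed.

End CompletelyMixedOpen.

(** * Absolutely continuous functions with nonnegative lower derivative *)

Section RealInduction.
Context {R : realType}.

(** Let m be the supremum of the times up to which P holds. The limit hypothesis carries P to m, and
    the step hypothesis excludes m < t. *)
Lemma real_induction (a b : R) (P : R -> Prop) :
  P a ->
  (forall t, a <= t < b -> P t ->
    exists2 d : R, 0 < d & forall s, t < s < t + d -> s <= b -> P s) ->
  (forall t, a < t <= b -> (forall s, a <= s < t -> P s) -> P t) ->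
  forall t, a <= t <= b -> P t.
Proof.
move=> Pa Pstep Plim t /andP[a_t tb].
pose S : set R := [set s | a <= s <= t /\ forall r, a <= r <= s -> P r].
have Sa : S a.
  split; first by rewrite lexx.
  by move=> r; rewrite -eq_le => /eqP <-.
have St s : S s -> s <= t by case=> /andP[].
have hS : has_sup S by split; [exists a|exists t => s /St].
pose m := sup S.
have am : a <= m by apply: sup_upper_bound.
have mt : m <= t by apply: ge_sup; [exists a|move=> s /St].
have Pm s : a <= s < m -> P s.
  move=> /andP[a_s sm].
  have [r [_ Pr] sr] := sup_adherent (eps := m - s) ltac:(by rewrite subr_gt0) hS.
  by apply: Pr; rewrite a_s; move: sr; rewrite -/m subKr => /ltW.
have {}Pm s : a <= s <= m -> P s.
  move=> /andP[a_s]; rewrite le_eqVlt => /orP[/eqP sm|sm]; last first.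
    by apply: Pm; rewrite a_s.
  move: a_s; rewrite le_eqVlt => /orP[/eqP <- //|a_s].
  by apply: Plim; [rewrite a_s sm (le_trans mt)|rewrite sm].
move: mt; rewrite le_eqVlt => /orP[/eqP mE|mt].
  by apply: Pm; rewrite a_t mE lexx.
have [||d d0 dP] := Pstep m; [|by apply: Pm; rewrite am lexx|].
  by rewrite am (lt_le_trans mt).
pose r := Num.min t (m + d / 2).
have mr : m < r by rewrite lt_min mt ltrDl divr_gt0.
have : S r.
  split; first by rewrite (le_trans am (ltW mr)) ge_min lexx.
  move=> s /andP[a_s sr]; have [sm|ms] := leP s m; first by apply: Pm; rewrite a_s.
  apply: dP; last by apply: le_trans tb; move: sr; rewrite le_min => /andP[].
  rewrite ms; apply: le_lt_trans sr _; rewrite gt_min; apply/orP; right.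
  by rewrite ltrD2l ltr_pdivrMr// ltr_pMr// ltr1n.
by move=> /(sup_upper_bound hS); rewrite -/m leNgt mr.
Qed.

End RealInduction.

Section AbsoluteContinuity.
Context {R : realType}.
Implicit Types (f : R -> R) (a b e : R) (U : set R).

Definition subintervals a b U (N : nat) (s t : nat -> R) : Prop :=
  [/\ forall k, (k < N)%N -> a <= s k /\ s k <= t k /\ t k <= b,
      trivIset `I_N (fun k => `]s k, t k[%classic)
    & forall k, (k < N)%N -> `]s k, t k[%classic `<=` U].

(* U is meant to be a small neighbourhood of the exceptional null set: the
   variation of f over U pays for the increments over U. *)
Lemma dini_lower_bound f a b U e : a <= b -> open U ->
  (forall N s t, subintervals a b U N s t ->
    \sum_(k < N) `|f (t k) - f (s k)| <= e) ->
  (forall t, a < t <= b -> forall h : R, 0 < h ->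
    exists2 d : R, 0 < d & forall s, t - d < s < t -> a <= s -> `|f t - f s| < h) ->
  (forall t, a <= t < b -> ~ U t -> exists2 d : R, 0 < d &
    forall s, t < s < t + d -> s <= b -> - (e * (s - t)) <= f s - f t) ->
  0 < e ->
  - (e * (b - a)) - e <= f b - f a.
Proof.
move=> ab oU smallU fc dini e0.
(* v is the variation of f over finitely many disjoint intervals inside both [a, t] and U. *)
pose V t v := exists N x y, subintervals a t U N x y /\
  v = \sum_(k < N) `|f (y k) - f (x k)|.
have VS t s v : t <= s -> V t v -> V s v.
  move=> ts [N [x [y [[xy tr xyU] vE]]]]; exists N, x, y; split=> //; split=> //.
  by move=> k /xy[h1 [h2 h3]]; do 2!split=> //; exact: le_trans ts.
(* A decrease of f up to t is paid by the slope e off U, by the variation v on U, and by a slack h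
   that lets P pass to limits from the left. *)
pose P t := forall h : R, 0 < h -> exists2 v, V t v & - (e * (t - a)) - v - h <= f t - f a.
suff Pb : P b.
  apply/ler_addgt0Pr => h h0; have [v [N [x [y [xyU vE]]]] fv] := Pb h h0.
  have := smallU _ _ _ xyU; rewrite -vE; lra.
apply: (@real_induction _ a b) => [|t /andP[a_t tb] Pt|t /andP[a_t tb] Pt|]; last 1 first.
- by rewrite ab lexx.
- move=> h h0; exists 0.
    exists 0%N, (fun=> 0), (fun=> 0); rewrite big_ord0; split=> //; split=> //.
  by rewrite !subrr mulr0; lra.
- have [Ut|nUt] := pselect (U t).
    have : nbhs t U by rewrite nbhsE; exists U.
    move=> /nbhs_ballP[d /= d0 dU]; exists d => // s /andP[ts std] sb h h0.
    have [v [N [x [y [[xy tr xyU] vE]]]] fv] := Pt h h0.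
    have tsU : `]t, s[%classic `<=` U.
      move=> r /=; rewrite in_itv/= => /andP[tr' rs]; apply: dU.
      rewrite -ball_normE /= ltr_distlC; lra.
    exists (v + `|f s - f t|); last first.
      have := ler_norm (- (f s - f t)); rewrite normrN.
      have : e * (t - a) <= e * (s - a) by rewrite ler_pM2l//; lra.
      lra.
    exists N.+1, (fun k => if (k < N)%N then x k else t),
      (fun k => if (k < N)%N then y k else s); split; last first.
      rewrite big_ord_recr/= ltnn vE; congr (_ + _).
      by apply: eq_bigr => k _; rewrite ltn_ord.
    split.
    + move=> k; case: ifP => [/xy[h1 [h2 h3]] _|_ _]; first by lra.
      by lra.
    + apply/trivIsetP => i j /= iN jN ij.
      have disj k r : (k < N)%N -> r \in `]x k, y k[ -> ~ r \in `]t, s[.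
        by move=> /xy[_ [_ h3]]; rewrite !in_itv/= => /andP[_ ry] /andP[rt _]; lra.
      case: ifPn => iN'; case: ifPn => jN'.
      * by move/trivIsetP : tr => /(_ i j iN' jN' ij).
      * by rewrite -subset0 => r /= [rx /(disj _ _ iN' rx)].
      * by rewrite -subset0 => r /= [rt rx]; exact: disj rx rt.
      * have lastE k : (k < N.+1)%N -> ~~ (k < N)%N -> k = N.
          by move=> kN kN'; apply/eqP; rewrite eqn_leq -ltnS kN leqNgt.
        by move: ij; rewrite (lastE _ iN iN') (lastE _ jN jN') eqxx.
    + by move=> k _; case: ifPn => // kN; exact: xyU.
  have [|d d0 fd] := dini t _ nUt; first by rewrite a_t.
  exists d => // s /andP[ts std] sb h h0; have [v Vv fv] := Pt h h0.
  exists v; first exact: VS (ltW ts) Vv.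
  have := fd s; rewrite ts std => /(_ isT sb); lra.
- move=> h h0; have h20 : 0 < h / 2 by rewrite divr_gt0.
  have [|d d0 fd] := fc t _ _ h20; first by rewrite a_t.
  pose s := Num.max a (t - d / 2).
  have st : s < t by rewrite gt_max a_t/= gtrBl divr_gt0.
  have a_s : a <= s by rewrite le_max lexx.
  have [v Vv fv] := Pt s ltac:(by rewrite a_s) _ h20.
  exists v; first exact: VS (ltW st) Vv.
  have /ltW := fd s ltac:(rewrite st andbT lt_max; apply/orP; right; rewrite ltrD2l ltrN2 ltr_pdivrMr// ltr_pMr// ltr1n//) a_s.
  rewrite ler_norml => /andP[u1 u2].
  have : e * (s - a) <= e * (t - a) by rewrite ler_pM2l//; lra.
  lra.
Qed.

End AbsoluteContinuity.

Lemma ac_modulus {R : realType} {W : normedModType R} (u : R -> W) (a b h : R) :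
  abs_continuous_on a b u -> 0 < h ->
  exists2 d : R, 0 < d & forall s t, a <= s -> s <= t -> t <= b -> t - s < d ->
    `|u t - u s| < h.
Proof.
move=> acu h0; have [d d0 ud] := acu h h0; exists d => // s t a_s st tb std.
have := ud 1%N (fun=> s) (fun=> t); rewrite !big_ord1; apply=> //.
by apply/trivIsetP => -[|//] [|//].
Qed.

Section DiniMonotone.
Context {R : realType}.
Implicit Types (f : R -> R) (a b e : R) (U E : set R).

Definition ac_on a b f : Prop := @abs_continuous_on R R^o a b f.

Lemma subintervals_length a b U N (s t : nat -> R) (d : R) : open U ->
  (lebesgue_measure U < d%:E)%E -> subintervals a b U N s t ->
  \sum_(k < N) (t k - s k) < d.
Proof.
move=> oU Ud [st tr stU].
pose F k : set R := if (k < N)%N then `]s k, t k[%classic else set0.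
have mF k : measurable (F k) by rewrite /F; case: ifP => _; [exact: measurable_itv|exact: measurable0].
have trF : trivIset setT F.
  apply/trivIsetP => i j _ _ ij; rewrite /F.
  case: ifPn => iN; last by rewrite set0I.
  case: ifPn => jN; last by rewrite setI0.
  by move/trivIsetP : tr => /(_ i j iN jN ij).
rewrite -lte_fin -sumEFin; apply: le_lt_trans Ud.
have -> : (\sum_(k < N) (t k - s k)%:E = \sum_(k < N) lebesgue_measure (F k))%E.
  apply: eq_bigr => k _; rewrite /F ltn_ord lebesgue_measure_itv/= lte_fin.
  have [_ [skt _]] := st k (ltn_ord k).
  by case: ltP => [_|tks]; [rewrite EFinB|rewrite (@le_anti _ _ (s k) (t k)) ?subrr// skt].
rewrite -measure_bigsetU//; apply: le_measure; rewrite ?inE.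
- by apply: bigsetU_measurable => k _; exact: mF.
- exact: measurable_realfun.open_measurable.
- move=> r; rewrite -bigcup_mkord => -[k /= kN]; rewrite /F kN; exact: stU.
Qed.

Lemma negligible_open_cover E e : lebesgue_measure.-negligible E -> 0 < e ->
  exists U, [/\ open U, E `<=` U & (lebesgue_measure U < e%:E)%E].
Proof.
move=> [A [mA A0 EA]] e0.
have [|U [oU AU Ue]] := @lebesgue_regularity_outer R A e mA _ e0.
  by apply: (@le_lt_trans _ _ 0%E); [rewrite le_eqVlt; apply/orP; left; exact/eqP|rewrite ltry].
exists U; split=> //; first exact: subset_trans AU.
rewrite (measureDI _ _ mA); last exact: measurable_realfun.open_measurable.
apply: le_lt_trans Ue; rewrite (setIidr AU) -[leRHS]adde0 leeD2l//.
by rewrite le_eqVlt; apply/orP; left; exact/eqP.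
Qed.

Lemma ac_small_cover f a b E e : ac_on a b f -> lebesgue_measure.-negligible E ->
  0 < e -> exists U, [/\ open U, E `<=` U & forall N s t, subintervals a b U N s t ->
    \sum_(k < N) `|f (t k) - f (s k)| <= e].
Proof.
move=> acf E0 e0; have [d d0 fd] := acf e e0.
have [U [oU EU Ud]] := negligible_open_cover E0 d0.
exists U; split=> // N s t st; apply/ltW/fd; [|by case: st|].
  by case: st => + _ _; apply.
exact: subintervals_length Ud st.
Qed.

(** A nonnegative lower right Dini derivative off a null set suffices: absolute continuity makes the
    variation of f small over a small open neighbourhood of that set. *)
Lemma ac_nondecreasing f a b E : a <= b -> ac_on a b f ->
  lebesgue_measure.-negligible E ->
  (forall t, a <= t < b -> ~ E t -> forall e, 0 < e -> exists2 d : R, 0 < d &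
    forall s, t < s < t + d -> s <= b -> - (e * (s - t)) <= f s - f t) ->
  f a <= f b.
Proof.
move=> ab acf E0 dini; rewrite -subr_ge0; apply/ler_addgt0Pr => h h0.
(* The loss e * (b - a) + e allowed by [dini_lower_bound] is then exactly h. *)
pose e := h / (b - a + 1).
have ba0 : 0 < b - a + 1 by lra.
have e0 : 0 < e by rewrite divr_gt0.
have [U [oU EU smallU]] := ac_small_cover acf E0 e0.
have := dini_lower_bound ab oU smallU; have -> : e * (b - a) = h - e.
  by rewrite /e; field; rewrite gt_eqF.
move=> H; suff : - (h - e) - e <= f b - f a by lra.
apply: H => //.
- move=> t /andP[a_t tb] r r0; have [d d0 fd] := @ac_modulus R R^o f a b r acf r0; exists d => // s.
  by move=> /andP[tds st] a_s; apply: fd => //; [exact: ltW|lra].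
- by move=> t tab nU; apply: dini => // /EU.
Qed.

(** [dini_lower_bound] in reversed time. The hypothesis bounds [f s - f t] from below for s on the
    left of t, which is the form that a function touched from below supplies. *)
Lemma ac_nonincreasing f a b E : a <= b -> ac_on a b f ->
  lebesgue_measure.-negligible E ->
  (forall t, a < t <= b -> ~ E t -> forall e, 0 < e -> exists2 d : R, 0 < d &
    forall s, t - d < s < t -> a <= s -> - (e * (t - s)) <= f s - f t) ->
  f b <= f a.
Proof.
move=> ab acf E0 dini; rewrite -subr_ge0; apply/ler_addgt0Pr => h h0.
pose e := h / (b - a + 1).
have ba0 : 0 < b - a + 1 by lra.
have e0 : 0 < e by rewrite divr_gt0.
have [U [oU EU smallU]] := ac_small_cover acf E0 e0.
have ab' : - b <= - a by rewrite lerN2.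
have oU' : open (-%R @^-1` U : set R).
  by apply: open_comp oU => x _; exact: opp_continuous.
have := @dini_lower_bound R (fun x => f (- x)) (- b) (- a) (-%R @^-1` U) e ab' oU'.
rewrite !opprK; have -> : e * (- a + b) = h - e.
  by rewrite /e; field; rewrite gt_eqF.
move=> H; suff : - (h - e) - e <= f a - f b by lra.
apply: H => //.
- move=> N s t [st tr stU].
  have /smallU : subintervals a b U N (fun k => - t k) (fun k => - s k).
    split.
    + by move=> k /st[h1 [h2 h3]]; lra.
    + apply/trivIsetP => i j iN jN ij; rewrite -subset0 => x /=.
      move/trivIsetP : tr => /(_ i j iN jN ij); rewrite -subset0 => tr [xi xj].
      by apply: (tr (- x)); split; rewrite /= in_itv/=; [move: xi|move: xj];
        rewrite in_itv/= => /andP[? ?]; apply/andP; split; lra.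
    + move=> k kN x /=; rewrite in_itv/= => /andP[h1 h2].
      by have := stU k kN (- x); rewrite /= opprK; apply; rewrite in_itv/=; apply/andP; split; lra.
  by under eq_bigr do rewrite distrC.
- move=> t /andP[a_t tb] r r0; have [d d0 fd] := @ac_modulus R R^o f a b r acf r0; exists d => // s.
  by move=> /andP[tds st] a_s; rewrite distrC; apply: fd; lra.
- move=> t /andP[ta tb] nU.
  have [||d d0 fd] := dini (- t) _ _ _ e0; [by apply/andP; split; lra|by move=> /EU|].
  exists d => // s /andP[ts std] sa; have := fd (- s).
  have -> : - t - - s = s - t by ring.
  by apply; [apply/andP; split; lra|lra].
Qed.

End DiniMonotone.

(** * Derivatives as first-order approximations *)

Section Approximation.
Context {R : realType} {W : normedModType R}.
Implicit Types (u : R -> W) (D : W).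

(** The derivative without quotients or filters, a form that feeds the Dini estimates directly. *)
Definition approx_at u (t : R) D : Prop := forall h : R, 0 < h ->
  exists2 d : R, 0 < d & forall s, `|s - t| < d ->
    `|u s - u t - (s - t) *: D| <= h * `|s - t|.

Lemma is_derive_approx u t D : is_derive t (1 : R) u D -> approx_at u t D.
Proof.
move=> uD h h0; have [dv dE] := uD.
have : (fun r : R => r^-1 *: ((u \o shift t) (r *: (1 : R)) - u t)) @ 0^' --> D.
  by rewrite -dE; exact: dv.
move=> /cvgrPdist_le/(_ h h0); move=> /nbhs_ballP[d /= d0 dP].
exists d => // s sd; have [->|st] := eqVneq s t.
  by rewrite !subrr scale0r subr0 !normr0 mulr0.
have st0 : s - t != 0 by rewrite subr_eq0.
have := dP (s - t); rewrite /ball/= sub0r normrN => /(_ sd st0).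
rewrite [(s - t) *: 1]mulr1 subrK => H.
have -> : u s - u t - (s - t) *: D = - ((s - t) *: (D - (s - t)^-1 *: (u s - u t))).
  by rewrite scalerBr scalerA mulfV// scale1r opprB.
by rewrite normrN normrZ mulrC ler_wpM2r.
Qed.

Lemma approx_is_derive u t D : approx_at u t D -> is_derive t (1 : R) u D.
Proof.
move=> uD.
have cv : (fun r : R => r^-1 *: ((u \o shift t) (r *: (1 : R)) - u t)) @ 0^' --> D.
  apply/cvgrPdist_le => h h0; have [d d0 dP] := uD h h0.
  apply/nbhs_ballP; exists d => // r /=.
  rewrite /ball/= sub0r normrN => rd r0.
  have := dP (r + t); rewrite addrK => /(_ rd); rewrite [r *: 1]mulr1 => H.
  have -> : D - r^-1 *: (u (r + t) - u t) = - (r^-1 *: (u (r + t) - u t - r *: D)).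
    by rewrite [in RHS]scalerBr scalerA mulVf// scale1r opprB.
  rewrite normrN normrZ normfV mulrC ler_pdivrMr ?normr_gt0//.
by split; [apply/cvg_ex; exists D|exact: cvg_lim].
Qed.

End Approximation.

Section AcDominated.
Context {R : realType} {W W' : normedModType R}.

Lemma ac_dominated (u : R -> W) (f : R -> W') (a b C : R) :
  abs_continuous_on a b u -> 0 <= C ->
  (forall s t, a <= s -> s <= t -> t <= b ->
    `|f t - f s| <= C * (`|u t - u s| + (t - s))) ->
  abs_continuous_on a b f.
Proof.
move=> acu C0 fu h h0; pose h' := h / (2 * (C + 1)).
have C1 : 0 < C + 1 by rewrite ltr_wpDl.
have h'0 : 0 < h' by rewrite divr_gt0// mulr_gt0.
have [d d0 dP] := acu h' h'0.
exists (Num.min d h'); first by rewrite lt_min d0.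
move=> N s t st tr; rewrite lt_min => /andP[sd sh].
have := dP N s t st tr sd => su.
apply: (@le_lt_trans _ _ (C * (\sum_(k < N) `|u (t k) - u (s k)| + \sum_(k < N) (t k - s k)))).
  rewrite -big_split/= mulr_sumr; apply: ler_sum => k _.
  by have [h1 [h2 h3]] := st k (ltn_ord k); exact: fu.
have hE : 2 * (C + 1) * h' = h by rewrite /h' mulrC divfK// gt_eqF// mulr_gt0.
have : 0 <= \sum_(k < N) `|u (t k) - u (s k)| by apply: sumr_ge0.
have : C * (\sum_(k < N) `|u (t k) - u (s k)| + \sum_(k < N) (t k - s k)) <= C * (h' + h').
  by rewrite ler_wpM2l// lerD// ltW.
lra.
Qed.

End AcDominated.

Section LeftLimit.
Context {R : realType}.

(** The Lipschitz bound makes the image of the left neighbourhoods of T a Cauchy filter, which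
    converges by completeness. *)
Lemma mx_lipschitz_left_limit m n (u : R -> 'M[R]_(m, n)) (a T L : R) : a < T -> 0 < L ->
  (forall t r, a <= t -> t <= r -> r < T -> `|u r - u t| <= L * (r - t)) ->
  exists l, forall h : R, 0 < h -> exists2 d : R, 0 < d &
    forall r, a <= r -> T - d < r < T -> `|l - u r| <= h.
Proof.
move=> aT L0 lu; pose F := u @ at_left T.
have PF : ProperFilter F by exact: fmap_proper_filter.
have cF : cauchy F.
  apply: cauchy_exP => h h0; pose t := Num.max a (T - h / (2 * L)).
  have L20 : 0 < 2 * L by rewrite mulr_gt0.
  have tT : t < T by rewrite gt_max aT gtrBl divr_gt0.
  exists (u t); rewrite /F /=; near=> r.
  have tr : t < r by near: r; exact: nbhs_left_gt.
  have rT : r < T by near: r; exact: nbhs_left_lt.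
  rewrite -ball_normE /= distrC; apply: le_lt_trans (lu _ _ _ (ltW tr) rT) _.
    by rewrite le_max lexx.
  have : T - h / (2 * L) <= t by rewrite le_max lexx orbT.
  move=> tge; apply: (@le_lt_trans _ _ (L * (h / (2 * L)))).
    by rewrite ler_pM2l//; lra.
  have -> : L * (h / (2 * L)) = h / 2 by field; rewrite gt_eqF.
  by rewrite ltr_pdivrMr// ltr_pMr// ltr1n.
have Fl : F --> lim F by apply: cauchy_cvg.
exists (lim F) => h h0; have := Fl => /cvgrPdist_le/(_ h h0) -[d /= d0 dP]; exists d => // r ar /andP[Tr rT].
by apply: dP => //; rewrite /ball/= ltr_norml; lra.
Unshelve. all: by end_near. Qed.

End LeftLimit.

(** * Sets of times isolated from one side *)

Section RightIsolated.
Context {R : realType}.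
Implicit Types (A : set R).

Lemma countable_inj_preimage {T U : Type} (f : T -> U) (A : set U) (B : set T) :
  (forall t, B t -> A (f t)) -> {in B &, injective f} -> countable A -> countable B.
Proof.
move=> BA fi /countable_injP[g gi]; apply/countable_injP; exists (g \o f).
move=> t r tB rB /= /gi fE; apply: fi => //.
by apply: fE; rewrite inE; apply: BA; rewrite -inE.
Qed.

(** A rational number in the gap to the right of each point gives an injection. *)
Lemma countable_right_isolated A :
  (forall t, A t -> exists2 d : R, 0 < d & forall r, t < r < t + d -> ~ A r) ->
  countable A.
Proof.
move=> iso.
have /choice[q qP] t : exists q : rat, A t -> t < ratr q /\ forall r, A r -> ~ (t < r <= ratr q).
  have [At|nAt] := pselect (A t); last by exists 0.
  have [d d0 dP] := iso t At.
  have td : t < t + d by rewrite ltrDl.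
  have [q] := rat_in_itvoo td; rewrite in_itv/= => /andP[tq qd].
  exists q => _; split=> // r Ar /andP[tr rq]; apply: (dP r) => //.
  by rewrite tr (le_lt_trans rq).
apply/countable_injP; exists (pickle \o q) => t r /set_mem At /set_mem Ar /=.
move=> /(pcan_inj (@pickleK rat)) qE.
have [tq tP] := qP t At; have [rq rP] := qP r Ar.
apply/eqP; rewrite eq_le !leNgt; apply/andP; split; apply/negP => h.
- by apply: (rP t At); rewrite h -qE ltW.
- by apply: (tP r Ar); rewrite h qE ltW.
Qed.

Lemma countable_left_isolated A :
  (forall t, A t -> exists2 d : R, 0 < d & forall r, t - d < r < t -> ~ A r) ->
  countable A.
Proof.
move=> iso; apply: (@countable_inj_preimage _ _ -%R (-%R @^-1` A)).
- by move=> t At; rewrite /= opprK.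
- by move=> t r _ _; exact: oppr_inj.
apply: countable_right_isolated => t /= /iso[d d0 dP]; exists d => // r /andP[tr rd].
by apply: dP; lra.
Qed.

Lemma countable_negligible A : countable A -> lebesgue_measure.-negligible A.
Proof.
move=> cA; apply/negligibleP; last exact: countable_lebesgue_measure0.
by apply: countable_measurable => // t; exact: measurable_set1.
Qed.
End RightIsolated.

Section ApproximationRules.
Context {R : realType}.

Lemma approx_shift {W : normedModType R} (u : R -> W) (t : R) (D c : W) :
  approx_at u t D -> approx_at (fun s => c + u s) t D.
Proof.
move=> uD h h0; have [d d0 dP] := uD h h0; exists d; first exact: d0.
by move=> s sd; rewrite opprD addrACA subrr add0r; exact: dP.
Qed.

Lemma approx_bound {W : normedModType R} (u : R -> W) (t : R) (D : W) : approx_at u t D -> exists2 d : R, 0 < d &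
  forall s, `|s - t| < d -> `|u s - u t| <= (`|D| + 1) * `|s - t|.
Proof.
move=> uD; have [d d0 dP] := uD 1 ltr01; exists d; first exact: d0.
move=> s sd; have -> : u s - u t = (u s - u t - (s - t) *: D) + (s - t) *: D by rewrite subrK.
apply: le_trans (ler_normD _ _) _; rewrite normrZ.
have := dP s sd; lra.
Qed.

Lemma approx_chain {W : normedModType R} (u : R -> W) (g : R -> R) (t g' : R) (D : W) :
  approx_at u (g t) D -> @approx_at R R^o g t g' -> approx_at (u \o g) t (g' *: D).
Proof.
move=> uD gD h h0; have A0 : 0 < `|g'| + 1 by rewrite ltr_wpDl.
have D0 : 0 < `|D| + 1 by rewrite ltr_wpDl.
have [d1 d10 d1P] := approx_bound gD.
(* h1 pays for the error of u along g, and h2 for the error of g times D. *)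
pose h1 := h / (2 * (`|g'| + 1)); pose h2 := h / (2 * (`|D| + 1)).
have h10 : 0 < h1 by rewrite divr_gt0// mulr_gt0.
have h20 : 0 < h2 by rewrite divr_gt0// mulr_gt0.
have [d2 d20 d2P] := uD h1 h10; have [d3 d30 d3P] := gD h2 h20.
exists (Num.min d1 (Num.min (d2 / (`|g'| + 1)) d3)); first by rewrite !lt_min d10 divr_gt0.
move=> s; rewrite !lt_min => /andP[sd1 /andP[sd2 sd3]].
have gb := d1P s sd1; rewrite ltr_pdivlMr// in sd2.
have gd : `|g s - g t| < d2 by apply: le_lt_trans gb _; rewrite mulrC.
have ub := d2P (g s) gd; have rb := d3P s sd3.
have -> : (u \o g) s - (u \o g) t - (s - t) *: (g' *: D) =
    (u (g s) - u (g t) - (g s - g t) *: D) + (g s - g t - (s - t) *: (g' : R^o)) *: D.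
  by rewrite [X in _ = _ + X]scalerBl scalerA addrA subrK.
apply: le_trans (ler_normD _ _) _; rewrite normrZ.
have st0 := normr_ge0 (s - t).
have H1 : h1 * `|g s - g t| <= h / 2 * `|s - t|.
  have -> : h / 2 * `|s - t| = h1 * ((`|g'| + 1) * `|s - t|).
    by rewrite /h1; field; rewrite gt_eqF.
  by rewrite ler_pM2l.
have H2 : `|g s - g t - (s - t) *: (g' : R^o)| * `|D| <= h / 2 * `|s - t|.
  apply: (@le_trans _ _ (h2 * `|s - t| * `|D|)); first by rewrite ler_wpM2r.
  have -> : h / 2 * `|s - t| = h2 * `|s - t| * (`|D| + 1).
    by rewrite /h2; field; rewrite gt_eqF.
  apply: ler_wpM2l; first by rewrite mulr_ge0// ltW.
  by rewrite lerDl.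
lra.
Qed.

Lemma approx_scale {W : normedModType R} (u : R -> W) (g : R -> R) (t g' : R) (D : W) :
  @approx_at R R^o g t g' -> approx_at u t D ->
  approx_at (fun s => g s *: u s) t (g t *: D + g' *: u t).
Proof.
move=> gD uD h h0.
have A0 : 0 < `|g t| + 1 by rewrite ltr_wpDl.
have B0 : 0 < `|u t| + 1 by rewrite ltr_wpDl.
have C0 : 0 < (`|g'| + 1) * (`|D| + 1) by rewrite mulr_gt0// ltr_wpDl.
(* h1 and h2 pay for the errors of u and g; the product of the increments is of second order, so h3
   only limits the distance of s from t. *)
pose h1 := h / (3 * (`|g t| + 1)); pose h2 := h / (3 * (`|u t| + 1)).
pose h3 := h / (3 * ((`|g'| + 1) * (`|D| + 1))).
have h10 : 0 < h1 by rewrite divr_gt0// mulr_gt0.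
have h20 : 0 < h2 by rewrite divr_gt0// mulr_gt0.
have h30 : 0 < h3 by rewrite divr_gt0// mulr_gt0.
have [d1 d10 d1P] := uD h1 h10; have [d2 d20 d2P] := gD h2 h20.
have [d3 d30 d3P] := approx_bound gD; have [d4 d40 d4P] := approx_bound uD.
exists (Num.min (Num.min d1 d2) (Num.min (Num.min d3 d4) h3)).
  by rewrite !lt_min d10 d20 d30 d40.
move=> s; rewrite !lt_min => /andP[/andP[sd1 sd2] /andP[/andP[sd3 sd4] sh3]].
have -> : g s *: u s - g t *: u t - (s - t) *: (g t *: D + g' *: u t) =
    g t *: (u s - u t - (s - t) *: D) + (g s - g t - (s - t) *: (g' : R^o)) *: u t +
    (g s - g t) *: (u s - u t).
  have rE : (s - t) *: (g' : R^o) = (s - t) * g' by [].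
  rewrite rE; move: (s - t) => r {rE}.
  have -> : u s = u t + (u s - u t) by rewrite addrC subrK.
  have -> : g s = g t + (g s - g t) by rewrite addrC subrK.
  move: (u s - u t) (g s - g t) => w a.
  rewrite [u t + w]addrC addrK [g t + a]addrC addrK !scalerDr !scalerDl scalerN scaleNr !scalerA (mulrC (g t) r).
  rewrite (addrA (a *: w + _)) addrK [a *: w + _]addrC (addrAC _ (a *: w)).
  by rewrite (addrAC _ (a *: w)) opprD addrACA.
have st0 := normr_ge0 (s - t).
have H1 := d1P s sd1; have H2 := d2P s sd2; have H3 := d3P s sd3; have H4 := d4P s sd4.
apply: le_trans (ler_normD _ _) _.
apply: (@le_trans _ _ (h / 3 * `|s - t| + h / 3 * `|s - t| + h / 3 * `|s - t|)); last lra.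
apply: lerD; first apply: le_trans (ler_normD _ _) _; first apply: lerD.
- rewrite normrZ; apply: (@le_trans _ _ (`|g t| * (h1 * `|s - t|))); first by rewrite ler_wpM2l.
  have -> : h / 3 * `|s - t| = (`|g t| + 1) * (h1 * `|s - t|).
    by rewrite /h1; field; rewrite gt_eqF.
  by apply: ler_wpM2r; [rewrite mulr_ge0// ltW|rewrite lerDl].
- rewrite normrZ; apply: (@le_trans _ _ (h2 * `|s - t| * `|u t|)); first by rewrite ler_wpM2r.
  have -> : h / 3 * `|s - t| = h2 * `|s - t| * (`|u t| + 1).
    by rewrite /h2; field; rewrite gt_eqF.
  by apply: ler_wpM2l; [rewrite mulr_ge0// ltW|rewrite lerDl].
- rewrite normrZ.
  apply: (@le_trans _ _ ((`|g'| + 1) * `|s - t| * ((`|D| + 1) * `|s - t|))).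
    by apply: ler_pM.
  have -> : h / 3 * `|s - t| = (`|g'| + 1) * (`|D| + 1) * h3 * `|s - t|.
    rewrite /h3; have g1 : `|g'| + 1 != 0 by rewrite gt_eqF// ltr_wpDl.
    have g2 : `|D| + 1 != 0 by rewrite gt_eqF// ltr_wpDl.
    by field; rewrite g1 g2.
  rewrite mulrACA [leLHS]mulrA; apply: ler_wpM2r => //.
  by rewrite ler_pM2l// ltW.
Qed.

Lemma approx_expR (t : R) : @approx_at R R^o expR t (expR t).
Proof. by apply: is_derive_approx; exact: is_derive_expR. Qed.

Lemma approx_opp (t : R) : @approx_at R R^o -%R t (-1).
Proof.
move=> h h0; exists 1; first exact: ltr01.
move=> s _; have -> : - s - - t - (s - t) *: (-1 : R^o) = 0.
  by have -> : (s - t) *: (-1 : R^o) = (s - t) * (-1) by []; ring.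
by rewrite normr0 mulr_ge0// ltW.
Qed.

Lemma expR_lipschitz (a b s t : R) : s <= t -> t <= b ->
  `|expR t - expR s| <= expR b * (t - s).
Proof.
move=> st tb; rewrite ger0_norm ?subr_ge0 ?ler_expR//.
have -> : expR s = expR t * expR (s - t) by rewrite -expRD addrC subrK.
have := expR_ge1Dx (s - t) => h1.
have h2 : expR t <= expR b by rewrite ler_expR.
have h3 := expR_gt0 t.
have h4 : expR t * (1 + (s - t)) <= expR t * expR (s - t) by rewrite ler_pM2l.
have h5 : expR t * (t - s) <= expR b * (t - s) by rewrite ler_wpM2r// subr_ge0.
lra.
Qed.

End ApproximationRules.

Section WithinContinuity.
Context {R : realType} {W W' : normedModType R}.

Lemma within_continuous_dist2 (T : set R) (D : set W) (f : R -> W -> W') :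
  (forall t x, T t -> D x -> forall h : R, 0 < h -> exists2 r : R, 0 < r &
    forall s y, T s -> D y -> `|s - t| < r -> `|y - x| < r ->
      `|f s y - f t x| <= h) ->
  {within T `*` D, continuous (fun tx : R * W => f tx.1 tx.2)}.
Proof.
move=> fP; apply/subspace_continuousP => -[t x] [/= Tt Dx]; apply/cvgrPdist_le => h h0.
have [r r0 rP] := fP t x Tt Dx h h0.
rewrite near_withinE; apply/(@nbhs_ballP R (R * W)%type); exists r => // -[s y] [/=].
rewrite -!ball_normE /= => ts xy [Ts Dy].
by rewrite distrC; apply: rP => //; rewrite distrC.
Qed.

End WithinContinuity.

(** * Best replies *)

Section BestResponse.
Context {R : realType} {n : nat}.
Implicit Types (M : 'M[R]_n) (p q : 'cV[R]_n).

Definition best_rows M q : {set 'I_n} :=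
  [set i | [forall k, (M *m q) k 0 <= (M *m q) i 0]]%SET.
Definition best_cols M p : {set 'I_n} :=
  [set j | [forall k, (M^T *m p) j 0 <= (M^T *m p) k 0]]%SET.

Lemma best_rows_neq0 M q (n_gt0 : (0 < n)%N) : best_rows M q != finset.set0.
Proof.
apply/set0Pn; exists [arg max_(i > Ordinal n_gt0) (M *m q) i 0]%O; rewrite inE.
by apply/forallP => k; case: arg_maxP => // i _; apply.
Qed.

Lemma best_cols_neq0 M p (n_gt0 : (0 < n)%N) : best_cols M p != finset.set0.
Proof.
apply/set0Pn; exists [arg min_(j < Ordinal n_gt0) (M^T *m p) j 0]%O; rewrite inE.
by apply/forallP => k; case: arg_minP => // i _; apply.
Qed.

Lemma BRp_face M q (n_gt0 : (0 < n)%N) : BRp M q = face (best_rows M q).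
Proof.
apply/seteqP; split=> [x [sx xmax]|x [sx xI]].
- split=> // i; rewrite inE negb_forall => /existsP[k]; rewrite -ltNge => ik.
  have [x0 x1] := sx.
  (* Move the whole weight of the inferior row i to the better row k. *)
  have := xmax (x + (x i 0) *: (delta_mx k 0 - delta_mx i 0)).
  rewrite payoffDl payoffZl payoffBl !payoffE !dot_delta => h.
  have ki : k != i by apply/eqP => ki; rewrite ki ltxx in ik.
  suff /h : simplex R n (x + x i 0 *: (delta_mx k 0 - delta_mx i 0)).
    have := x0 i; rewrite le_eqVlt => /orP[/eqP <-//|xi0].
    have : 0 < x i 0 * ((M *m q) k 0 - (M *m q) i 0) by rewrite mulr_gt0// subr_gt0.
    lra.
  split.
    move=> j; rewrite !mxE.
    have [->|ji] := eqVneq j i.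
      by rewrite eq_sym (negbTE ki)/= sub0r mulrN mulr1 subrr.
    by rewrite andFb subr0 addr_ge0// mulr_ge0// ler0n.
  under eq_bigr do rewrite !mxE.
  rewrite big_split/= x1 -mulr_sumr sumrB.
  have E l : \sum_(i < n) (((i == l) && (0 == 0 :> 'I_1))%:R : R) = 1.
    by rewrite (bigD1 l)//= eqxx big1 ?addr0// => j /negbTE ->.
  by rewrite !E subrr mulr0 addr0.
- split=> // y sy; rewrite !payoffE.
  have /set0Pn[i iI] := best_rows_neq0 M q n_gt0.
  apply: (@le_trans _ _ ((M *m q) i 0)).
    apply: (face_dot_le (simplex_face sy)) => k _.
    by move: iI; rewrite inE => /forallP.
  apply: (@face_dot_ge _ _ (best_rows M q)) => // k kI.
  by move: kI; rewrite inE => /forallP.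
Qed.

Lemma BRq_BRp M p :
  BRq M p = BRp (- M^T) p.
Proof.
have E x : payoff (- M^T) x p = - payoff M p x.
  rewrite payoffE payoffEr /dot -sumrN; apply: eq_bigr => i _.
  by rewrite mulNmxE mulrN.
apply/seteqP; split=> x [sx xm]; split=> // y /xm.
  by rewrite !E lerN2.
by rewrite !E lerN2.
Qed.

Lemma BRq_face M p (n_gt0 : (0 < n)%N) : BRq M p = face (best_cols M p).
Proof.
rewrite BRq_BRp BRp_face//; congr face; apply/setP => j; rewrite !inE.
by apply: eq_forallb => k; rewrite !mulNmxE lerN2.
Qed.

End BestResponse.

(** * The zero-sum game of a regular matrix: gain, best replies and local games *)

Section ZeroSum.
Context {R : realType} {n : nat}.
Variables (M : 'M[R]_n) (e : 'cV[R]_n * 'cV[R]_n).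
Hypothesis n_gt0 : (0 < n)%N.
Hypothesis regM : regular M.
Hypothesis emix : completely_mixed M e.
Notation V := ('cV[R]_n * 'cV[R]_n)%type.
Implicit Types (x y z u v b : V) (p q : 'cV[R]_n).

Definition gain x y : R := payoff M x.1 y.2 - payoff M y.1 x.2.

Lemma gainDr x y z : gain x (y + z) = gain x y + gain x z.
Proof. by rewrite /gain /= payoffDr payoffDl; ring. Qed.

Lemma gainZr (t : R) x y : gain x (t *: y) = t * gain x y.
Proof. by rewrite /gain /= payoffZr payoffZl; ring. Qed.

Lemma gain_anti x y : gain y x = - gain x y.
Proof. by rewrite /gain; ring. Qed.

Lemma gainNr x y : gain x (- y) = - gain x y.
Proof. by rewrite -scaleN1r gainZr mulN1r. Qed.

Lemma gainBr x y z : gain x (y - z) = gain x y - gain x z.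
Proof. by rewrite gainDr gainNr. Qed.

Lemma gainBl x y z : gain (x - y) z = gain x z - gain y z.
Proof. by rewrite gain_anti gainBr (gain_anti x) (gain_anti y); ring. Qed.

Lemma gainxx x : gain x x = 0.
Proof. by rewrite /gain subrr. Qed.

(** State space after the blow-up: blown-up curves leave the simplices but not their affine
    hulls. *)
Definition affine u : Prop := \sum_i u.1 i 0 = 1 /\ \sum_i u.2 i 0 = 1.

Lemma simplex2_affine u : simplex2 R n u -> affine u.
Proof. by move=> [[_ ?] [_ ?]]. Qed.

Lemma e_simplex2 : simplex2 R n e. Proof. by have [] := emix. Qed.

Lemma e_affine : affine e. Proof. exact/simplex2_affine/e_simplex2. Qed.

(** The two constants of the equilibrium agree, both being the payoff at e. Asking only for equal
    sums covers affine points and tangent vectors at once. *)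
Lemma gain_e x : \sum_i x.1 i 0 = \sum_i x.2 i 0 -> gain x e = 0.
Proof.
move=> xx; have [[[_ e1] [_ e2]] _ _ [l le] [mu me]] := emix.
have pl q : payoff M e.1 q = l * \sum_i q i 0.
  rewrite /payoff le mxE mulr_sumr; apply: eq_bigr => i _; by rewrite mxE.
have pm p : payoff M p e.2 = mu * \sum_i p i 0.
  rewrite payoffE me mulr_sumr; apply: eq_bigr => i _; by rewrite mxE mulrC.
have lm : l = mu by have := pl e.2; rewrite pm e1 e2 !mulr1.
by rewrite /gain pl pm lm xx subrr.
Qed.

Lemma gain_e_affine x : affine x -> gain x e = 0.
Proof. by move=> [x1 x2]; rewrite gain_e// x1 x2. Qed.

Lemma affine_comb u v (t : R) : affine u -> affine v -> affine (u + t *: (v - e)).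
Proof.
move=> [u1 u2] [v1 v2]; have [e1 e2] := e_affine.
split=> /=; under eq_bigr do rewrite !mxE; rewrite big_split/= -mulr_sumr sumrB.
  by rewrite u1 v1 e1 subrr mulr0 addr0.
by rewrite u2 v2 e2 subrr mulr0 addr0.
Qed.

Definition BR u : set V := face (best_rows M u.2) `*` face (best_cols M u.1).

Lemma BR_E u : BR u = BRp M u.2 `*` BRq M u.1.
Proof. by rewrite /BR BRp_face// BRq_face//. Qed.

Lemma BR_simplex2 u b : BR u b -> simplex2 R n b.
Proof. by move=> [[? _] [? _]]. Qed.

Lemma BR_max u b b' : BR u b -> simplex2 R n b' -> gain b' u <= gain b u.
Proof.
rewrite BR_E => -[[s1 m1] [s2 m2]] [s1' s2'].
by rewrite /gain; have := m1 _ s1'; have := m2 _ s2'; lra.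
Qed.

Lemma BR_neq0 u : exists b, BR u b.
Proof.
have /set0Pn[i iI] := best_rows_neq0 M u.2 n_gt0.
have /set0Pn[j jJ] := best_cols_neq0 M u.1 n_gt0.
by exists (delta_mx i 0, delta_mx j 0); split; exact: face_delta.
Qed.

Lemma BR_argmax u b : simplex2 R n b ->
  (forall b', simplex2 R n b' -> gain b' u <= gain b u) -> BR u b.
Proof.
move=> [s1 s2] m; rewrite BR_E; split; split=> // x sx.
  by have := m (x, b.2) (conj sx s2); rewrite /gain/=; lra.
by have := m (b.1, x) (conj s1 sx); rewrite /gain/=; lra.
Qed.

Lemma sup_attained (A : set R) (m : R) : A m -> (forall r, A r -> r <= m) -> sup A = m.
Proof.
move=> Am Ale; apply/eqP; rewrite eq_le; apply/andP; split.
  by apply: ge_sup; [exists m|].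
by apply: sup_upper_bound => //; split; [exists m|exists m].
Qed.

Lemma inf_attained (A : set R) (m : R) : A m -> (forall r, A r -> m <= r) -> inf A = m.
Proof.
move=> Am Ale; apply/eqP; rewrite eq_le; apply/andP; split.
  by apply: inf_lbound => //; exists m.
by apply: lb_le_inf; [exists m|].
Qed.

Lemma Ham_BR u b : BR u b -> Ham M u = gain b u.
Proof.
rewrite BR_E => -[[s1 m1] [s2 m2]]; rewrite /Ham /gain; congr (_ - _).
  by apply: sup_attained; [exists b.1|move=> _ [x sx <-]; exact: m1].
by apply: inf_attained; [exists b.2|move=> _ [x sx <-]; exact: m2].
Qed.

Lemma Ham_ge u b : simplex2 R n b -> gain b u <= Ham M u.
Proof.
have [b' ub'] := BR_neq0 u; rewrite (Ham_BR ub'); exact: BR_max.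
Qed.

Lemma payoff_scale (s : R) p q : payoff (s *: M) p q = s * payoff M p q.
Proof. by rewrite !payoffE -scalemxAl dotZr. Qed.

(* b solves the zero-sum game s *: M restricted to the face of best replies to
   u.  The sign s = 1 governs the motion forward in time, s = -1 (with the roles
   of the players exchanged) the motion backward in time. *)
Definition local_eq (s : R) u b : Prop :=
  BR u b /\ forall b', BR u b' -> s * gain b' b <= 0.

Lemma local_eq_face (s : R) u b : local_eq s u b <-> BR u b /\
  face_eq (s *: M) (best_rows M u.2) (best_cols M u.1) b.1 b.2.
Proof.
have gE x y : s * gain x y = payoff (s *: M) x.1 y.2 - payoff (s *: M) y.1 x.2.
  by rewrite !payoff_scale /gain; ring.
split=> -[ub h]; split=> //.
  move=> i j iI jJ; have := h (delta_mx i 0, delta_mx j 0).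
  rewrite gE subr_le0 payoffE dot_delta [X in _ <= X]payoffEr dot_delta; apply.
  by split; exact: face_delta.
have [b1 b2] := ub; move=> x [x1 x2]; rewrite gE subr_le0.
apply: (@le_trans _ _ (payoff (s *: M) b.1 b.2)).
  by rewrite payoffE; apply: (face_dot_le x1) => i iI; exact: face_eq_le b1 b2 h iI.
by rewrite [leRHS]payoffEr; apply: (face_dot_ge x2) => j jJ; exact: face_eq_ge b1 b2 h jJ.
Qed.

Lemma local_eq_exists (s : R) u : exists b, local_eq s u b.
Proof.
have [b [c [bI cJ bc]]] := minimax_face (s *: M)
  (best_rows_neq0 M u.2 n_gt0) (best_cols_neq0 M u.1 n_gt0).
by exists (b, c); apply/local_eq_face.
Qed.

Lemma local_eq_unique (s : R) u b b' : s != 0 ->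
  local_eq s u b -> local_eq s u b' -> b = b'.
Proof.
move=> s0 /local_eq_face[[b1 b2] h] /local_eq_face[[b1' b2'] h'].
have [h1 h2] := face_eq_unique regM s0 b1 b2 b1' b2' h h'.
by case: b b' h1 h2 {b1 b2 h b1' b2' h'} => ? ? [? ?] /= -> ->.
Qed.

(** The default 0 is never met, since a local equilibrium exists for all s and u. *)
Definition loc (s : R) u : V := xget 0 (local_eq s u).

Lemma locP (s : R) u : local_eq s u (loc s u).
Proof. by have [b ub] := local_eq_exists s u; exact: (xgetPex 0 (ex_intro _ b ub)). Qed.

Lemma loc_eq (s : R) u b : s != 0 -> local_eq s u b -> b = loc s u.
Proof. by move=> s0 ub; exact: local_eq_unique s0 ub (locP s u). Qed.

(** Initial velocity at u of the blown-up motion, in forward time for s = 1 and in reversed time for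
    s = -1. *)
Definition velocity (s : R) u : V := s *: (loc s u - e).

Lemma norm_fst u : `|u.1| <= `|u|.
Proof. by rewrite prod_normE le_max lexx. Qed.

Lemma norm_snd u : `|u.2| <= `|u|.
Proof. by rewrite prod_normE le_max lexx orbT. Qed.

Lemma norm_pair_le u (r : R) : `|u.1| <= r -> `|u.2| <= r -> `|u| <= r.
Proof. by move=> u1 u2; rewrite prod_normE ge_max u1. Qed.

Lemma norm_simplex2 b : simplex2 R n b -> `|b| <= 1.
Proof. by move=> [s1 s2]; apply: norm_pair_le; exact: simplex_norm. Qed.

Lemma norm_sub_e b : simplex2 R n b -> `|b - e| <= 2.
Proof.
move=> sb; apply: le_trans (ler_normB _ _) _; rewrite -[2]/(1 + 1).
by apply: lerD; apply: norm_simplex2 => //; exact: e_simplex2.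
Qed.

Lemma norm_velocity (s : R) u : `|velocity s u| <= `|s| * 2.
Proof.
rewrite /velocity normrZ ler_wpM2l//; apply: norm_sub_e.
exact: BR_simplex2 (locP s u).1.
Qed.

Lemma affine_velocity (s t : R) u : affine u -> affine (u + t *: velocity s u).
Proof.
move=> au; rewrite /velocity scalerA; apply: affine_comb => //.
exact/simplex2_affine/(BR_simplex2 (locP s u).1).
Qed.

Definition mass : R := \sum_i \sum_j `|M i j|.

Lemma mass_ge0 : 0 <= mass.
Proof. by apply: sumr_ge0 => i _; apply: sumr_ge0. Qed.

Lemma norm_mulmx q i : `|(M *m q) i 0| <= mass * `|q|.
Proof.
rewrite mxE; apply: le_trans (ler_norm_sum _ _ _) _.
have row : \sum_j `|M i j| <= mass.
  rewrite /mass [leRHS](bigD1 i)//= lerDl; apply: sumr_ge0 => k _; exact: sumr_ge0.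
apply: (@le_trans _ _ ((\sum_j `|M i j|) * `|q|)); last by rewrite ler_wpM2r.
rewrite mulr_suml; apply: ler_sum => j _; rewrite normrM ler_wpM2l//.
exact: mx_norm_ge.
Qed.

Lemma norm_mulmx_tr p j : `|(M^T *m p) j 0| <= mass * `|p|.
Proof.
rewrite mxE; apply: le_trans (ler_norm_sum _ _ _) _.
have col : \sum_i `|M i j| <= mass.
  rewrite /mass exchange_big [leRHS](bigD1 j)//= lerDl; apply: sumr_ge0 => k _.
  exact: sumr_ge0.
apply: (@le_trans _ _ ((\sum_i `|M i j|) * `|p|)); last by rewrite ler_wpM2r.
rewrite mulr_suml; apply: ler_sum => i _; rewrite normrM mxE ler_wpM2l//.
exact: mx_norm_ge.
Qed.

Lemma norm_dot_simplex p q (r : R) : simplex R n p -> (forall i, `|q i 0| <= r) ->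
  `|dot p q| <= r.
Proof.
move=> sp qr; rewrite ler_norml; apply/andP; split.
  by apply: (face_dot_ge (simplex_face sp)) => i _; have := qr i; rewrite ler_norml => /andP[].
by apply: (face_dot_le (simplex_face sp)) => i _; have := qr i; rewrite ler_norml => /andP[].
Qed.

(** The summand 1 makes the constant positive, so that it can be divided by. *)
Definition gain_const : R := 2 * mass + 1.

Lemma gain_const_gt0 : 0 < gain_const.
Proof. by have := mass_ge0; rewrite /gain_const; lra. Qed.

Lemma norm_gain b u : simplex2 R n b -> `|gain b u| <= gain_const * `|u|.
Proof.
move=> [s1 s2]; rewrite /gain; apply: le_trans (ler_normB _ _) _.
have h1 : `|payoff M b.1 u.2| <= mass * `|u|.
  rewrite payoffE; apply: norm_dot_simplex => // i.
  apply: le_trans (norm_mulmx _ _) _; rewrite ler_wpM2l ?mass_ge0//; exact: norm_snd.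
have h2 : `|payoff M u.1 b.2| <= mass * `|u|.
  rewrite payoffEr; apply: norm_dot_simplex => // i.
  apply: le_trans (norm_mulmx_tr _ _) _; rewrite ler_wpM2l ?mass_ge0//; exact: norm_fst.
by have := normr_ge0 u; rewrite /gain_const; lra.
Qed.

Lemma Ham_lipschitz u v : `|Ham M u - Ham M v| <= gain_const * `|u - v|.
Proof.
suff h x y : Ham M x - Ham M y <= gain_const * `|x - y|.
  rewrite ler_norml; apply/andP; split; last exact: h.
  by have := h v u; rewrite distrC; lra.
have [b xb] := BR_neq0 x; rewrite (Ham_BR xb).
have sb := BR_simplex2 xb; apply: (@le_trans _ _ (gain b x - gain b y)).
  by rewrite lerD2l lerN2 Ham_ge.
by rewrite -gainBr; apply: le_trans (ler_norm _) (norm_gain _ sb).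
Qed.

(** Upper semicontinuity: if d bounds the positive differences of pure payoffs at x from below, a
    change of all payoffs by less than d / 2 cannot make an inferior pure strategy best. *)
Lemma BR_near x : exists2 r : R, 0 < r & forall y, `|y - x| < r -> BR y `<=` BR x.
Proof.
have strict (w : 'cV[R]_n) : exists2 d : R, 0 < d &
    forall i k, w i 0 < w k 0 -> d <= w k 0 - w i 0.
  (* Pairs without a strict inequality get the harmless value 1. *)
  have [|d d0 dP] := @finite_pos_lower_bound R ('I_n * 'I_n)%type
    (fun ik => if w ik.1 0 < w ik.2 0 then w ik.2 0 - w ik.1 0 else 1).
    by move=> [i k] /=; case: ifPn => //; rewrite subr_gt0.
  by exists d => // i k ik; have := dP (i, k); rewrite /= ik.
have [d1 d10 d1P] := strict (M *m x.2); have [d2 d20 d2P] := strict (M^T *m x.1).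
pose d := Num.min d1 d2; have d0 : 0 < d by rewrite lt_min d10.
exists (d / (2 * (mass + 1))).
  by rewrite divr_gt0// mulr_gt0// ltr_wpDl// mass_ge0.
have m1 : 0 < mass + 1 by rewrite ltr_wpDl// mass_ge0.
move=> y; rewrite ltr_pdivlMr ?mulr_gt0// => yx.
have yxm : mass * `|y - x| < d / 2.
  have := normr_ge0 (y - x); have := mass_ge0; lra.
have [dd1 dd2] : d <= d1 /\ d <= d2 by rewrite /d !ge_min !lexx orbT.
have h1 i : `|(M *m y.2) i 0 - (M *m x.2) i 0| < d / 2.
  have -> : (M *m y.2) i 0 - (M *m x.2) i 0 = (M *m (y.2 - x.2)) i 0.
    by rewrite mulmxBr !mxE.
  apply: le_lt_trans yxm; apply: le_trans (norm_mulmx _ _) _.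
  by rewrite ler_wpM2l ?mass_ge0//; exact: (norm_snd (y - x)).
have h2 i : `|(M^T *m y.1) i 0 - (M^T *m x.1) i 0| < d / 2.
  have -> : (M^T *m y.1) i 0 - (M^T *m x.1) i 0 = (M^T *m (y.1 - x.1)) i 0.
    by rewrite mulmxBr !mxE.
  apply: le_lt_trans yxm; apply: le_trans (norm_mulmx_tr _ _) _.
  by rewrite ler_wpM2l ?mass_ge0//; exact: (norm_fst (y - x)).
have rows : best_rows M y.2 \subset best_rows M x.2.
  apply/fintype.subsetP => i; rewrite !inE => /forallP iy; apply/forallP => k.
  rewrite leNgt; apply/negP => ik; have := iy k; have := d1P _ _ ik.
  have := h1 i; have := h1 k; rewrite !ltr_distlC => /andP[? ?] /andP[? ?]; lra.
have cols : best_cols M y.1 \subset best_cols M x.1.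
  apply/fintype.subsetP => i; rewrite !inE => /forallP iy; apply/forallP => k.
  rewrite leNgt; apply/negP => ik; have := iy k; have := d2P _ _ ik.
  have := h2 i; have := h2 k; rewrite !ltr_distlC => /andP[? ?] /andP[? ?]; lra.
by move=> b [b1 b2]; split; [exact: face_sub rows _ b1|exact: face_sub cols _ b2].
Qed.

Lemma gain_sub_e b x : simplex2 R n b -> gain b (x - e) = gain b x.
Proof.
by move=> sb; rewrite gainBr (gain_e_affine (simplex2_affine sb)) subr0.
Qed.

(** Best replies near x are best replies to x, and along the segment the gain of each such z changes
    by t * (s * [gain z b]) <= 0, that of b by 0. So b remains a best reply, and it solves the
    smaller local game as well. *)
Lemma velocity_near (s : R) x : s != 0 -> exists2 d : R, 0 < d &
  forall t, 0 <= t < d -> velocity s (x + t *: velocity s x) = velocity s x.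
Proof.
move=> s0; have [r r0 near] := BR_near x.
have c0 : 0 < `|s| * 2 by rewrite mulr_gt0 ?normr_gt0.
exists (r / (`|s| * 2)); first by rewrite divr_gt0.
move=> t /andP[t0 tr]; set b := loc s x; set y := x + _.
have [xb bmax] := locP s x; rewrite -/b in xb bmax.
have sb := BR_simplex2 xb.
have yx : BR y `<=` BR x.
  apply: near; rewrite /y addrC addKr normrZ ger0_norm//.
  rewrite ltr_pdivlMr// in tr; apply: le_lt_trans tr.
  by rewrite ler_wpM2l// norm_velocity.
have gy z : simplex2 R n z -> gain z y = gain z x + t * (s * gain z b).
  by move=> sz; rewrite /y gainDr gainZr /velocity gainZr -/b gain_sub_e.
suff yb : local_eq s y b by rewrite /velocity -(loc_eq s0 yb).
split; last by move=> z /yx; exact: bmax.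
apply: BR_argmax => // z sz; have [w yw] := BR_neq0 y.
apply: le_trans (BR_max yw sz) _; have xw := yx _ yw.
rewrite (gy _ (BR_simplex2 xw)) (gy _ sb) gainxx !mulr0 addr0.
have : t * (s * gain w b) <= 0 by rewrite mulr_ge0_le0// bmax.
by have := BR_max xb (BR_simplex2 xw); lra.
Qed.

(** Since [gain b e = 0], each [gain b] is homogeneous about e. *)
Lemma BR_scale (r : R) u : 0 < r -> BR (e + r *: (u - e)) = BR u.
Proof.
move=> r0; have g b : simplex2 R n b -> gain b (e + r *: (u - e)) = r * gain b u.
  move=> sb; rewrite gainDr (gain_e_affine (simplex2_affine sb)) add0r gainZr.
  by rewrite gain_sub_e.
apply/seteqP; split=> b ub; have sb := BR_simplex2 ub; apply: BR_argmax => // b' sb'.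
  by have := BR_max ub sb'; rewrite !g// ler_pM2l.
by rewrite !g// ler_pM2l//; exact: BR_max.
Qed.

Lemma Ham_scale (r : R) u : 0 < r -> Ham M (e + r *: (u - e)) = r * Ham M u.
Proof.
move=> r0; have [b ub] := BR_neq0 u; rewrite (Ham_BR ub) (@Ham_BR _ b) ?BR_scale//.
have sb := BR_simplex2 ub.
by rewrite gainDr (gain_e_affine (simplex2_affine sb)) add0r gainZr gain_sub_e.
Qed.

(** Compactness: on the best replies at distance at least h from the local equilibrium, the largest
    profit of a deviation has a minimum g, positive by uniqueness; half of it serves as d. *)
Lemma loc_approx (s : R) x (h : R) : s != 0 -> 0 < h -> exists2 d : R, 0 < d &
  forall b, BR x b -> (forall b', BR x b' -> s * gain b' b <= d) -> `|b - loc s x| < h.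
Proof.
move=> s0 h0; set b0 := loc s x.
pose A : set V := BR x `&` [set b | h <= `|b - b0|].
have cA : compact A.
  apply: compact_closedI; first by apply: compact_setX; exact: face_compact.
  apply: (@closed_comp _ _ (fun b : V => `|b - b0|) [set r : R | h <= r]); last exact: closed_ge.
  by move=> b _; apply: cvg_norm; apply: cvgB; [exact: cvg_id|exact: cvg_cst].
have [A0|A0] := pselect (A !=set0); last first.
  exists 1 => // b xb _; rewrite ltNge; apply/negP => hb; apply: A0; exists b.
  by split.
have /set0Pn[i iI] := best_rows_neq0 M x.2 n_gt0.
have /set0Pn[j jJ] := best_cols_neq0 M x.1 n_gt0.
have ijS : (i, j) \in finset.setX (best_rows M x.2) (best_cols M x.1).
  by rewrite finset.in_setX iI.
have [z [g [[xz hz] gle gmin]]] :=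
  minimax_attained ijS (@subgame_gap_continuous _ _ (s *: M)) cA A0.
have g0 : 0 < g.
  rewrite ltNge; apply/negP => g0; move: hz; rewrite /= => /le_gtF.
  suff -> : z = b0 by rewrite subrr normr0 h0.
  apply: loc_eq => //; apply/local_eq_face; split=> // k l kI lJ.
  rewrite -subr_le0; apply: le_trans g0; apply: (gle (k, l)).
  by rewrite finset.in_setX kI.
exists (g / 2); first by rewrite divr_gt0.
move=> b xb bd; rewrite ltNge; apply/negP => hb.
have [[k l]] := gmin b (conj xb hb); rewrite finset.in_setX => /andP[kI lJ].
have := bd (delta_mx k 0, delta_mx l 0) (conj (face_delta kI) (face_delta lJ)).
have -> : s * gain (delta_mx k 0, delta_mx l 0) b = subgame_gap (s *: M) (k, l) b.
  rewrite /gain mulrBr -!payoff_scale payoffE dot_delta [X in _ - X]payoffEr.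
  by rewrite dot_delta.
by lra.
Qed.

(** * Solutions of the blown-up inclusion *)

(* th is an internal clock: id for the Hamiltonian inclusion, and expR for a
   best response solution c after the blow-up e + expR t *: (c t - e). *)
Definition ae_sol (th : R -> R) (a b : R) (u : R -> V) : Prop :=
  [/\ abs_continuous_on a b u,
      forall t, a <= t <= b -> affine (u t),
      exists2 C, 0 <= C & forall s t, a <= s -> s <= t -> t <= b -> `|th t - th s| <= C * (t - s),
      forall s t, a <= s -> s < t -> t <= b -> th s < th t
    & exists2 E, lebesgue_measure.-negligible E &
      forall t, a <= t <= b -> ~ E t -> exists c D, [/\ BR (u t) c, 0 <= D,
        @approx_at R R^o th t D & approx_at u t (D *: (c - e))]].

Lemma ae_sol_sub (th : R -> R) (a b a' b' : R) (u : R -> V) : a <= a' -> b' <= b ->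
  ae_sol th a b u -> ae_sol th a' b' u.
Proof.
move=> aa bb [acu au [C C0 thC] thm [E E0 EP]]; split.
- move=> h h0; have [d d0 dP] := acu h h0; exists d => // N s t st; apply: dP => k kN.
  by have [h1 [h2 h3]] := st k kN; lra.
- by move=> t /andP[h1 h2]; apply: au; lra.
- by exists C => // s t h1 h2 h3; apply: thC; lra.
- by move=> s t h1 h2 h3; apply: thm; lra.
- by exists E => // t /andP[h1 h2]; apply: EP; lra.
Qed.

(** Almost everywhere the derivative is [D * (l (c - e) + k)], which is nonnegative. This integrates
    a linear inequality on the replies; the equation for l encodes its linearity. *)
Lemma ae_sol_mono (th : R -> R) (a b : R) (u : R -> V) (l : V -> R) (C k : R) : a <= b -> ae_sol th a b u ->
  (forall x y (r : R), l (x + r *: y) = l x + r * l y) -> 0 <= C ->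
  (forall x, `|l x| <= C * `|x|) ->
  (forall t c, a <= t <= b -> BR (u t) c -> 0 <= l (c - e) + k) ->
  l (u a) + k * th a <= l (u b) + k * th b.
Proof.
move=> ab [acu au [Ct Ct0 thC] thm [E E0 EP]] ladd C0 lC lge.
have lB x y : l (x - y) = l x - l y by rewrite -scaleN1r ladd mulN1r.
have l0 : l 0 = 0 by have := lB 0 0; rewrite !subrr.
have lZ r x : l (r *: x) = r * l x by have := ladd 0 x r; rewrite add0r l0 add0r.
apply: (@ac_nondecreasing _ (fun t => l (u t) + k * th t) a b E ab) => //.
  apply: (@ac_dominated _ _ _ u _ a b (C + `|k| * Ct) acu).
    by rewrite addr_ge0// mulr_ge0.
  move=> s t a_s st tb.
  have -> : l (u t) + k * th t - (l (u s) + k * th s) = l (u t - u s) + k * (th t - th s).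
    by rewrite lB; ring.
  apply: le_trans (ler_normD _ _) _; rewrite normrM.
  have h1 := lC (u t - u s).
  have h2 : `|k| * `|th t - th s| <= `|k| * (Ct * (t - s)) by rewrite ler_wpM2l// thC.
  have h3 : 0 <= C * (t - s) by rewrite mulr_ge0// subr_ge0.
  have h4 : 0 <= `|k| * Ct * `|u t - u s| by rewrite mulr_ge0// mulr_ge0.
  lra.
move=> t /andP[a_t tb] nE h h0.
have tab : a <= t <= b by rewrite a_t ltW.
have [c [D [utc D0 thD uD]]] := EP t tab nE.
pose h' := h / (C + `|k| + 1).
have S0 : 0 < C + `|k| + 1 by rewrite ltr_wpDl// addr_ge0.
have h'0 : 0 < h' by rewrite divr_gt0.
have [d1 d10 d1P] := thD h' h'0; have [d2 d20 d2P] := uD h' h'0.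
exists (Num.min d1 d2); first by rewrite lt_min d10.
move=> s /andP[ts std] sb.
have sE : `|s - t| = s - t by rewrite gtr0_norm// subr_gt0.
have [sd1 sd2] : `|s - t| < d1 /\ `|s - t| < d2.
  have : s - t < Num.min d1 d2 by lra.
  by rewrite sE lt_min => /andP[].
have := d1P s sd1; have := d2P s sd2; rewrite sE.
set ru := u s - _ - _; set rt := th s - _ - _ => hru hrt.
have -> : l (u s) + k * th s - (l (u t) + k * th t) =
    (s - t) * (D * (l (c - e) + k)) + (l ru + k * rt).
  have -> : rt = th s - th t - (s - t) * D by [].
  rewrite /ru !lB lZ lZ lB; ring.
have h1 : 0 <= (s - t) * (D * (l (c - e) + k)).
  apply: mulr_ge0; first by rewrite subr_ge0 ltW.
  by apply: mulr_ge0 => //; exact: lge utc.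
have h2 : - (C * (h' * (s - t))) <= l ru.
  have := lC ru; rewrite ler_norml => /andP[+ _].
  by apply: le_trans; rewrite lerN2 ler_wpM2l.
have h3 : - (`|k| * (h' * (s - t))) <= k * rt.
  have : `|k * rt| <= `|k| * (h' * (s - t)) by rewrite normrM ler_wpM2l.
  by rewrite ler_norml => /andP[].
have hE : h = h' * (C + `|k| + 1) by rewrite /h' divfK// gt_eqF.
have : 0 <= h' * (s - t) by rewrite mulr_ge0 ?ltW// subr_gt0.
rewrite hE; lra.
Qed.

(** For the reply c used at t, [Ham M] lies above [gain c] and meets it at u t, while [gain c] has
    slope [gain c c - gain c e = 0] along c - e. This lower bound holds on both sides of t: on the
    right it forbids decrease, on the left increase. *)
Lemma Ham_ae_sol (th : R -> R) (a b : R) (u : R -> V) : a <= b -> ae_sol th a b u -> Ham M (u a) = Ham M (u b).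
Proof.
move=> ab [acu au [Ct Ct0 thC] thm [E E0 EP]].
have acH : ac_on a b (fun t => Ham M (u t)).
  apply: (@ac_dominated _ _ _ u _ a b gain_const acu); first exact/ltW/gain_const_gt0.
  move=> s t a_s st tb; apply: le_trans (Ham_lipschitz _ _) _.
  by rewrite ler_wpM2l ?(ltW gain_const_gt0)// lerDl subr_ge0.
have dini t : a <= t <= b -> ~ E t -> forall h : R, 0 < h -> exists2 d : R, 0 < d &
    forall s, `|s - t| < d -> - (h * `|s - t|) <= Ham M (u s) - Ham M (u t).
  move=> tab nE h h0; have [c [D [utc D0 _ uD]]] := EP t tab nE.
  have [d d0 dP] := uD (h / gain_const) (divr_gt0 h0 gain_const_gt0).
  exists d => // s sd; have sc := BR_simplex2 utc.
  rewrite (Ham_BR utc).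
  apply: (@le_trans _ _ (gain c (u s - u t))); last by rewrite gainBr lerD2r Ham_ge.
  have -> : u s - u t = (u s - u t - (s - t) *: (D *: (c - e))) + (s - t) *: (D *: (c - e)).
    by rewrite subrK.
  rewrite gainDr !gainZr gain_sub_e// gainxx !mulr0 addr0.
  have := norm_gain (u s - u t - (s - t) *: (D *: (c - e))) sc.
  rewrite ler_norml => /andP[+ _]; apply: le_trans; rewrite lerN2.
  rewrite mulrC -ler_pdivlMr ?gain_const_gt0// mulrAC; exact: dP.
apply/eqP; rewrite eq_le; apply/andP; split.
  apply: (ac_nondecreasing ab acH E0) => t /andP[a_t tb] nE h h0.
  have [|d d0 dP] := dini t _ nE h h0; first by rewrite a_t ltW.
  exists d => // s /andP[ts std] sb; have := dP s.
  by rewrite gtr0_norm ?subr_gt0//; apply; lra.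
apply: (ac_nonincreasing ab acH E0) => t /andP[a_t tb] nE h h0.
have [|d d0 dP] := dini t _ nE h h0; first by rewrite tb ltW.
exists d => // s /andP[tds st] a_s; have := dP s.
by rewrite ltr0_norm ?subr_lt0// opprB; apply; lra.
Qed.

(** The mean c is defined by the displacement. Sign conditions on the coordinates of all replies
    pass to c by [ae_sol_mono], where the coordinate of e times the clock turns the increment of u
    into that of c. *)
Lemma ae_sol_average (th : R -> R) (a b : R) (u : R -> V) I J : a < b -> ae_sol th a b u ->
  (forall t, a <= t <= b -> BR (u t) `<=` face I `*` face J) ->
  exists2 c, (face I `*` face J) c & u b = u a + (th b - th a) *: (c - e).
Proof.
move=> ab su IJ; have [acu au _ thm _] := su.
have T0 : 0 < th b - th a by rewrite subr_gt0; exact: thm.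
have TN : th b - th a != 0 by rewrite gt_eqF.
pose c := e + (th b - th a)^-1 *: (u b - u a).
have cE : u b = u a + (th b - th a) *: (c - e).
  by rewrite /c (addrC e) addrK scalerA mulfV// scale1r [RHS]addrC subrK.
have le_ab := ltW ab.
have aa : affine (u a) by apply: au; rewrite lexx.
have ab' : affine (u b) by apply: au; rewrite lexx andbT.
have ea := e_affine.
have [c1s c2s] : affine c.
  case: aa ab' ea => a1 a2 [b1 b2] [e1 e2]; split; rewrite /c /=.
    under eq_bigr do rewrite !mxE.
    by rewrite big_split/= -mulr_sumr sumrB e1 b1 a1 subrr mulr0 addr0.
  under eq_bigr do rewrite !mxE.
  by rewrite big_split/= -mulr_sumr sumrB e2 b2 a2 subrr mulr0 addr0.
have c1E i : c.1 i 0 = e.1 i 0 + (th b - th a)^-1 * ((u b).1 i 0 - (u a).1 i 0).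
  by rewrite /c /= !mxE.
have c2E i : c.2 i 0 = e.2 i 0 + (th b - th a)^-1 * ((u b).2 i 0 - (u a).2 i 0).
  by rewrite /c /= !mxE.
have nb1 i x : `|x.1 i 0| <= 1 * `|x|.
  by rewrite mul1r; exact: le_trans (mx_norm_ge _ _ _) (norm_fst _).
have nb2 i x : `|x.2 i 0| <= 1 * `|x|.
  by rewrite mul1r; exact: le_trans (mx_norm_ge _ _ _) (norm_snd _).
have ge1 i : 0 <= c.1 i 0.
  have h : (u a).1 i 0 + e.1 i 0 * th a <= (u b).1 i 0 + e.1 i 0 * th b.
    apply: (@ae_sol_mono th a b u (fun x => x.1 i 0) 1 (e.1 i 0) le_ab su _ ler01 (nb1 i)).
      by move=> x y r; rewrite /= !mxE.
    by move=> t d tab /BR_simplex2[[d0 _] _]; rewrite /= !mxE subrK.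
  have : 0 <= (th b - th a) * c.1 i 0 by rewrite c1E mulrDr mulVKf//; lra.
  by rewrite pmulr_rge0.
have ge2 i : 0 <= c.2 i 0.
  have h : (u a).2 i 0 + e.2 i 0 * th a <= (u b).2 i 0 + e.2 i 0 * th b.
    apply: (@ae_sol_mono th a b u (fun x => x.2 i 0) 1 (e.2 i 0) le_ab su _ ler01 (nb2 i)).
      by move=> x y r; rewrite /= !mxE.
    by move=> t d tab /BR_simplex2[_ [d0 _]]; rewrite /= !mxE subrK.
  have : 0 <= (th b - th a) * c.2 i 0 by rewrite c2E mulrDr mulVKf//; lra.
  by rewrite pmulr_rge0.
have le1 i : i \notin I -> c.1 i 0 = 0.
  move=> iI; apply/eqP; rewrite eq_le ge1 andbT.
  have h : - (u a).1 i 0 + - e.1 i 0 * th a <= - (u b).1 i 0 + - e.1 i 0 * th b.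
    apply: (@ae_sol_mono th a b u (fun x => - x.1 i 0) 1 (- e.1 i 0) le_ab su _ ler01).
    - by move=> x y r; rewrite /= !mxE; ring.
    - by move=> x; rewrite normrN; exact: nb1.
    - by move=> t d tab /(IJ _ tab)[[_ dI] _]; rewrite /= !mxE dI//; lra.
  have : (th b - th a) * c.1 i 0 <= 0 by rewrite c1E mulrDr mulVKf//; lra.
  by rewrite pmulr_rle0.
have le2 i : i \notin J -> c.2 i 0 = 0.
  move=> iI; apply/eqP; rewrite eq_le ge2 andbT.
  have h : - (u a).2 i 0 + - e.2 i 0 * th a <= - (u b).2 i 0 + - e.2 i 0 * th b.
    apply: (@ae_sol_mono th a b u (fun x => - x.2 i 0) 1 (- e.2 i 0) le_ab su _ ler01).
    - by move=> x y r; rewrite /= !mxE; ring.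
    - by move=> x; rewrite normrN; exact: nb2.
    - by move=> t d tab /(IJ _ tab)[_ [_ dI]]; rewrite /= !mxE dI//; lra.
  have : (th b - th a) * c.2 i 0 <= 0 by rewrite c2E mulrDr mulVKf//; lra.
  by rewrite pmulr_rle0.
by exists c.
Qed.

Lemma BR_average th (a b : R) (u : R -> V) x : a < b -> ae_sol th a b u ->
  (forall t, a <= t <= b -> BR (u t) `<=` BR x) ->
  exists2 c, BR x c & u b = u a + (th b - th a) *: (c - e).
Proof. exact: ae_sol_average. Qed.

(* The mean c of the best replies used on [t, s] is itself a best reply to u t,
   and conservation of Ham M makes it a local equilibrium, hence the only one. *)
Lemma ae_sol_forward th (a b t : R) (u : R -> V) : ae_sol th a b u -> a <= t < b ->
  exists2 d : R, 0 < d & forall s, t < s < t + d -> s <= b ->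
    u s = u t + (th s - th t) *: velocity 1 (u t).
Proof.
move=> su /andP[a_t tb]; have [r r0 near] := BR_near (u t).
have [acu _ _ thm _] := su; have [d d0 dP] := ac_modulus acu r0.
exists d => // s /andP[ts std] sb.
have sts : ae_sol th t s u by apply: ae_sol_sub su.
have ats (w : R) : t <= w <= s -> BR (u w) `<=` BR (u t).
  by move=> /andP[tq qs]; apply: near; apply: dP; lra.
have [c tc us] := BR_average ts sts ats.
have Th : 0 < th s - th t by rewrite subr_gt0; apply: thm.
suff cE : local_eq 1 (u t) c by rewrite us /velocity scale1r -(loc_eq (oner_neq0 _) cE).
split=> // c' tc'; rewrite mul1r.
have sc' := BR_simplex2 tc'.
have := Ham_ge (u s) sc'; rewrite -(Ham_ae_sol (ltW ts) sts) (Ham_BR tc') us.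
by rewrite gainDr gainZr gain_sub_e// gerDl pmulr_rle0.
Qed.

(** Going back, conservation of [Ham M] yields 0 <= [gain c' c], which is the local game of sign
    -1. *)
Lemma ae_sol_backward th (a b t : R) (u : R -> V) : ae_sol th a b u -> a < t <= b ->
  exists2 d : R, 0 < d & forall s, t - d < s < t -> a <= s ->
    u s = u t + (th t - th s) *: velocity (-1) (u t).
Proof.
move=> su /andP[a_t tb]; have [r r0 near] := BR_near (u t).
have [acu _ _ thm _] := su; have [d d0 dP] := ac_modulus acu r0.
exists d => // s /andP[tds st] a_s.
have sts : ae_sol th s t u by apply: ae_sol_sub su.
have ats (w : R) : s <= w <= t -> BR (u w) `<=` BR (u t).
  by move=> /andP[sq qt]; apply: near; rewrite distrC; apply: dP; lra.
have [c tc ut] := BR_average st sts ats.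
have Th : 0 < th t - th s by rewrite subr_gt0; apply: thm.
have us : u s = u t + (th t - th s) *: (- (c - e)).
  by rewrite scalerN ut addrK.
have N1 : (-1 : R) != 0 by rewrite oppr_eq0 oner_neq0.
suff cE : local_eq (-1) (u t) c by rewrite us /velocity scaleN1r -(loc_eq N1 cE).
split=> // c' tc'; rewrite mulN1r oppr_le0.
have sc' := BR_simplex2 tc'.
have := Ham_ge (u s) sc'; rewrite (Ham_ae_sol (ltW st) sts) (Ham_BR tc') us.
by rewrite gainDr gainZr gainNr gain_sub_e// gerDl pmulr_rle0// oppr_le0.
Qed.

Definition speed (s : R) : R := `|s| * 2.

(** More rigid than the inclusion: a straight segment of prescribed direction starts at every time,
    not only at almost every one. This is what real induction can use. *)
Definition flowline (s T : R) (u : R -> V) : Prop :=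
  [/\ forall t, 0 <= t <= T -> affine (u t),
      forall t r, 0 <= t -> t <= r -> r <= T -> `|u r - u t| <= speed s * (r - t)
    & forall t, 0 <= t < T -> exists2 d : R, 0 < d & forall r, t < r < t + d -> r <= T ->
        u r = u t + (r - t) *: velocity s (u t)].

Lemma flowline_sub (s T T' : R) (u : R -> V) : T' <= T -> flowline s T u -> flowline s T' u.
Proof.
move=> TT [au lu su]; split.
- by move=> t /andP[t0 tT]; apply: au; lra.
- by move=> t r t0 tr rT; apply: lu => //; lra.
- move=> t /andP[t0 tT]; have [|d d0 dP] := su t; first by lra.
  by exists d; [exact: d0|move=> r trd rT; apply: dP; lra].
Qed.

Lemma flowline_ext (s T : R) (u v : R -> V) : (forall t, 0 <= t <= T -> u t = v t) ->
  flowline s T u -> flowline s T v.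
Proof.
move=> uv [au lu su]; split.
- by move=> t tT; rewrite -uv//; apply: au.
- by move=> t r t0 tr rT; rewrite -!uv; [exact: lu|lra|lra].
- move=> t /andP[t0 tT]; have [|d d0 dP] := su t; first by lra.
  exists d; first exact: d0.
  move=> r /andP[tr rtd] rT.
  have ur := uv r ltac:(lra); have ut := uv t ltac:(lra).
  by rewrite -ur -ut; apply: dP; [apply/andP; split|].
Qed.

(** From a common point both curves follow the same segment to the right, and the speed bound makes
    them agree at limits from the left. *)
Lemma flowline_unique (s T : R) (u v : R -> V) : flowline s T u -> flowline s T v ->
  u 0 = v 0 -> forall t, 0 <= t <= T -> u t = v t.
Proof.
move=> [_ lu su] [_ lv sv] uv0; apply: real_induction => // t tT.
- move=> uvt; have [[d d0 dP] [d' d'0 d'P]] := (su t tT, sv t tT).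
  exists (Num.min d d'); first by rewrite lt_min d0.
  move=> r /andP[tr rtd] rT.
  have [rd rd'] : r < t + d /\ r < t + d'.
    by move: rtd; rewrite -ltrBlDl lt_min => /andP[]; lra.
  have h1 : t < r < t + d by apply/andP.
  have h2 : t < r < t + d' by apply/andP.
  by rewrite (dP _ h1 rT) (d'P _ h2 rT) uvt.
- move=> uvt; apply/eqP; rewrite -subr_eq0 -normr_le0; apply/ler_addgt0Pr => h h0.
  rewrite add0r; case/andP: tT => t0 tT.
  have S0 : 0 <= speed s by rewrite mulr_ge0.
  pose k := h / (2 * speed s + 1).
  have S1 : 0 < 2 * speed s + 1 by lra.
  have k0 : 0 < k by rewrite divr_gt0.
  pose r := Num.max 0 (t - k).
  have rt : r < t by rewrite gt_max t0 gtrBl.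
  have r0 : 0 <= r by rewrite le_max lexx.
  have rk : t - r <= k by have : t - k <= r; [rewrite le_max lexx orbT|lra].
  have -> : u t - v t = (u t - u r) - (v t - v r) by rewrite (uvt r) ?r0// opprB addrA subrK.
  apply: le_trans (ler_normB _ _) _.
  have h1 := lu r t r0 (ltW rt) tT; have h2 := lv r t r0 (ltW rt) tT.
  have h3 : speed s * (t - r) <= speed s * k by rewrite ler_wpM2l.
  have hE : h = k * (2 * speed s + 1) by rewrite /k divfK// gt_eqF.
  by rewrite hE; lra.
Qed.

Lemma flowline_const (s : R) x : affine x -> flowline s 0 (fun=> x).
Proof.
move=> ax; split=> // [t r t0 tr r0|t /andP[t0 t0']].
  by rewrite subrr normr0 mulr_ge0 ?mulr_ge0// subr_ge0.
by have := le_lt_trans t0 t0'; rewrite ltxx.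
Qed.

(* Accumulation of corners is harmless: flowlines have bounded speed, so that
   they extend to their limit times and from there by a straight segment. *)
Lemma flowline_extend (s T : R) (u : R -> V) : s != 0 -> 0 <= T -> flowline s T u ->
  exists2 d : R, 0 < d & forall T', T <= T' < T + d ->
    exists2 v, flowline s T' v & v 0 = u 0.
Proof.
move=> s0 T0 [au lu su]; have [d d0 vd] := velocity_near (u T) s0.
exists d => // T' /andP[TT' T'd]; set w := velocity s (u T) in vd.
pose v r := if r <= T then u r else u T + (r - T) *: w.
have vT r : T <= r -> v r = u T + (r - T) *: w.
  rewrite /v le_eqVlt => /orP[/eqP <-|Tr]; first by rewrite lexx subrr scale0r addr0.
  by rewrite leNgt Tr.
have vu r : r <= T -> v r = u r by rewrite /v => ->.
have aT : affine (u T) by apply: au; rewrite T0 lexx.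
have lw t r : T <= t -> t <= r -> `|v r - v t| <= speed s * (r - t).
  move=> Tt tr; rewrite !vT//; last exact: le_trans tr.
  rewrite opprD addrACA subrr add0r -scalerBl opprB addrA subrK normrZ.
  rewrite ger0_norm ?subr_ge0// mulrC ler_wpM2r ?subr_ge0//; exact: norm_velocity.
exists v; last by rewrite vu.
split.
- move=> t /andP[t0 tT']; have [tT|Tt] := leP t T; first by rewrite vu//; apply: au; rewrite t0.
  by rewrite vT ?(ltW Tt)//; apply: affine_velocity.
- move=> t r t0 tr rT'; have [rT|Tr] := leP r T.
    by rewrite !vu//; [exact: lu|exact: le_trans rT].
  have [tT|Tt] := leP t T; last by apply: lw => //; exact: ltW.
  have -> : v r - v t = (v r - v T) + (v T - v t) by rewrite addrA subrK.
  apply: le_trans (ler_normD _ _) _.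
  have h1 := lw T r (lexx _) (ltW Tr); have := lu t T t0 tT (lexx _).
  by rewrite -!vu// => h2; lra.
- move=> t /andP[t0 tT']; have [Tt|tT] := leP T t.
    exists 1; first exact: ltr01.
    move=> r /andP[tr _] rT'.
    have Tr := le_trans Tt (ltW tr).
    have td : 0 <= t - T < d by apply/andP; split; lra.
    rewrite (vT _ Tr) (vT _ Tt) (vd _ td) -addrA -scalerDl.
    by congr (_ + _ *: _); lra.
  have [|d' d'0 d'P] := su t; first by rewrite t0.
  exists (Num.min d' (T - t)); first by rewrite lt_min d'0 subr_gt0.
  move=> r /andP[tr]; rewrite -ltrBlDl lt_min => /andP[rd rT] _.
  have rT2 : r <= T by lra.
  by rewrite (vu _ rT2) (vu _ (ltW tT)); apply: d'P; [lra|].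
Qed.

(** By uniqueness the flowlines chosen for different end times are coherent, so the diagonal [U r r]
    extends all of them. *)
Lemma flowline_glue (s : R) x (D : R -> Prop) :
  (forall t r, t <= r -> D r -> D t) ->
  (forall T, 0 <= T -> D T -> exists2 u, flowline s T u & u 0 = x) ->
  exists u : R -> V, forall T, 0 <= T -> D T -> flowline s T u /\ u 0 = x.
Proof.
move=> Dd ex.
have /choice[U UP] T : exists u : R -> V, 0 <= T -> D T -> flowline s T u /\ u 0 = x.
  have [[T0 DT]|nT] := pselect (0 <= T /\ D T).
    by have [u ux fu] := ex T T0 DT; exists u.
  by exists (fun=> x) => T0 DT; exfalso; apply: nT.
exists (fun r => U r r) => T T0 DT; split.
  have [fT xT] := UP T T0 DT.
  apply: flowline_ext fT => t /andP[t0 tT].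
  have [ft xt] := UP t t0 (Dd _ _ tT DT).
  have fT' := flowline_sub tT (UP T T0 DT).1.
  by apply: (flowline_unique fT' ft); rewrite ?xT ?xt// t0 lexx.
by have [] := UP 0 (lexx _) (Dd _ _ T0 DT).
Qed.

(** The speed bound gives a limit at T in each component; its coordinate sums are still 1, being
    limits of constant sums. *)
Lemma flowline_limit (s T : R) x (u : R -> V) : 0 < T -> s != 0 ->
  (forall T', 0 <= T' -> T' < T -> flowline s T' u /\ u 0 = x) ->
  exists2 v, flowline s T v & v 0 = x.
Proof.
move=> T0 s0 fu; have S0 : 0 < speed s by rewrite mulr_gt0 ?normr_gt0.
have lu t r : 0 <= t -> t <= r -> r < T -> `|u r - u t| <= speed s * (r - t).
  by move=> t0 tr rT; have [[_ + _] _] := fu r (le_trans t0 tr) rT; apply.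
have [l1 l1P] := @mx_lipschitz_left_limit R _ _ (fun r => (u r).1) 0 T _ T0 S0
  (fun t r t0 tr rT => le_trans (norm_fst (u r - u t)) (lu t r t0 tr rT)).
have [l2 l2P] := @mx_lipschitz_left_limit R _ _ (fun r => (u r).2) 0 T _ T0 S0
  (fun t r t0 tr rT => le_trans (norm_snd (u r - u t)) (lu t r t0 tr rT)).
pose l : V := (l1, l2).
have lP (t h : R) : 0 <= t -> t < T -> 0 < h -> exists r, [/\ t <= r, r < T & `|l - u r| <= h].
  move=> t0 tT h0; have [[d1 d10 d1P] [d2 d20 d2P]] := (l1P h h0, l2P h h0).
  pose d := Num.min d1 d2; have d0 : 0 < d by rewrite lt_min d10.
  pose r := Num.max t (T - d / 2).
  have rT : r < T by rewrite gt_max tT gtrBl divr_gt0.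
  have tr : t <= r by rewrite le_max lexx.
  have rd : T - d < r.
    have : T - d / 2 <= r by rewrite le_max lexx orbT.
    lra.
  have [dd1 dd2] : d <= d1 /\ d <= d2 by rewrite /d !ge_min !lexx orbT.
  exists r; split=> //; apply: norm_pair_le; [apply: d1P|apply: d2P];
    by [exact: le_trans tr|lra].
pose v r := if r < T then u r else l.
have vu r : r < T -> v r = u r by rewrite /v => ->.
have vT : v T = l by rewrite /v ltxx.
have lv t : 0 <= t -> t < T -> `|l - u t| <= speed s * (T - t).
  move=> t0 tT; apply/ler_addgt0Pr => h h0; have [r [tr rT lr]] := lP t h t0 tT h0.
  have -> : l - u t = (u r - u t) + (l - u r) by rewrite [RHS]addrC addrA subrK.
  apply: le_trans (ler_normD _ _) _; apply: lerD => //.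
  apply: le_trans (lu _ _ t0 tr rT) _; rewrite ler_pM2l//; lra.
have al : affine l.
  have sums (p q : 'cV[R]_n) : `|\sum_i p i 0 - \sum_i q i 0| <= n%:R * `|p - q|.
    rewrite -sumrB; apply: le_trans (ler_norm_sum _ _ _) _.
    apply: (@le_trans _ _ (\sum_(i < n) `|p - q|)).
      by apply: ler_sum => i _; have := mx_norm_ge (p - q) i 0; rewrite !mxE.
    by rewrite sumr_const card_ord mulr_natl.
  have eq1 (c : R) : (forall h, 0 < h -> `|c - 1| <= n%:R * h) -> c = 1.
    move=> ch; apply/eqP; rewrite -subr_eq0 -normr_le0; apply/ler_addgt0Pr => h h0.
    rewrite add0r; have := ch (h / n%:R).
    by rewrite divr_gt0 ?ltr0n// mulrCA divff ?mulr1 ?pnatr_eq0 -?lt0n//; apply.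
  split; apply: eq1 => h h0; have [r [r0 rT lr]] := lP 0 h (lexx _) T0 h0;
    have [[ar _ _] _] := fu r r0 rT; have [ar1 ar2] : affine (u r) by apply: ar; lra.
  - have := sums l.1 (u r).1; rewrite ar1 => hs; apply: le_trans hs _.
    rewrite ler_wpM2l//; exact: le_trans (norm_fst (l - u r)) lr.
  - have := sums l.2 (u r).2; rewrite ar2 => hs; apply: le_trans hs _.
    rewrite ler_wpM2l//; exact: le_trans (norm_snd (l - u r)) lr.
exists v; last by rewrite vu//; have [] := fu 0 (lexx _) T0.
split.
- move=> t /andP[t0]; rewrite le_eqVlt => /orP[/eqP ->|tT]; first by rewrite vT.
  by rewrite vu//; have [[+ _ _] _] := fu t t0 tT; apply; rewrite t0 lexx.
- move=> t r t0 tr; rewrite le_eqVlt => /orP[/eqP rE|rT]; last first.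
    by rewrite !vu//; [exact: lu|exact: le_lt_trans rT].
  move: tr; rewrite rE le_eqVlt => /orP[/eqP ->|tT].
    by rewrite !subrr normr0 mulr0.
  by rewrite vT vu// lv.
- move=> t /andP[t0 tT]; pose T' := (t + T) / 2.
  have tT' : t < T' by rewrite /T'; lra.
  have T'T : T' < T by rewrite /T'; lra.
  have [[_ _ +] _] := fu T' (le_trans t0 (ltW tT')) T'T.
  move=> /(_ t)[|d d0 dP]; first by rewrite t0.
  exists (Num.min d (T' - t)); first by rewrite lt_min d0 subr_gt0.
  move=> r /andP[tr]; rewrite -ltrBlDl lt_min => /andP[rd rT'] _.
  have rT2 : r < T by lra.
  by rewrite (vu _ rT2) (vu _ tT); apply: dP; lra.
Qed.

Lemma flowline_exists (s T : R) x : s != 0 -> affine x -> 0 <= T ->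
  exists2 u, flowline s T u & u 0 = x.
Proof.
move=> s0 ax T0.
apply: (@real_induction _ 0 T (fun T => exists2 u, flowline s T u & u 0 = x));
  last by rewrite T0 lexx.
- by exists (fun=> x) => //; exact: flowline_const.
- move=> t /andP[t0 tT] [u fu ux]; have [d d0 dP] := flowline_extend s0 t0 fu.
  exists d => // r /andP[tr rtd] _; rewrite -ux; apply: dP; lra.
- move=> t /andP[t0 tT] ex.
  have [u uP] : exists u : R -> V, forall T, 0 <= T -> T < t -> flowline s T u /\ u 0 = x.
    apply: (flowline_glue (D := fun r => r < t)).
      by move=> q r qr rt; exact: le_lt_trans rt.
    by move=> r r0 rt; apply: ex; rewrite r0.
  exact: flowline_limit uP.
Qed.

(** * The flow of the blown-up inclusion *)

Lemma flowline_global (s : R) x : s != 0 -> affine x ->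
  exists u : R -> V, u 0 = x /\ forall T, 0 <= T -> flowline s T u.
Proof.
move=> s0 ax; have [|T T0 _|u uP] := @flowline_glue s x (fun=> True).
- by [].
- exact: flowline_exists.
- by exists u; split=> [|T T0]; [have [] := uP 0 (lexx _) I|have [] := uP T T0 I].
Qed.

(** The hypotheses stand under the existential so that one choice serves all s and x. *)
Lemma half_flow_exists (s : R) x : exists u : R -> V, s != 0 -> affine x ->
  u 0 = x /\ forall T, 0 <= T -> flowline s T u.
Proof.
have [[s0 ax]|nsx] := pselect (s != 0 /\ affine x).
  by have [u uP] := flowline_global s0 ax; exists u.
by exists (fun=> x) => s0 ax; exfalso; apply: nsx.
Qed.

Definition half_flow (s : R) x : R -> V := projT1 (cid (half_flow_exists s x)).

Lemma half_flow0 (s : R) x : s != 0 -> affine x -> half_flow s x 0 = x.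
Proof. by move=> s0 ax; have [] := projT2 (cid (half_flow_exists s x)) s0 ax. Qed.

Lemma half_flowP (s : R) x T : s != 0 -> affine x -> 0 <= T ->
  flowline s T (half_flow s x).
Proof. by move=> s0 ax T0; have [_] := projT2 (cid (half_flow_exists s x)) s0 ax; apply. Qed.

Lemma half_flow_step (s : R) x t : s != 0 -> affine x -> 0 <= t ->
  exists2 d : R, 0 < d & forall r, t < r < t + d ->
    half_flow s x r = half_flow s x t + (r - t) *: velocity s (half_flow s x t).
Proof.
move=> s0 ax t0; have t1 : 0 <= t + 1 by lra.
have [_ _ /(_ t)[|d d0 dP]] := half_flowP s0 ax t1; first by lra.
exists (Num.min d 1); first by rewrite lt_min d0 ltr01.
move=> r /andP[tr]; rewrite -ltrBlDl lt_min => /andP[rd r1].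
by apply: dP; lra.
Qed.

(* A curve moving along the velocity field in the internal time tau is the
   reparametrised half flow. *)
Lemma half_flow_unique (s L C : R) (u : R -> V) (tau : R -> R) : s != 0 ->
  affine (u 0) -> tau 0 = 0 -> 0 <= C ->
  (forall t r, 0 <= t -> t < r -> r <= L -> tau t < tau r) ->
  (forall t r, 0 <= t -> t <= r -> r <= L -> `|tau r - tau t| <= C * (r - t)) ->
  (forall h, 0 < h -> exists2 d : R, 0 < d & forall t r, 0 <= t -> t <= r -> r <= L ->
     r - t < d -> `|u r - u t| < h) ->
  (forall t, 0 <= t < L -> exists2 d : R, 0 < d & forall r, t < r < t + d -> r <= L ->
     u r = u t + (tau r - tau t) *: velocity s (u t)) ->
  forall t, 0 <= t <= L -> u t = half_flow s (u 0) (tau t).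
Proof.
move=> s0 au tau0 C0 tau_mono tau_lip u_mod u_step.
have tau_ge0 t : 0 <= t -> t <= L -> 0 <= tau t.
  rewrite le_eqVlt => /orP[/eqP <-|t0] tL; first by rewrite tau0.
  by rewrite -tau0 ltW// tau_mono.
apply: real_induction.
- by rewrite tau0 half_flow0.
- move=> t /andP[t0 tL] ut; have [d d0 dP] := u_step t ltac:(lra).
  have [d' d'0 d'P] := half_flow_step s0 au (tau_ge0 t t0 (ltW tL)).
  have C1 : 0 < C + 1 by lra.
  exists (Num.min d (d' / (C + 1))); first by rewrite lt_min d0 divr_gt0.
  move=> r /andP[tr]; rewrite -ltrBlDl lt_min => /andP[rd rd'] rL.
  have trd : t < r < t + d by lra.
  rewrite ltr_pdivlMr// in rd'.
  have taud : tau t < tau r < tau t + d'.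
    have := tau_lip t r t0 (ltW tr) rL; rewrite ler_norml => /andP[_ h1].
    by rewrite (tau_mono t r t0 tr rL)/=; lra.
  by rewrite (dP _ trd rL) (d'P _ taud) -ut.
- move=> t /andP[t0 tL] ih; apply/eqP; rewrite -subr_eq0 -normr_le0.
  apply/ler_addgt0Pr => h h0; rewrite add0r.
  have S0 : 0 <= speed s by rewrite mulr_ge0.
  have [d d0 dP] := u_mod (h / 2) ltac:(lra).
  pose K := 2 * (speed s * C + 1).
  have SC : 0 <= speed s * C by rewrite mulr_ge0.
  have K0 : 0 < K by rewrite /K; lra.
  pose k := Num.min (d / 2) (h / K).
  have k0 : 0 < k by rewrite lt_min !divr_gt0.
  pose r := Num.max 0 (t - k).
  have rt : r < t by rewrite gt_max t0 gtrBl.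
  have r0 : 0 <= r by rewrite le_max lexx.
  have trk : t - r <= k by have : t - k <= r; [rewrite le_max lexx orbT|lra].
  have [kd kh] : k <= d / 2 /\ k <= h / K by rewrite /k !ge_min !lexx orbT.
  have r0t : 0 <= r < t by rewrite r0.
  have -> : u t - half_flow s (u 0) (tau t) = (u t - u r) -
      (half_flow s (u 0) (tau t) - half_flow s (u 0) (tau r)).
    by rewrite -(ih r r0t) opprB addrA subrK.
  apply: le_trans (ler_normB _ _) _.
  have h1 : `|u t - u r| < h / 2 by apply: dP; lra.
  have [_ /(_ (tau r) (tau t)) h2 _] := half_flowP s0 au (tau_ge0 t (ltW t0) tL).
  have {}h2 := h2 (tau_ge0 r r0 ltac:(lra)) (ltW (tau_mono r t r0 rt tL)) (lexx _).
  have := tau_lip r t r0 (ltW rt) tL; rewrite ler_norml => /andP[_ h3].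
  have h4 : speed s * (tau t - tau r) <= speed s * (C * k).
    apply: ler_wpM2l => //; apply: le_trans h3 _; exact: ler_wpM2l.
  have h5 : K * k <= h by rewrite mulrC -ler_pdivlMr.
  move: h5; rewrite /K => h5.
  by lra.
Qed.

Definition Psi (t : R) x : V := if 0 <= t then half_flow 1 x t else half_flow (-1) x (- t).

Let one0 : (1 : R) != 0. Proof. exact: oner_neq0. Qed.
Let mone0 : (-1 : R) != 0. Proof. by rewrite oppr_eq0 oner_neq0. Qed.

Lemma Psi_pos t x : 0 <= t -> Psi t x = half_flow 1 x t.
Proof. by rewrite /Psi => ->. Qed.

Lemma Psi_neg t x : affine x -> t <= 0 -> Psi t x = half_flow (-1) x (- t).
Proof.
rewrite /Psi => ax; rewrite le_eqVlt => /orP[/eqP ->|t0].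
  by rewrite lexx oppr0 !half_flow0.
by rewrite leNgt t0.
Qed.

Lemma Psi0 x : affine x -> Psi 0 x = x.
Proof. by move=> ax; rewrite Psi_pos// half_flow0. Qed.

Lemma Psi_affine t x : affine x -> affine (Psi t x).
Proof.
move=> ax; have [t0|t0] := leP 0 t.
  by rewrite Psi_pos//; have [+ _ _] := half_flowP one0 ax t0; apply; rewrite t0 lexx.
have t0' : 0 <= - t by lra.
rewrite Psi_neg ?(ltW t0)//; have [+ _ _] := half_flowP mone0 ax t0'.
by apply; rewrite t0' lexx.
Qed.

Lemma Psi_lipschitz t r x : affine x -> `|Psi r x - Psi t x| <= 2 * `|r - t|.
Proof.
move=> ax.
have S1 : speed 1 = 2 by rewrite /speed normr1 mul1r.
have S2 : speed (-1) = 2 by rewrite /speed normrN1 mul1r.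
suff H t' r' : t' <= r' -> `|Psi r' x - Psi t' x| <= 2 * (r' - t').
  have [tr|rt] := leP t r; first by rewrite ger0_norm ?subr_ge0// H.
  have rt0 : r - t < 0 by lra.
  by rewrite (ltr0_norm rt0) opprB distrC; apply: H; exact: ltW.
have pos t1 r1 : 0 <= t1 -> t1 <= r1 -> `|Psi r1 x - Psi t1 x| <= 2 * (r1 - t1).
  move=> t10 tr; have r10 := le_trans t10 tr; rewrite !Psi_pos//.
  by have [_ + _] := half_flowP one0 ax r10; rewrite S1; apply.
have neg t1 r1 : r1 <= 0 -> t1 <= r1 -> `|Psi r1 x - Psi t1 x| <= 2 * (r1 - t1).
  move=> r10 tr; have t10 := le_trans tr r10.
  have nt : 0 <= - t1 by lra.
  rewrite !Psi_neg// distrC; have [_ + _] := half_flowP mone0 ax nt.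
  rewrite S2 => /(_ (- r1) (- t1)) h.
  have -> : r1 - t1 = - t1 - - r1 by ring.
  by apply: h; lra.
move=> tr; have [t0|t0] := leP 0 t'; first exact: pos.
have [r0|r0] := leP r' 0; first exact: neg.
have -> : Psi r' x - Psi t' x = (Psi r' x - Psi 0 x) + (Psi 0 x - Psi t' x).
  by rewrite addrA subrK.
apply: le_trans (ler_normD _ _) _.
have := pos 0 r' (lexx _) (ltW r0); have := neg t' 0 (lexx _) (ltW t0); lra.
Qed.

Definition regular_time x (t : R) : Prop :=
  exists2 c, BR (Psi t x) c & approx_at (Psi ^~ x) t (c - e).

Lemma approx_affine (u : R -> V) (t d : R) (y w : V) (t0 : R) : 0 < d ->
  (forall r, `|r - t| < d -> u r = y + (r - t0) *: w) -> approx_at u t w.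
Proof.
move=> d0 uE h h0; exists d; first exact: d0.
move=> s sd; have ut : `|t - t| < d by rewrite subrr normr0.
rewrite (uE s sd) (uE t ut) opprD addrACA subrr add0r -scalerBl.
have -> : s - t0 - (t - t0) = s - t by ring.
by rewrite subrr normr0 mulr_ge0// ltW.
Qed.

(** Just after t the curve is straight with a constant local equilibrium as reply, so all these
    times are regular. Irregular times t >= 0 are thus isolated from the right, hence countable. *)
Lemma right_regular_time x t : affine x -> 0 <= t ->
  exists2 d : R, 0 < d & forall r, t < r < t + d -> regular_time x r.
Proof.
move=> ax t0; have [d d0 dP] := half_flow_step one0 ax t0.
have [d' d'0 d'P] := velocity_near (half_flow 1 x t) one0.
set y := half_flow 1 x t in dP d'P; set v := velocity 1 y in dP d'P.
exists (Num.min d d'); first by rewrite lt_min d0.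
move=> r /andP[tr]; rewrite -ltrBlDl lt_min => /andP[rd rd'].
have PE s : t < s < t + d -> Psi s x = y + (s - t) *: v.
  by move=> sd; rewrite Psi_pos; [exact: dP|lra].
have rE := PE r ltac:(lra).
have vE : v = loc 1 (Psi r x) - e.
  by rewrite -(d'P (r - t)); [rewrite -rE /velocity scale1r|lra].
exists (loc 1 (Psi r x)); first exact: (locP 1 _).1.
rewrite -vE; pose m := Num.min (r - t) (t + d - r).
have m0 : 0 < m by rewrite lt_min; apply/andP; split; lra.
apply: (approx_affine (t0 := t) (y := y) m0) => s sm; apply: PE.
have [m1 m2] : m <= r - t /\ m <= t + d - r by rewrite /m !ge_min !lexx orbT.
by move: sm; rewrite ltr_norml => /andP[h1 h2]; apply/andP; split; lra.
Qed.

Lemma left_regular_time x t : affine x -> t <= 0 ->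
  exists2 d : R, 0 < d & forall r, t - d < r < t -> regular_time x r.
Proof.
move=> ax t0; have nt0 : 0 <= - t by lra.
have [d d0 dP] := half_flow_step mone0 ax nt0.
have [d' d'0 d'P] := velocity_near (half_flow (-1) x (- t)) mone0.
set y := half_flow _ x (- t) in dP d'P; set v := velocity (-1) y in dP d'P.
exists (Num.min d d'); first by rewrite lt_min d0.
move=> r /andP[]; rewrite ltrBlDr -ltrBlDl lt_min => /andP[rd rd'] rt.
have PE s : t - d < s < t -> Psi s x = y + (s - t) *: (- v).
  move=> sd; rewrite Psi_neg//; last lra.
  by rewrite (dP (- s)); [rewrite scalerN -scaleNr; congr (_ + _ *: _); ring|lra].
have rE := PE r ltac:(lra).
have vE : - v = loc (-1) (Psi r x) - e.
  rewrite -(d'P (t - r)); last lra.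
  have -> : y + (t - r) *: v = Psi r x by rewrite rE scalerN -scaleNr opprB.
  by rewrite /velocity scaleN1r opprK.
exists (loc (-1) (Psi r x)); first exact: (locP (-1) _).1.
rewrite -vE; pose m := Num.min (t - r) (r - (t - d)).
have m0 : 0 < m by rewrite lt_min; apply/andP; split; lra.
apply: (approx_affine (t0 := t) (y := y) m0) => s sm; apply: PE.
have [m1 m2] : m <= t - r /\ m <= r - (t - d) by rewrite /m !ge_min !lexx orbT.
by move: sm; rewrite ltr_norml => /andP[h1 h2]; apply/andP; split; lra.
Qed.

Lemma irregular_countable_pos x : affine x ->
  countable [set t | 0 <= t /\ ~ regular_time x t].
Proof.
move=> ax; apply: countable_right_isolated => t [t0 _].
have [d d0 dP] := right_regular_time ax t0.
by exists d; [exact: d0|move=> r rd [_ nr]; apply: nr; exact: dP].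
Qed.

Lemma irregular_countable_neg x : affine x ->
  countable [set t | t <= 0 /\ ~ regular_time x t].
Proof.
move=> ax; apply: countable_left_isolated => t [t0 _].
have [d d0 dP] := left_regular_time ax t0.
by exists d; [exact: d0|move=> r rd [_ nr]; apply: nr; exact: dP].
Qed.

Lemma irregular_negligible x : affine x ->
  lebesgue_measure.-negligible [set t | ~ regular_time x t].
Proof.
move=> ax.
have h1 := countable_negligible (irregular_countable_pos ax).
have h2 := countable_negligible (irregular_countable_neg ax).
apply: negligibleS (negligibleU h1 h2) => t /= nt.
by have [t0|/ltW t0] := leP 0 t; [left|right].
Qed.

Lemma Psi_ac x (a b : R) : affine x -> abs_continuous_on a b (Psi ^~ x).
Proof.
move=> ax; apply: (@ac_dominated R R^o _ (fun=> 0) _ a b 2) => //.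
  by move=> h h0; exists 1 => // N s t _ _ _; rewrite big1// => k _; rewrite subrr normr0.
move=> s t _ st _; rewrite subrr normr0 add0r.
by have := Psi_lipschitz s t ax; rewrite (ger0_norm (_ : 0 <= t - s)) ?subr_ge0.
Qed.

Lemma Psi_ae_sol x (a b : R) : affine x -> ae_sol id a b (Psi ^~ x).
Proof.
move=> ax; split.
- exact: Psi_ac.
- by move=> t _; exact: Psi_affine.
- by exists 1 => // s t _ st _; rewrite mul1r ger0_norm// subr_ge0.
- by [].
- exists [set t | ~ regular_time x t]; first exact: irregular_negligible.
  move=> t _ /contrapT[c tc cE]; exists c, 1; split=> //.
    move=> h h0; exists 1; first exact: ltr01.
    by move=> s _; rewrite [(s - t) *: _]mulr1 subrr normr0 mulr_ge0// ltW.
  by rewrite scale1r.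
Qed.

Lemma ae_sol_unique_forward th (a b : R) (u : R -> V) : a <= b -> ae_sol th a b u ->
  u b = Psi (th b - th a) (u a).
Proof.
move=> ab su; have [acu au [C C0 thC] thm _] := su.
have ua : affine (u a) by apply: au; rewrite lexx.
have tba : 0 <= th b - th a.
  by move: ab; rewrite le_eqVlt => /orP[/eqP ->|h]; [rewrite subrr|rewrite subr_ge0 ltW// thm].
have := @half_flow_unique 1 (b - a) C (fun r => u (a + r)) (fun r => th (a + r) - th a) one0.
rewrite addr0 => /(_ ua (subrr _) C0) H.
have := H _ _ _ _ (b - a); rewrite (addrC a) subrK Psi_pos//; apply.
- by move=> t r t0 tr rL; rewrite ltrD2r; apply: thm; lra.
- move=> t r t0 tr rL; have -> : th (a + r) - th a - (th (a + t) - th a) = th (a + r) - th (a + t) by ring.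
  have -> : r - t = a + r - (a + t) by ring.
  by apply: thC; lra.
- move=> h h0; have [d d0 dP] := ac_modulus acu h0; exists d; first exact: d0.
  by move=> t r t0 tr rL trd; apply: dP; lra.
- move=> t tL; have [|d d0 dP] := @ae_sol_forward th a b (a + t) u su; first by lra.
  exists d; first exact: d0.
  move=> r rd rL; rewrite (dP (a + r)); [|lra|lra].
  by congr (_ + _ *: _); ring.
- by rewrite subr_ge0 ab lexx.
Qed.

Lemma ae_sol_unique_backward th (a b : R) (u : R -> V) : a <= b -> ae_sol th a b u ->
  u a = Psi (th a - th b) (u b).
Proof.
move=> ab su; have [acu au [C C0 thC] thm _] := su.
have ub : affine (u b) by apply: au; rewrite lexx andbT.
have tba : th a - th b <= 0.
  by move: ab; rewrite le_eqVlt => /orP[/eqP ->|h]; [rewrite subrr|rewrite subr_le0 ltW// thm].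
have := @half_flow_unique (-1) (b - a) C (fun r => u (b - r)) (fun r => th b - th (b - r)) mone0.
rewrite subr0 => /(_ ub (subrr _) C0) H.
have := H _ _ _ _ (b - a); rewrite subKr Psi_neg// opprB; apply.
- by move=> t r t0 tr rL; rewrite ltrD2l ltrN2; apply: thm; lra.
- move=> t r t0 tr rL.
  have -> : th b - th (b - r) - (th b - th (b - t)) = th (b - t) - th (b - r) by ring.
  have -> : r - t = b - t - (b - r) by ring.
  by apply: thC; lra.
- move=> h h0; have [d d0 dP] := ac_modulus acu h0; exists d; first exact: d0.
  by move=> t r t0 tr rL trd; rewrite distrC; apply: dP; lra.
- move=> t tL; have [|d d0 dP] := @ae_sol_backward th a b (b - t) u su; first by lra.
  exists d; first exact: d0.
  move=> r rd rL; rewrite (dP (b - r)); [|lra|lra].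
  by congr (_ + _ *: _); ring.
- by rewrite subr_ge0 ab lexx.
Qed.

(** [Psi ^~ x] is a solution on intervals across 0 as well, so uniqueness covers all combinations of
    signs. *)
Lemma PsiD s t x : affine x -> Psi (s + t) x = Psi s (Psi t x).
Proof.
move=> ax; have [s0|s0] := leP 0 s.
  have ts : t <= s + t by lra.
  by rewrite (ae_sol_unique_forward ts (Psi_ae_sol t (s + t) ax)) addrK.
have ts : s + t <= t by lra.
by rewrite (ae_sol_unique_backward ts (Psi_ae_sol (s + t) t ax)) addrK.
Qed.

Lemma Ham_Psi t x : affine x -> Ham M (Psi t x) = Ham M x.
Proof.
move=> ax; have [t0|/ltW t0] := leP 0 t.
  by rewrite -(Ham_ae_sol t0 (Psi_ae_sol 0 t ax)) Psi0.
by rewrite (Ham_ae_sol t0 (Psi_ae_sol t 0 ax)) Psi0.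
Qed.

Lemma Psi_average t x y : affine y ->
  (forall r, `|r| <= `|t| -> BR (Psi r y) `<=` BR x) ->
  exists2 c, BR x c & Psi t y = y + t *: (c - e).
Proof.
move=> ay near; have [t0|t0|t0] := ltgtP t 0.
- have [|c xc] := BR_average t0 (Psi_ae_sol t 0 ay) (x := x).
    move=> r /andP[tr r0]; apply: near; rewrite !ler0_norm//; lra.
  rewrite sub0r Psi0// => yE; exists c; first exact: xc.
  by rewrite {2}yE -addrA -scalerDl addNr scale0r addr0.
- have [|c xc] := BR_average t0 (Psi_ae_sol 0 t ay) (x := x).
    by move=> r /andP[r0 rt]; apply: near; rewrite !ger0_norm//; lra.
  by rewrite subr0 Psi0// => yE; exists c.
- have [c yc] := BR_neq0 y; exists c; last by rewrite t0 Psi0// scale0r addr0.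
  have := near 0; rewrite normr0 => /(_ (normr_ge0 _)); rewrite Psi0//; exact.
Qed.

(* On a nearby curve the mean reply is an eta-equilibrium with |t| * eta of the
   order of |y - x|: either eta is small and loc_approx applies, or |t| is small. *)
Lemma Psi_local_continuity x : affine x -> exists2 d : R, 0 < d &
  forall h : R, 0 < h -> exists2 r : R, 0 < r & forall y t, affine y ->
    `|y - x| < r -> `|t| < d -> `|Psi t y - Psi t x| <= h.
Proof.
move=> ax; have [r0 r00 near] := BR_near x.
(* This time step does not depend on h, as the continuation in time requires. At speed at most 2 a
   curve moves by less than r0 / 2 during it. *)
exists (r0 / 4); first by rewrite divr_gt0.
move=> h h0; set d := r0 / 4.
have d0 : 0 < d by rewrite divr_gt0.
pose h' := h / (2 * d).
have h'0 : 0 < h' by rewrite divr_gt0// mulr_gt0.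
have [k1 k10 k1P] := loc_approx x one0 h'0.
have [k2 k20 k2P] := loc_approx x mone0 h'0.
pose k := Num.min k1 k2.
have k0 : 0 < k by rewrite lt_min k10.
have [kk1 kk2] : k <= k1 /\ k <= k2 by rewrite /k !ge_min !lexx orbT.
have C0 := gain_const_gt0; set C := gain_const in C0.
(* Chosen so that |y - x| + 2 |t| <= B |y - x| in the case where |t| * k <= 2 C |y - x|. *)
pose B := 2 + 4 * C / k.
have B0 : 0 < B by rewrite ltr_wpDr// divr_ge0 ?(ltW k0)// mulr_ge0// ltW.
pose r := Num.min (r0 / 2) (h / (2 * B)).
have rr : 0 < r by rewrite lt_min !divr_gt0// mulr_gt0.
have [rr0 rh] : r <= r0 / 2 /\ r <= h / (2 * B) by rewrite /r !ge_min !lexx orbT.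
exists r; first exact: rr.
move=> y t ay yx td.
have avg z : affine z -> `|z - x| < r -> exists2 c, BR x c & Psi t z = z + t *: (c - e).
  move=> az zx; apply: Psi_average => // s st; apply: near.
  have -> : Psi s z - x = (Psi s z - Psi 0 z) + (z - x) by rewrite Psi0// addrA subrK.
  apply: le_lt_trans (ler_normD _ _) _.
  have := Psi_lipschitz 0 s az; rewrite subr0 => h1.
  have : r0 = 4 * d by rewrite /d; field.
  lra.
have [cy xcy yE] := avg y ay yx.
have [|cx xcx xE] := avg x ax; first by rewrite subrr normr0.
rewrite yE xE.
have -> : y + t *: (cy - e) - (x + t *: (cx - e)) = (y - x) + t *: (cy - cx).
  by rewrite opprD addrACA -scalerBr opprB addrA subrK.
apply: le_trans (ler_normD _ _) _; rewrite normrZ.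
(* [Ham M] is conserved along the curve of y, and both [Ham M] and [gain b] change by at most C |y -
   x| between x and y. *)
have gap b : BR x b -> t * gain b cy <= 2 * C * `|y - x|.
  move=> xb; have sb := BR_simplex2 xb.
  have := Ham_ge (Psi t y) sb; rewrite Ham_Psi// yE gainDr gainZr gain_sub_e//.
  have := Ham_lipschitz y x; rewrite ler_norml => /andP[_ h1].
  have := norm_gain (y - x) sb; rewrite gainBr ler_norml => /andP[h2 _].
  rewrite (Ham_BR xb) in h1; rewrite -/C in h1 h2; lra.
have gap0 b : BR x b -> t * gain b cx <= 0.
  move=> xb; have sb := BR_simplex2 xb.
  have := Ham_ge (Psi t x) sb; rewrite Ham_Psi// xE gainDr gainZr gain_sub_e//.
  rewrite (Ham_BR xb); lra.
have cc : `|cy - cx| <= 2.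
  apply: le_trans (ler_normB _ _) _; rewrite -[2]/(1 + 1).
  by apply: lerD; apply: norm_simplex2; [exact: BR_simplex2 xcy|exact: BR_simplex2 xcx].
have Bk : B * k = 2 * k + 4 * C by rewrite /B mulrDl divfK// gt_eqF.
have yxh : B * `|y - x| <= h / 2.
  have : B * `|y - x| <= B * (h / (2 * B)) by rewrite ler_pM2l//; lra.
  have -> : B * (h / (2 * B)) = h / 2 by field; rewrite gt_eqF.
  by [].
have yx0 := normr_ge0 (y - x).
have [tk|kt] := leP (`|t| * k) (2 * C * `|y - x|).
  have h1 : `|t| * `|cy - cx| <= `|t| * 2 by rewrite ler_wpM2l.
  suff : (`|y - x| + `|t| * 2) <= B * `|y - x| by lra.
  rewrite -(ler_pM2r k0).
  have -> : B * `|y - x| * k = (B * k) * `|y - x| by ring.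
  by rewrite Bk; nra.
have t0 : 0 < `|t|.
  rewrite lt_neqAle normr_ge0 andbT; apply/eqP => t0; move: kt; rewrite -t0 mul0r.
  have : 0 <= 2 * C * `|y - x| by rewrite mulr_ge0// mulr_ge0// ltW.
  lra.
(* With s the sign of t, the two bounds concern the local game of sign s: cx solves it exactly, cy
   up to k. *)
have small (s : R) : s * `|t| = t -> s != 0 ->
    (forall b, BR x b -> (forall b', BR x b' -> s * gain b' b <= k) -> `|b - loc s x| < h') ->
    `|cy - cx| < h'.
  move=> st s0 H; suff -> : cx = loc s x.
    apply: (H cy xcy) => b xb; rewrite -(ler_pM2r t0).
    have -> : s * gain b cy * `|t| = t * gain b cy by rewrite -[in RHS]st; ring.
    by have := gap b xb; lra.
  apply: (loc_eq s0); split; first exact: xcx.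
  move=> b xb; rewrite -(pmulr_rle0 _ t0).
  have -> : `|t| * (s * gain b cx) = t * gain b cx by rewrite -[in RHS]st; ring.
  exact: gap0.
have ch : `|cy - cx| < h'.
  have [tge|tlt] := leP 0 t.
    apply: (small 1 _ one0); first by rewrite mul1r ger0_norm.
    by move=> b xb bk; apply: k1P => // b' xb'; apply: le_trans (bk _ xb') kk1.
  apply: (small (-1) _ mone0); first by rewrite mulN1r ltr0_norm// opprK.
  by move=> b xb bk; apply: k2P => // b' xb'; apply: le_trans (bk _ xb') kk2.
have h1 : `|t| * `|cy - cx| <= d * h'.
  by apply: ler_pM => //; exact: ltW.
have dh : d * h' = h / 2 by rewrite /h'; field; rewrite gt_eqF.
have : `|y - x| <= B * `|y - x|.
  rewrite ler_peMl// /B.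
  have : 0 <= 4 * C / k by rewrite divr_ge0 ?(ltW k0)// mulr_ge0// ltW.
  lra.
lra.
Qed.

(** Real induction on T: [Psi_local_continuity] moves on to later times, and at limits from the left
    continuity is kept because all curves share the speed bound 2. The sign s treats both directions
    of time. *)
Lemma Psi_continuous_at_time (s T : R) x : s * s = 1 -> affine x -> 0 <= T ->
  forall h : R, 0 < h -> exists2 r : R, 0 < r & forall y, affine y ->
    `|y - x| < r -> `|Psi (s * T) y - Psi (s * T) x| <= h.
Proof.
move=> ss ax T0.
have ns : `|s| = 1.
  have : `|s| * `|s| = 1 by rewrite -normrM ss normr1.
  have := normr_ge0 s; nra.
pose P T := forall h : R, 0 < h -> exists2 r : R, 0 < r & forall y, affine y ->
    `|y - x| < r -> `|Psi (s * T) y - Psi (s * T) x| <= h.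
apply: (@real_induction _ 0 T P); last by rewrite T0 lexx.
- move=> h h0; exists h => // y ay yx; rewrite mulr0 !Psi0//; exact: ltW.
- move=> t /andP[t0 tT] Pt.
  have [d d0 dP] := Psi_local_continuity (Psi_affine (s * t) ax).
  exists d; first exact: d0.
  move=> r /andP[tr rtd] rT h h0; have [r1 r10 r1P] := dP h h0.
  have [r2 r20 r2P] := Pt (r1 / 2) ltac:(lra).
  exists r2; first exact: r20.
  move=> y ay yx; have -> : s * r = s * (r - t) + s * t by ring.
  rewrite !PsiD//; apply: r1P; first exact: Psi_affine.
    by have := r2P y ay yx; lra.
  by rewrite normrM ns mul1r gtr0_norm; lra.
- move=> t /andP[t0 tT] ih h h0.
  pose r := Num.max 0 (t - h / 8).
  have rt : r < t by rewrite gt_max t0 gtrBl divr_gt0.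
  have r0 : 0 <= r by rewrite le_max lexx.
  have trk : t - r <= h / 8 by have : t - h / 8 <= r; [rewrite le_max lexx orbT|lra].
  have r0t : 0 <= r < t by rewrite r0.
  have [d d0 dP] := ih r r0t (h / 2) ltac:(lra).
  exists d; first exact: d0.
  move=> y ay yx; have h1 := dP y ay yx.
  have h2 := Psi_lipschitz (s * r) (s * t) ay.
  have h3 := Psi_lipschitz (s * r) (s * t) ax.
  have sE : `|s * t - s * r| = t - r.
    by rewrite -mulrBr normrM ns mul1r gtr0_norm// subr_gt0.
  rewrite sE in h2 h3.
  have -> : Psi (s * t) y - Psi (s * t) x = (Psi (s * t) y - Psi (s * r) y) +
     (Psi (s * r) y - Psi (s * r) x) - (Psi (s * t) x - Psi (s * r) x).
    by rewrite addrA subrK opprB [RHS]addrA subrK.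
  apply: le_trans (ler_normB _ _) _.
  apply: (@le_trans _ _ (`|Psi (s * t) y - Psi (s * r) y| + `|Psi (s * r) y - Psi (s * r) x|
     + `|Psi (s * t) x - Psi (s * r) x|)); first by rewrite lerD2r ler_normD.
  lra.
Qed.

Lemma Psi_continuous t x : affine x -> forall h : R, 0 < h -> exists2 r : R, 0 < r &
  forall t' y, affine y -> `|t' - t| < r -> `|y - x| < r ->
    `|Psi t' y - Psi t x| <= h.
Proof.
move=> ax h h0.
have [r r0 rP] : exists2 r : R, 0 < r & forall y, affine y ->
    `|y - x| < r -> `|Psi t y - Psi t x| <= h / 2.
  have h20 : 0 < h / 2 by lra.
  have [t0|/ltW t0] := leP 0 t.
    have := Psi_continuous_at_time (mulr1 1) ax t0 h20; rewrite mul1r; exact.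
  have nt0 : 0 <= - t by lra.
  have NN : (-1) * (-1) = 1 :> R by rewrite mulrNN mulr1.
  by have := Psi_continuous_at_time NN ax nt0 h20; rewrite mulrNN mul1r; exact.
exists (Num.min r (h / 4)); first by rewrite lt_min r0 divr_gt0.
move=> t' y ay; rewrite !lt_min => /andP[_ tt'] /andP[yx _].
have -> : Psi t' y - Psi t x = (Psi t' y - Psi t y) + (Psi t y - Psi t x).
  by rewrite addrA subrK.
apply: le_trans (ler_normD _ _) _.
have := Psi_lipschitz t t' ay; have := rP y ay yx; lra.
Qed.

(** By [BR_scale] the dilated curve uses the same replies, so it solves the inclusion with clock r *
    s; uniqueness identifies it. *)
Lemma Psi_scale (r t : R) x : 0 < r -> affine x ->
  Psi (r * t) (e + r *: (x - e)) = e + r *: (Psi t x - e).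
Proof.
move=> r0 ax.
pose u s := e + r *: (Psi s x - e).
have sol (a b : R) : ae_sol (fun s => r * s) a b u.
  split.
  - apply: (@ac_dominated _ _ _ (Psi ^~ x) _ a b r (Psi_ac a b ax)); first exact: ltW.
    move=> s s' _ ss' _; rewrite /u opprD addrACA subrr add0r -scalerBr.
    rewrite opprB addrA subrK normrZ gtr0_norm// ler_wpM2l ?(ltW r0)// lerDl subr_ge0//.
  - by move=> s _; apply: affine_comb; [exact: e_affine|exact: Psi_affine].
  - exists r; first exact: ltW.
    by move=> s s' _ ss' _; rewrite -mulrBr normrM !ger0_norm ?subr_ge0// ltW.
  - by move=> s s' _ ss' _; rewrite ltr_pM2l.
  - exists [set t | ~ regular_time x t]; first exact: irregular_negligible.
    move=> s _ /contrapT[c sc cE]; exists c, r; split.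
    + by rewrite /u BR_scale.
    + exact: ltW.
    + move=> h h0; exists 1; first exact: ltr01.
      move=> s' _; have -> : r * s' - r * s - (s' - s) *: (r : R^o) = 0.
        by rewrite -mulrBr [(s' - s) *: _]mulrC subrr.
      by rewrite normr0 mulr_ge0// ltW.
    + move=> h h0; have [d d0 dP] := cE (h / r) (divr_gt0 h0 r0).
      exists d; first exact: d0.
      move=> s' sd; rewrite /u opprD addrACA subrr add0r -scalerBr opprB addrA subrK.
      rewrite scalerA mulrC -scalerA -scalerBr normrZ gtr0_norm//.
      by have := dP s' sd; rewrite mulrAC ler_pdivlMr// mulrC.
have u0 : u 0 = e + r *: (x - e) by rewrite /u Psi0.
have [t0|/ltW t0] := leP 0 t.
  by have := ae_sol_unique_forward t0 (sol 0 t); rewrite mulr0 subr0 u0.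
by have := ae_sol_unique_backward t0 (sol t 0); rewrite mulr0 subr0 u0.
Qed.

(** * Level sets and the symplectic form *)

Lemma BR_e b : simplex2 R n b -> BR e b.
Proof.
move=> sb; apply: BR_argmax => // b' sb'.
by rewrite !gain_e_affine//; exact: simplex2_affine.
Qed.

Lemma Ham_e : Ham M e = 0.
Proof. by rewrite (Ham_BR (BR_e e_simplex2)) gainxx. Qed.

(** All strategies are best replies to e, so the local game at e is the whole game and its unique
    equilibrium is e. *)
Lemma e_only_saddle z : simplex2 R n z ->
  (forall b, simplex2 R n b -> gain b z <= 0) -> z = e.
Proof.
move=> sz zmax; apply: (@local_eq_unique 1 e) => //.
  by split; [exact: BR_e|move=> b /BR_simplex2 sb; rewrite mul1r zmax].
split; first exact/BR_e/e_simplex2.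
move=> b /BR_simplex2 sb; rewrite gain_e_affine ?mulr0//; exact: simplex2_affine.
Qed.

Lemma nash_e : nash M = [set e].
Proof.
apply/seteqP; split=> [z [sz zz]|_ ->]; last first.
  split; first exact: e_simplex2.
  by have := BR_e e_simplex2; rewrite BR_E.
have {}zz : BR z z by rewrite BR_E.
by apply: e_only_saddle => // b sb; have := BR_max zz sb; rewrite gainxx.
Qed.

Lemma e_interior : exists2 r : R, 0 < r &
  forall x, affine x -> `|x - e| <= r -> simplex2 R n x.
Proof.
have [_ p1 p2 _ _] := emix.
have [r1 r10 r1P] := finite_pos_lower_bound p1.
have [r2 r20 r2P] := finite_pos_lower_bound p2.
exists (Num.min r1 r2); first by rewrite lt_min r10.
move=> x [x1 x2]; rewrite le_min => /andP[xr1 xr2]; split; split=> // i.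
  have := r1P i; have := le_trans (mx_norm_ge (x - e).1 i 0) (le_trans (norm_fst _) xr1).
  by rewrite /= !mxE ler_norml => /andP[h _]; lra.
have := r2P i; have := le_trans (mx_norm_ge (x - e).2 i 0) (le_trans (norm_snd _) xr2).
by rewrite /= !mxE ler_norml => /andP[h _]; lra.
Qed.

Lemma affine_sub x : affine x -> tangent2 R n (x - e).
Proof.
have [e1 e2] := e_affine; move=> [x1 x2]; split=> /=; under eq_bigr do rewrite !mxE.
  by rewrite sumrB x1 e1 subrr.
by rewrite sumrB x2 e2 subrr.
Qed.

Lemma affine_add v (r : R) : tangent2 R n v -> affine (e + r *: v).
Proof.
have [e1 e2] := e_affine; move=> [v1 v2]; split=> /=; under eq_bigr do rewrite !mxE.
  by rewrite big_split/= -mulr_sumr e1 v1 mulr0 addr0.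
by rewrite big_split/= -mulr_sumr e2 v2 mulr0 addr0.
Qed.

Lemma gain_e_tangent v : tangent2 R n v -> gain v e = 0.
Proof. by move=> [v1 v2]; rewrite gain_e// v1 v2. Qed.

Lemma small_in_simplex v : tangent2 R n v -> exists2 r : R, 0 < r & simplex2 R n (e + r *: v).
Proof.
move=> tv; have [r r0 rP] := e_interior.
have v0 : 0 < `|v| + 1 by rewrite ltr_wpDl.
exists (r / (`|v| + 1)); first by rewrite divr_gt0.
apply: rP; first exact: affine_add.
rewrite addrC addKr normrZ gtr0_norm ?divr_gt0// mulrAC ler_pdivrMr// ler_pM2l//.
by rewrite lerDl.
Qed.

(** A nonzero such v, scaled to stay in the simplices, would make e + r v a second saddle point.
    Positivity of [Ham M] off e and nondegeneracy of the form both rest on this. *)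
Lemma gain_degenerate v : tangent2 R n v ->
  (forall b, simplex2 R n b -> gain b v <= 0) -> v = 0.
Proof.
move=> tv vmax; have [r r0 sr] := small_in_simplex tv.
have : e + r *: v = e.
  apply: e_only_saddle => // b sb; rewrite gainDr (gain_e_affine (simplex2_affine sb)).
  by rewrite add0r gainZr pmulr_rle0//; exact: vmax.
move=> /eqP; rewrite addrC -subr_eq0 addrK scaler_eq0 gt_eqF//= => /eqP; exact.
Qed.

Lemma Ham_gt0 x : affine x -> x <> e -> 0 < Ham M x.
Proof.
move=> ax xe; rewrite ltNge; apply/negP => H0; apply: xe.
apply/eqP; rewrite -subr_eq0; apply/eqP/gain_degenerate; first exact: affine_sub.
by move=> b sb; rewrite gain_sub_e//; exact: le_trans (Ham_ge _ sb) H0.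
Qed.

Lemma omega_gain x y : omega M x y = gain x y.
Proof.
have E p q : payoff M p q = \sum_i \sum_j M i j * (p i 0 * q j 0).
  rewrite payoffE; apply: eq_bigr => i _; rewrite mxE mulr_sumr.
  by apply: eq_bigr => j _; ring.
rewrite /gain !E -sumrB; apply: eq_bigr => i _; rewrite -sumrB; apply: eq_bigr => j _.
by ring.
Qed.

Lemma gain_symplectic x : tangent2 R n x ->
  (forall y, tangent2 R n y -> gain x y = 0) -> x = 0.
Proof.
move=> tx x0; apply: gain_degenerate => // b sb.
have := x0 _ (affine_sub (simplex2_affine sb)).
rewrite gainBr (gain_e_tangent tx) subr0 => h.
by rewrite gain_anti h oppr0.
Qed.

Lemma symplecticM : symplectic M.
Proof.
move=> x tx h; apply: gain_symplectic => // y ty; rewrite -omega_gain; exact: h.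
Qed.

(** With A = M the form is [gain] itself, and dH is [gain] against the reply c. On tangent vectors c
    and c - e act alike, so nondegeneracy leaves only X = c - e. *)
Lemma ham_fieldE z x : ham_field M M z x <-> exists2 c, BR z c & x = c - e.
Proof.
have key c y : tangent2 R n y -> simplex2 R n c -> gain (c - e) y = gain c y.
  by move=> ty sc; rewrite gainBl (gain_anti y e) (gain_e_tangent ty) oppr0 subr0.
split.
  move=> [tx [b [c [zb zc h]]]].
  have zbc : BR z (b, c) by rewrite BR_E.
  have sbc := BR_simplex2 zbc.
  exists (b, c); first exact: zbc.
  apply/eqP; rewrite -subr_eq0; apply/eqP/gain_symplectic.
    have [t1 t2] := affine_sub (simplex2_affine sbc); case: tx => x1 x2.
    split=> /=; under eq_bigr do rewrite mxE [X in _ + X]mxE.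
      by rewrite sumrB x1 t1 subrr.
    by rewrite sumrB x2 t2 subrr.
  move=> y ty; rewrite gainBl key// -omega_gain h//.
  by rewrite /gain subrr.
move=> [c zc ->]; have sc := BR_simplex2 zc; split.
  exact/affine_sub/simplex2_affine.
exists c.1, c.2; move: (zc); rewrite BR_E => -[zc1 zc2]; split=> // y ty.
by rewrite omega_gain key.
Qed.

Lemma br_fieldE z x : br_field M z x <-> BR z (x + z).
Proof. by rewrite BR_E. Qed.

Lemma affine_closed : closed (affine : set V).
Proof.
have c1 : continuous (fun x : V => \sum_i x.1 i 0).
  apply: sum_continuous => i x; apply: (@continuous_comp _ _ _ fst (fun p : 'cV[R]_n => p i 0)).
    exact: cvg_fst.
  exact: cV_coord_continuous.
have c2 : continuous (fun x : V => \sum_i x.2 i 0).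
  apply: sum_continuous => i x; apply: (@continuous_comp _ _ _ snd (fun p : 'cV[R]_n => p i 0)).
    exact: cvg_snd.
  exact: cV_coord_continuous.
have -> : (affine : set V) = ((fun x : V => \sum_i x.1 i 0) @^-1` [set r : R | r = 1]) `&`
    ((fun x : V => \sum_i x.2 i 0) @^-1` [set r : R | r = 1]) by [].
by apply: closedI; apply: closed_comp; [move=> x _; exact: c1|exact: closed_eq|
  move=> x _; exact: c2|exact: closed_eq].
Qed.

Lemma sphere_compact (r : R) :
  (forall x, affine x -> `|x - e| <= r -> simplex2 R n x) ->
  compact [set x : V | affine x /\ `|x - e| = r].
Proof.
move=> rP; apply: (@subclosed_compact _ _ (face [set: 'I_n]%SET `*` face [set: 'I_n]%SET)); last 2 first.
- by apply: compact_setX; exact: face_compact.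
- by move=> x [ax xr]; have [] := rP x ax ltac:(by rewrite xr); split; exact: simplex_face.
apply: closedI; first exact: affine_closed.
apply: (@closed_comp _ _ (fun x : V => `|x - e|) [set t : R | t = r]);
  last exact: closed_eq.
by move=> x _; apply: cvg_norm; apply: cvgB; [exact: cvg_id|exact: cvg_cst].
Qed.

Lemma Ham_continuous : continuous (Ham M).
Proof.
move=> x; apply/cvgrPdist_lt => h h0; apply/(@nbhs_ballP R V).
exists (h / gain_const); first by rewrite /= divr_gt0// gain_const_gt0.
move=> y; rewrite -ball_normE /= ltr_pdivlMr ?gain_const_gt0// => yx.
by apply: le_lt_trans (Ham_lipschitz _ _) _; rewrite mulrC.
Qed.

(** Let rho0 be the minimum of [Ham M] on a sphere about e inside the simplices. A point outside is
    moved onto the sphere by a dilation with factor below 1, so by homogeneity its [Ham M] exceeds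
    rho0. *)
Lemma small_level_in_simplex : exists2 rho0 : R, 0 < rho0 &
  forall x, affine x -> Ham M x < rho0 -> simplex2 R n x.
Proof.
have [r r0 rP] := e_interior.
pose A := [set x : V | affine x /\ `|x - e| = r].
(* The sphere is empty when n = 1, where the affine space is the single point e. *)
have [A0|A0] := pselect (A !=set0); last first.
  exists 1; first exact: ltr01.
  move=> x ax _; have [->|/eqP xe] := eqVneq x e; first exact: e_simplex2.
  exfalso; apply: A0; exists (e + (r / `|x - e|) *: (x - e)).
  have xe0 : 0 < `|x - e| by rewrite normr_gt0 subr_eq0; exact/eqP.
  split; first exact/affine_add/affine_sub.
  by rewrite addrC addKr normrZ gtr0_norm ?divr_gt0// divfK// gt_eqF.
have [z /set_mem[az zr] zmin] := compact_EVT_min A0 (sphere_compact rP)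
  (continuous_subspaceT Ham_continuous).
have ze : z <> e by move=> ze; move: zr r0; rewrite ze subrr normr0 => <-; rewrite ltxx.
have Hz := Ham_gt0 az ze.
exists (Ham M z); first exact: Hz.
move=> x ax Hx; apply: rP => //; rewrite leNgt; apply/negP => rx.
have xe0 : 0 < `|x - e| by exact: lt_trans rx.
pose y := e + (r / `|x - e|) *: (x - e).
have k0 : 0 < r / `|x - e| by rewrite divr_gt0.
have Ay : A y.
  split; first exact/affine_add/affine_sub.
  by rewrite /y addrC addKr normrZ gtr0_norm// divfK// gt_eqF.
have := zmin y (mem_set Ay); rewrite /y Ham_scale// => h.
have : r / `|x - e| < 1 by rewrite ltr_pdivrMr// mul1r.
have Hx0 : 0 < Ham M x by nra.
nra.
Qed.

(** * The two flows *)

(* Blowing up a best response solution by expR t about e turns it into a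
   solution of the Hamiltonian inclusion with clock expR t - 1. *)
Definition br_flow (t : R) x : V := e + expR (- t) *: (Psi (expR t - 1) x - e).

Lemma expR_clock (t : R) : 0 <= t -> 0 <= expR t - 1.
Proof. by move=> t0; rewrite subr_ge0 -expR0 ler_expR. Qed.

Lemma pair_eqP x y : (forall i, x.1 i 0 = y.1 i 0) -> (forall i, x.2 i 0 = y.2 i 0) -> x = y.
Proof.
by case: x y => ? ? [? ?] /= h1 h2; congr pair; apply/colP.
Qed.

(** Every strategy is a best reply to e, so [Psi_average] applies with x = e over any length of
    time. *)
Lemma Psi_simplex2 t x : simplex2 R n x ->
  exists2 c, simplex2 R n c & Psi t x = x + t *: (c - e).
Proof.
move=> sx; have [c xc xE] : exists2 c, BR e c & Psi t x = x + t *: (c - e).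
  apply: Psi_average; first exact: simplex2_affine.
  by move=> r _ b rb; apply: BR_e; exact: BR_simplex2 rb.
by exists c => //; exact: BR_simplex2 xc.
Qed.

Lemma simplex2_conv (r : R) x y : simplex2 R n x -> simplex2 R n y -> 0 <= r <= 1 ->
  simplex2 R n ((1 - r) *: x + r *: y).
Proof.
move=> [x1 x2] [y1 y2] r01.
by split; apply: face_simplex; apply: face_conv => //; exact: simplex_face.
Qed.

Lemma expRN_le1 (t : R) : 0 <= t -> expR (- t) <= 1.
Proof. by move=> t0; rewrite -expR0 ler_expR oppr_le0. Qed.

Lemma br_flow_simplex2 t x : simplex2 R n x -> 0 <= t -> simplex2 R n (br_flow t x).
Proof.
move=> sx t0; have [c sc cE] := Psi_simplex2 (expR t - 1) sx.
have E : expR (- t) * (expR t - 1) = 1 - expR (- t).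
  by rewrite mulrBr mulr1 -expRD addNr expR0.
have -> : br_flow t x = (1 - (1 - expR (- t))) *: x + (1 - expR (- t)) *: c.
  rewrite /br_flow cE -E.
  have := E; move: (expR (- t)) (expR t - 1) => a b ab.
  by apply: pair_eqP => i; rewrite /= !mxE ab; ring: ab.
by apply: simplex2_conv => //; rewrite subr_ge0 expRN_le1//= gerBl expR_ge0.
Qed.

Lemma Ham_br_flow t x : affine x -> Ham M (br_flow t x) = expR (- t) * Ham M x.
Proof. by move=> ax; rewrite Ham_scale ?expR_gt0// Ham_Psi. Qed.

Lemma br_flow0 x : affine x -> br_flow 0 x = x.
Proof.
by move=> ax; rewrite /br_flow oppr0 expR0 subrr scale1r Psi0// addrC subrK.
Qed.

Lemma br_flowD (s t : R) x : affine x -> br_flow (s + t) x = br_flow s (br_flow t x).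
Proof.
move=> ax; rewrite {2}/br_flow.
set y := br_flow t x.
have yE : y = e + expR (- t) *: (Psi (expR t - 1) x - e) by [].
(* The clock of the second run, dilated by [expR (- t)], starts where the first one stopped. *)
have -> : expR s - 1 = expR (- t) * (expR (s + t) - expR t).
  by rewrite mulrBr -!expRD addNr expR0 addrCA addNr addr0.
rewrite yE Psi_scale ?expR_gt0//; last exact: Psi_affine.
rewrite -PsiD// addrA subrK; set w := Psi _ _ - e.
by rewrite (addrC e (_ *: w)) addrK scalerA -expRD -opprD /br_flow.
Qed.

Lemma br_flow_ac x (a b : R) : affine x -> 0 <= a -> 0 <= b ->
  abs_continuous_on a b (br_flow ^~ x).
Proof.
move=> ax a0 b0; pose K := `|x - e| + 2 * (expR b * b).
apply: (@ac_dominated R R^o _ (fun=> 0) _ a b (2 * expR b + K)).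
- by move=> h h0; exists 1 => // N s t _ _ _; rewrite big1// => k _; rewrite subrr normr0.
- by rewrite !addr_ge0// mulr_ge0 ?expR_ge0// mulr_ge0// expR_ge0.
move=> s t a_s st tb; rewrite subrr normr0 add0r.
have s0 := le_trans a0 a_s; have t0 := le_trans s0 st.
have -> : br_flow t x - br_flow s x =
    expR (- t) *: (Psi (expR t - 1) x - Psi (expR s - 1) x) +
    (expR (- t) - expR (- s)) *: (Psi (expR s - 1) x - e).
  rewrite /br_flow; move: (Psi _ x) (Psi _ x) => y z.
  by apply: pair_eqP => i; rewrite /= !mxE; ring.
apply: le_trans (ler_normD _ _) _; rewrite !normrZ.
have h1 : `|Psi (expR t - 1) x - Psi (expR s - 1) x| <= 2 * (expR b * (t - s)).
  apply: le_trans (Psi_lipschitz _ _ ax) _; rewrite ler_pM2l//.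
  have -> : expR t - 1 - (expR s - 1) = expR t - expR s by ring.
  exact: expR_lipschitz.
have h2 : `|expR (- t)| <= 1 by rewrite ger0_norm ?expR_ge0// expRN_le1.
have h3 : `|expR (- t) - expR (- s)| <= t - s.
  rewrite distrC; have := @expR_lipschitz R 0 0 (- t) (- s).
  by rewrite lerN2 oppr_le0 expR0 mul1r (addrC (- s)) opprK; apply.
have h4 : `|Psi (expR s - 1) x - e| <= K.
  have -> : Psi (expR s - 1) x - e = (Psi (expR s - 1) x - Psi 0 x) + (x - e).
    by rewrite Psi0// addrA subrK.
  apply: le_trans (ler_normD _ _) _; rewrite addrC lerD2l.
  apply: le_trans (Psi_lipschitz _ _ ax) _; rewrite subr0 ler_pM2l//.
  have := @expR_lipschitz R 0 b 0 s s0 (le_trans st tb); rewrite expR0 subr0 => h.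
  by apply: le_trans h _; rewrite ler_pM2l ?expR_gt0// (le_trans st tb).
have ts0 : 0 <= t - s by rewrite subr_ge0.
have h5 : `|expR (- t)| * `|Psi (expR t - 1) x - Psi (expR s - 1) x| <= 1 * (2 * (expR b * (t - s))).
  exact: ler_pM.
have h6 : `|expR (- t) - expR (- s)| * `|Psi (expR s - 1) x - e| <= (t - s) * K.
  exact: ler_pM.
lra.
Qed.

Lemma br_flow_derive x (t : R) : affine x -> regular_time x (expR t - 1) ->
  exists2 v, br_field M (br_flow t x) v & is_derive t (1 : R) (br_flow ^~ x) v.
Proof.
move=> ax [c tc cE].
have g1 : @approx_at R R^o (fun s => expR s - 1) t (expR t).
  have -> : (fun s : R => expR s - 1) = (fun s => - 1 + expR s).
    by apply/funext => s; rewrite addrC.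
  exact: (@approx_shift R R^o _ _ _ (-1) (approx_expR t)).
have g2 : @approx_at R R^o (fun s => expR (- s)) t (- expR (- t)).
  have := @approx_chain R R^o expR -%R t (-1) (expR (- t)) (approx_expR _) (approx_opp t).
  by rewrite [_ *: _]mulN1r.
have u1 : approx_at (fun s => Psi (expR s - 1) x - e) t (expR t *: (c - e)).
  have -> : (fun s : R => Psi (expR s - 1) x - e) = (fun s => - e + Psi (expR s - 1) x).
    by apply/funext => s; rewrite addrC.
  apply: approx_shift; exact: (@approx_chain R V (Psi ^~ x) (fun s => expR s - 1) t (expR t) (c - e) cE g1).
(* This is c - [br_flow t x]: the exponentials cancel in the first term, and the second is -
   ([br_flow t x] - e). *)
exists (expR (- t) *: (expR t *: (c - e)) + (- expR (- t)) *: (Psi (expR t - 1) x - e)).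
  apply/br_fieldE; rewrite /br_flow BR_scale ?expR_gt0//.
  have -> : expR (- t) *: (expR t *: (c - e)) + - expR (- t) *: (Psi (expR t - 1) x - e) +
      (e + expR (- t) *: (Psi (expR t - 1) x - e)) = c; last exact: tc.
  rewrite scalerA -expRD addNr expR0 scale1r; move: (Psi _ _) (expR _) => y r.
  by apply: pair_eqP => i; rewrite /= !mxE; ring.
by apply: approx_is_derive; apply: approx_shift; exact: approx_scale g2 u1.
Qed.

Lemma br_flow_solution x : simplex2 R n x ->
  solution_on `[0, +oo[%classic (simplex2 R n) (br_field M) (br_flow ^~ x).
Proof.
move=> sx; have ax := simplex2_affine sx; split.
- by move=> t /=; rewrite in_itv/= andbT; exact: br_flow_simplex2.
- by move=> a b /=; rewrite !in_itv/= !andbT; exact: br_flow_ac.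
(* The clock is injective, so only countably many times hit irregular ones. *)
have cN : countable [set t : R | 0 <= t /\ ~ regular_time x (expR t - 1)].
  apply: (@countable_inj_preimage _ _ (fun t : R => expR t - 1)) (irregular_countable_pos ax).
    by move=> t [t0 nt]; split; first exact: expR_clock.
  by move=> t r _ _ /addIr/expR_inj.
apply: negligibleS (countable_negligible cN) => t /= nt.
apply: contrapT => h; apply: nt; rewrite in_itv/= andbT => t0.
by apply: br_flow_derive => //; apply: contrapT => nr; apply: h.
Qed.

Lemma approx_sub_e (u : R -> V) (t : R) (v : V) :
  approx_at u t v -> approx_at (fun s => u s - e) t v.
Proof.
move=> uv; have -> : (fun s : R => u s - e) = (fun s => - e + u s).
  by apply/funext => s; rewrite addrC.
exact: approx_shift.
Qed.

Lemma br_solution_ae_sol (J : set R) (c : R -> V) (t : R) :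
  is_interval J -> J `<=` `[0, +oo[%classic -> J 0 -> J t ->
  solution_on J (simplex2 R n) (br_field M) c ->
  ae_sol expR 0 t (fun s => e + expR s *: (c s - e)).
Proof.
move=> iJ J0' J0 Jt [cS cac cae].
have t0 : 0 <= t by have := J0' _ Jt; rewrite /= in_itv/= andbT.
have Js s : 0 <= s <= t -> J s by exact: iJ.
split.
- apply: (@ac_dominated _ _ _ c _ 0 t (2 * expR t) (cac 0 t J0 Jt)).
    by rewrite mulr_ge0// expR_ge0.
  move=> s r s0 sr rt.
  have -> : e + expR r *: (c r - e) - (e + expR s *: (c s - e)) =
     expR r *: (c r - c s) + (expR r - expR s) *: (c s - e).
    by apply: pair_eqP => i; rewrite /= !mxE; ring.
  apply: le_trans (ler_normD _ _) _; rewrite !normrZ.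
  have h1 : `|expR r| <= expR t by rewrite ger0_norm ?expR_ge0// ler_expR.
  have h2 := @expR_lipschitz R 0 t s r sr rt.
  have h3 : `|c s - e| <= 2 by apply: norm_sub_e; apply: cS; apply: Js; lra.
  have h4 : `|expR r| * `|c r - c s| <= expR t * `|c r - c s| by rewrite ler_wpM2r.
  have h5 : `|expR r - expR s| * `|c s - e| <= expR t * (r - s) * 2 by apply: ler_pM.
  have h6 : 0 <= expR t * `|c r - c s| by rewrite mulr_ge0// expR_ge0.
  lra.
- move=> s st; apply: affine_comb; first exact: e_affine.
  exact/simplex2_affine/cS/Js.
- exists (expR t); first exact: expR_ge0.
  by move=> s r _ sr rt; exact: (@expR_lipschitz R 0).
- by move=> s r _ sr _; rewrite ltr_expR.
exists (~` [set s | J s -> exists2 v, br_field M (c s) v & is_derive s (1 : R) c v]).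
  exact: cae.
move=> s st /contrapT/(_ (Js s st))[v /br_fieldE cv vE].
exists (v + c s), (expR s); split.
- by rewrite BR_scale ?expR_gt0.
- exact: expR_ge0.
- exact: approx_expR.
apply: approx_shift.
(* The growth of the factor [expR s] cancels the drift - c s of the best response field, leaving the
   reply v + c s. *)
have -> : expR s *: (v + c s - e) = expR s *: v + expR s *: (c s - e).
  by rewrite -scalerDr addrA.
exact: approx_scale (approx_expR s) (approx_sub_e (is_derive_approx vE)).
Qed.

Lemma br_flow_unique (J : set R) (c : R -> V) (t : R) :
  is_interval J -> J `<=` `[0, +oo[%classic -> J 0 -> J t ->
  solution_on J (simplex2 R n) (br_field M) c -> c t = br_flow t (c 0).
Proof.
move=> iJ J0' J0 Jt sc.
have t0 : 0 <= t by have := J0' _ Jt; rewrite /= in_itv/= andbT.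
have := ae_sol_unique_forward t0 (br_solution_ae_sol iJ J0' J0 Jt sc).
rewrite expR0 scale1r [e + (c 0 - e)]addrC subrK => h.
by rewrite /br_flow -h (addrC e (expR t *: _)) addrK scalerA -expRD addNr expR0 scale1r addrC subrK.
Qed.

Lemma br_flow_continuous (D : set V) : D `<=` simplex2 R n ->
  {within `[0, +oo[%classic `*` D, continuous (fun tx : R * V => br_flow tx.1 tx.2)}.
Proof.
move=> DS; apply: within_continuous_dist2 => t x; rewrite /= in_itv/= andbT.
move=> t0 /DS sx h h0; have ax := simplex2_affine sx.
have h20 : 0 < h / 2 by lra.
have [r r0 rP] := Psi_continuous (expR t - 1) ax h20.
pose K := `|Psi (expR t - 1) x - e| + 1.
have K0 : 0 < K by rewrite /K ltr_wpDl.
(* Up to time t + 1 the exponential has Lipschitz constant [expR (t + 1)], so r1 keeps the clock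
   within r. *)
pose r1 := Num.min 1 (r / expR (t + 1)).
have r10 : 0 < r1 by rewrite lt_min ltr01 divr_gt0 ?expR_gt0.
exists (Num.min r (Num.min r1 (h / (2 * K)))).
  by rewrite !lt_min r0 ltr01 !divr_gt0 ?expR_gt0 ?mulr_gt0.
move=> s y; rewrite /= in_itv/= andbT => s0 /DS sy.
have ay := simplex2_affine sy.
rewrite !lt_min => /andP[_ /andP[/andP[ts1 tsr] tsK]] /andP[yxr _].
have lip (a b : R) : a <= b -> b <= t + 1 -> `|expR b - expR a| <= expR (t + 1) * (b - a).
  by move=> ab bt; apply: (@expR_lipschitz R 0).
have ets : `|expR s - 1 - (expR t - 1)| < r.
  have -> : expR s - 1 - (expR t - 1) = expR s - expR t by ring.
  have h1 : expR (t + 1) * `|s - t| < r by rewrite mulrC -ltr_pdivlMr ?expR_gt0.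
  move: ts1 h1; rewrite ltr_norml => /andP[ts1 ts2].
  have [ts|st] := leP t s.
    by rewrite (ger0_norm (_ : 0 <= s - t)) ?subr_ge0// => h1; apply: le_lt_trans (lip _ _ ts _) h1; lra.
  rewrite (ltr0_norm (_ : s - t < 0)) ?subr_lt0// opprB => h1.
  by rewrite distrC; apply: le_lt_trans (lip _ _ (ltW st) _) h1; lra.
have h1 := rP _ _ ay ets yxr.
have -> : br_flow s y - br_flow t x =
    expR (- s) *: (Psi (expR s - 1) y - Psi (expR t - 1) x) +
    (expR (- s) - expR (- t)) *: (Psi (expR t - 1) x - e).
  rewrite /br_flow; move: (Psi _ x) (Psi _ y) => z w.
  by apply: pair_eqP => i; rewrite /= !mxE; ring.
apply: le_trans (ler_normD _ _) _; rewrite !normrZ.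
have h2 : `|expR (- s)| <= 1 by rewrite ger0_norm ?expR_ge0// expRN_le1.
have lipN (a b : R) : 0 <= a -> a <= b -> `|expR (- a) - expR (- b)| <= b - a.
  move=> a0 ab; have := @expR_lipschitz R 0 0 (- b) (- a).
  by rewrite lerN2 oppr_le0 expR0 mul1r (addrC (- a)) opprK; apply.
have h3 : `|expR (- s) - expR (- t)| <= `|s - t|.
  have [ts|st] := leP t s.
    have := lipN t s t0 ts; rewrite distrC => h4; apply: le_trans h4 (ler_norm _).
  have h4 := lipN s t s0 (ltW st); apply: le_trans h4 _.
  by rewrite distrC; exact: ler_norm.
have h5 : `|expR (- s)| * `|Psi (expR s - 1) y - Psi (expR t - 1) x| <= 1 * (h / 2).
  exact: ler_pM.
have h6 : `|expR (- s) - expR (- t)| * `|Psi (expR t - 1) x - e| <= `|s - t| * K.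
  by apply: ler_pM => //; rewrite /K lerDl.
have h7 : `|s - t| * K <= h / 2.
  have -> : h / 2 = (h / (2 * K)) * K by field; rewrite gt_eqF.
  by rewrite ler_pM2r// ltW.
lra.
Qed.

Lemma br_is_flow :
  is_flow `[0, +oo[%classic (simplex2 R n) (br_field M) (simplex2 R n `\ e) br_flow.
Proof.
split.
- move=> t x; rewrite /= in_itv/= andbT => t0 [sx xe].
  have ax := simplex2_affine sx; split; first exact: br_flow_simplex2.
  (* [Ham M] decays exactly by the factor [expR (- t)], so e is not reached in finite time. *)
  move=> be; have := Ham_gt0 ax xe.
  have : Ham M (br_flow t x) = 0 by rewrite be Ham_e.
  rewrite Ham_br_flow// => /eqP; rewrite mulf_eq0 gt_eqF ?expR_gt0//= => /eqP ->.
  by rewrite ltxx.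
- by move=> x [/simplex2_affine ax _]; exact: br_flow0.
- by move=> s t x _ _ [/simplex2_affine ax _]; exact: br_flowD.
- by move=> x [sx _]; exact: br_flow_solution.
- move=> x J c [sx _] iJ J0' J0 sc cx t Jt.
  by rewrite -cx; exact: br_flow_unique iJ J0' J0 Jt sc.
- by apply: br_flow_continuous => x [].
Qed.

Lemma Psi_solution (x : V) : affine x -> (forall t, simplex2 R n (Psi t x)) ->
  solution_on [set: R] (simplex2 R n) (ham_field M M) (Psi ^~ x).
Proof.
move=> ax sP; split.
- by move=> t _; exact: sP.
- by move=> a b _ _; exact: Psi_ac.
apply: negligibleS (irregular_negligible ax) => t /= nt rt; apply: nt => _.
have [c tc cE] := rt; exists (c - e); last exact: approx_is_derive.
by apply/ham_fieldE; exists c.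
Qed.

Lemma ham_solution_ae_sol (J : set R) (c : R -> V) (a b : R) :
  is_interval J -> J a -> J b ->
  solution_on J (simplex2 R n) (ham_field M M) c -> ae_sol id a b c.
Proof.
move=> iJ Ja Jb [cS cac cae].
have Js s : a <= s <= b -> J s by exact: iJ.
split.
- exact: cac.
- by move=> s /Js/cS/simplex2_affine.
- by exists 1 => // s t _ st _; rewrite mul1r ger0_norm// subr_ge0.
- by [].
exists (~` [set s | J s -> exists2 v, ham_field M M (c s) v & is_derive s (1 : R) c v]).
  exact: cae.
move=> s st /contrapT/(_ (Js s st))[v /ham_fieldE[k ck vE] cv].
exists k, 1; split=> //.
  move=> h h0; exists 1; first exact: ltr01.
  by move=> r _; rewrite [(r - s) *: _]mulr1 subrr normr0 mulr_ge0// ltW.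
by rewrite scale1r -vE; exact: is_derive_approx.
Qed.

(** Below rho0 the levels in the affine hull already lie in the simplices, so conservation of
    [Ham M] keeps [Psi] in the state space for all times. *)
Lemma ham_is_flow (rho rho0 : R) :
  (forall x, affine x -> Ham M x < rho0 -> simplex2 R n x) -> rho < rho0 ->
  is_flow [set: R] (simplex2 R n) (ham_field M M) (Ham_level M rho) Psi.
Proof.
move=> small rr.
have stay t x : Ham_level M rho x -> Ham_level M rho (Psi t x).
  move=> [/simplex2_affine ax Hx]; split; last by rewrite /= Ham_Psi.
  by apply: small; [exact: Psi_affine|rewrite Ham_Psi// Hx].
split.
- by move=> t x _; exact: stay.
- by move=> x [/simplex2_affine ax _]; exact: Psi0.
- by move=> s t x _ _ [/simplex2_affine ax _]; exact: PsiD.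
- move=> x xl; have [/simplex2_affine ax _] := xl.
  by apply: Psi_solution => // t; have [] := stay t x xl.
- move=> x J c [/simplex2_affine ax _] iJ _ J0 sc cx t Jt.
  have [t0|/ltW t0] := leP 0 t.
    have := ae_sol_unique_forward t0 (ham_solution_ae_sol iJ J0 Jt sc).
    by rewrite subr0 cx.
  have := ae_sol_unique_backward t0 (ham_solution_ae_sol iJ Jt J0 sc).
  by rewrite subr0 cx.
- apply: within_continuous_dist2 => t x _ [/simplex2_affine ax _] h h0.
  have [r r0 rP] := Psi_continuous t ax h0; exists r; first exact: r0.
  by move=> s y _ [/simplex2_affine ay _]; exact: rP.
Qed.

(** [Ham M] vanishes at e and is linear along the ray, with the positive slope [Ham M (e + v)]. *)
Lemma half_ray_level (rho rho0 : R) v :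
  (forall x, affine x -> Ham M x < rho0 -> simplex2 R n x) -> 0 < rho < rho0 ->
  tangent2 R n v -> v <> 0 ->
  (half_ray e v `&` Ham_level M rho) (e + (rho / Ham M (e + v)) *: v) /\
  forall z, (half_ray e v `&` Ham_level M rho) z -> z = e + (rho / Ham M (e + v)) *: v.
Proof.
move=> small /andP[rho_gt0 rr] tv v0.
have av : affine (e + v) by rewrite -[v]scale1r; exact: affine_add.
have Hv : 0 < Ham M (e + v).
  apply: Ham_gt0 => // ev; apply: v0; apply: (addrI e); rewrite addr0; exact: ev.
have HE (r : R) : 0 < r -> Ham M (e + r *: v) = r * Ham M (e + v).
  by move=> r0; rewrite -[in RHS]Ham_scale// (addrC e v) addrK.
split.
  have k0 : 0 < rho / Ham M (e + v) by rewrite divr_gt0.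
  have Hk : Ham M (e + (rho / Ham M (e + v)) *: v) = rho by rewrite HE// divfK// gt_eqF.
  split; first by exists (rho / Ham M (e + v)) => //; exact: ltW.
  by split => //; apply: small; [exact: affine_add|rewrite Hk].
move=> z [[r /= r0 <-] [_ /= Hz]].
have r_gt0 : 0 < r.
  rewrite lt_neqAle r0 andbT; apply/eqP => rz; move: Hz rho_gt0.
  by rewrite -rz scale0r addr0 Ham_e => <-; rewrite ltxx.
by move: Hz; rewrite HE// => <-; rewrite mulfK// gt_eqF.
Qed.

Definition ray_proj (rho : R) x : V := e + (rho / Ham M x) *: (x - e).

Lemma ray_proj_level (rho rho0 : R) x :
  (forall x, affine x -> Ham M x < rho0 -> simplex2 R n x) -> 0 < rho < rho0 ->
  (simplex2 R n `\ e) x -> (half_ray e (x - e) `&` Ham_level M rho) (ray_proj rho x).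
Proof.
move=> small rr [sx xe].
have xE : e + (x - e) = x by rewrite addrC subrK.
have := half_ray_level small rr (affine_sub (simplex2_affine sx)).
rewrite xE => H; have [|+ _] := H; last exact.
by move=> /eqP; rewrite subr_eq0 => /eqP.
Qed.

(** Normalising by [Ham M] undoes the factor [expR (- t)]. What remains is the constant dilation by
    rho / [Ham M x], which [Psi_scale] turns into a change of clock. *)
Lemma ray_proj_br_flow (rho t : R) x : 0 < rho -> (simplex2 R n `\ e) x ->
  ray_proj rho (br_flow t x) = Psi (rho / Ham M x * (expR t - 1)) (ray_proj rho x).
Proof.
move=> rho0 [sx xe]; have ax := simplex2_affine sx; have Hx := Ham_gt0 ax xe.
rewrite /ray_proj Psi_scale ?divr_gt0// Ham_br_flow// /br_flow.
rewrite (addrC e (expR (- t) *: _)) addrK scalerA; congr (_ + _ *: _).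
by field; rewrite !gt_eqF// expR_gt0.
Qed.

Lemma ray_proj_continuous (rho : R) : {within simplex2 R n `\ e, continuous (ray_proj rho)}.
Proof.
apply/subspace_continuousP => x [sx xe].
have Hx := Ham_gt0 (simplex2_affine sx) xe.
apply: cvg_trans (_ : ray_proj rho @ nbhs x --> ray_proj rho x).
  by apply: cvg_app; exact: cvg_within.
apply: (@cvgD _ V); first exact: cvg_cst.
apply: (@cvgZ _ V).
  apply: (@cvgM R); first exact: cvg_cst.
  by apply: cvgV; [rewrite gt_eqF|exact: Ham_continuous].
by apply: (@cvgB _ V); [exact: cvg_id|exact: cvg_cst].
Qed.

End ZeroSum.

Theorem mainTheorem2 (R : realType) (n : nat) (n_gt0 : (0 < n)%N) :
  exists W : set 'M[R]_n,
    [/\ W `<=` LI R n, open W, LI R n `<=` closure W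
      & lebesgue_null (LI R n `\` W)] /\
    forall (M : 'M[R]_n) (e : 'cV[R]_n * 'cV[R]_n),
      W M -> completely_mixed M e ->
      nash M = [set e] /\
      exists phi : R -> 'cV[R]_n * 'cV[R]_n -> 'cV[R]_n * 'cV[R]_n,
        is_flow `[0, +oo[%classic (simplex2 R n) (br_field M)
          (simplex2 R n `\ e) phi /\
      exists2 rho0 : R, 0 < rho0 & forall rho : R, 0 < rho < rho0 ->
        (forall v, tangent2 R n v -> v <> 0 ->
          exists! z, (half_ray e v `&` Ham_level M rho) z) /\
        exists proj : 'cV[R]_n * 'cV[R]_n -> 'cV[R]_n * 'cV[R]_n,
          [/\ forall x, (simplex2 R n `\ e) x ->
                (half_ray e (x - e) `&` Ham_level M rho) (proj x),
              {within simplex2 R n `\ e, continuous proj},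
              symplectic M
            & exists psi : R -> 'cV[R]_n * 'cV[R]_n -> 'cV[R]_n * 'cV[R]_n,
                is_flow [set: R] (simplex2 R n) (ham_field M M)
                  (Ham_level M rho) psi /\
                (* psi runs along proj \o phi after the change of time
                   t |-> expR t - 1 on the level set of rho, and
                   t |-> rho / h * (expR t - 1) on the level set of h *)
                forall x t, (simplex2 R n `\ e) x -> 0 <= t ->
                  proj (phi t x) =
                  psi (rho / Ham M x * (expR t - 1)) (proj x)].

Proof.
exists (LI R n `&` [set M | regular M]); split.
  have [oW dW nW] := @regular_LI_open_dense_conull R n n_gt0.
  by split=> // M [].
move=> M e [_ /= regM] emix; split; first exact: nash_e.
exists (br_flow n_gt0 regM emix); split; first exact: br_is_flow.
have [rho0 rho0_gt0 small] := small_level_in_simplex n_gt0 regM emix.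
exists rho0; first exact: rho0_gt0.
move=> rho rr; have /andP[rho_gt0 rho_lt] := rr; split.
  move=> v tv v0; have [zl zu] := half_ray_level n_gt0 regM emix small rr tv v0.
  by exists (e + (rho / Ham M (e + v)) *: v); split=> // z /zu.
exists (ray_proj M e rho); split.
- by move=> x; exact: ray_proj_level small rr.
- exact: ray_proj_continuous.
- exact: symplecticM emix.
- exists (Psi n_gt0 regM emix); split; first exact: ham_is_flow small rho_lt.
  by move=> x t xD _; exact: ray_proj_br_flow.
Qed.
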